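(* Let $K$ be a field and let $\Lambda = KQ/I$ be the truncated path algebra of Loewy length $L+1$ (with $L\ge 1$) on a finite quiver $Q$ with vertices $e_1,\dots,e_n$. Let $\mathbb{S}=(\mathbb{S}_0,\dots,\mathbb{S}_L)$ be a sequence of semisimple $\Lambda$-modules of total dimension $d$ with $\mathbf{Mod}(\mathbb{S})\ne\varnothing$, and let $s(j,l)$ be the multiplicity of the simple module $S_j$ in $\mathbb{S}_l$. Let $n_1,\dots,n_v$ be the different elements of $\mathbb{N}\cup\{0,\infty\}$ which have the form $1 + l\text{-}\deg(c(e_j))$ with $l\ge 1$ and $s(j,l)>0$ and which are strictly larger than $\operatorname{p\,dim}\mathbb{S}$. Then the range of values $$\{\operatorname{p\,dim} M \mid M \text{ in } \overline{\mathbf{Mod}(\mathbb{S})}\}$$ of the function $\operatorname{p\,dim}$ on the closure of $\mathbf{Mod}(\mathbb{S})$ in $\mathbf{Mod}_d(\Lambda)$ is equal to the following coinciding sets: $$\{\operatorname{p\,dim}\mathbb{S}' \mid \mathbb{S}' \ge \mathbb{S},\ \mathbf{Mod}(\mathbb{S}')\ne\varnothing\} = \{\operatorname{p\,dim}\mathbb{S}\}\cup\{n_1,\dots,n_v\}.$$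
   Context: $L$ is a positive integer, $K$ a field, $Q$ a finite quiver, $\Lambda = KQ/I$ with $I \subseteq KQ$ the ideal generated by all paths of length $L+1$, and $J$ is the Jacobson radical of $\Lambda$. Modules are left modules; $p'p$ means ''$p'$ after $p$'' for paths. The vertices $e_1,\dots,e_n$ are identified with the corresponding primitive idempotents of $\Lambda$, and $S_i=\Lambda e_i/Je_i$. $\operatorname{p\,dim}$ denotes projective dimension. $c(e)\in\mathbb{N}\cup\{0,\infty\}$ is the supremum of the lengths of the paths in $KQ$ starting in the vertex $e$. For $0\le l\le L$ and an integer $c\ge 0$, $l\text{-}\deg(c) = [\frac{c}{L+1}] + [\frac{c+l}{L+1}]$, where $[x]$ is the largest integer $\le x$; $l\text{-}\deg(\infty)=\infty$, and $1+\infty=\infty$. With the algebra generators $a_1,\dots,a_r$ of $\Lambda$ given by the vertices and the residue classes of the arrows, $\mathbf{Mod}_d(\Lambda)$ is the affine variety of tuples $(x_i)\in\prod_{i\le r}\operatorname{End}_K(K^d)$ satisfying all relations satisfied by the $a_i$; each point $x$ gives a $d$-dimensional module on $K^d$ via $a_iv=x_i(v)$. The modules represented by the points of a subvariety $\mathcal{C}$ are called the modules in $\mathcal{C}$. The radical layering of a finitely generated module $M$ is $\mathbb{S}(M)=(J^lM/J^{l+1}M)_{0\le l\le L}$; isomorphic semisimple modules are identified. A sequence $\mathbb{S}=(\mathbb{S}_0,\dots,\mathbb{S}_L)$ of semisimple modules has total dimension $d=\sum_l\dim_K\mathbb{S}_l$, and $\mathbf{Mod}(\mathbb{S})$ is the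 set of points of $\mathbf{Mod}_d(\Lambda)$ corresponding to modules with radical layering $\mathbb{S}$; its closure in $\mathbf{Mod}_d(\Lambda)$ is denoted $\overline{\mathbf{Mod}(\mathbb{S})}$. All modules with the same radical layering $\mathbb{S}$ have the same projective dimension; this common value is denoted $\operatorname{p\,dim}\mathbb{S}$ (for $\mathbf{Mod}(\mathbb{S})\neq\varnothing$). Partial order: for two sequences $\mathbb{S},\mathbb{S}'$ of semisimple modules with $\bigoplus_{0\le l\le L}\mathbb{S}_l=\bigoplus_{0\le l\le L}\mathbb{S}'_l$ (up to isomorphism), $\mathbb{S}'\ge\mathbb{S}$ means that $\bigoplus_{l\le r}\mathbb{S}_l$ is a direct summand of $\bigoplus_{l\le r}\mathbb{S}'_l$ for all $r\ge 0$.
   Formalization: For finite K the set of K-points is discrete and the claim fails (K=F_2, Q=e_1→e_2, L=1, S=(S_1,S_2): {0} vs {0,1}); the literal closure is treated for infinite K, and for every K the closure is taken via polynomials over K vanishing on Mod(S) over all field extensions. *)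

(* Defs.v *)
From HB Require Import structures.
From mathcomp Require Import all_boot all_order all_algebra.
From mathcomp Require mpoly.
From mathcomp Require Import finmap monalg.
From mathcomp Require Import boolp classical_sets.

Set Implicit Arguments.
Unset Strict Implicit.
Unset Printing Implicit Defensive.

Import GRing.Theory.
Local Open Scope classical_set_scope.
Local Open Scope ring_scope.
Local Open Scope quotient_scope.

Record quiver := Quiver {
  vertex : finType;
  arrow : finType;
  src : arrow -> vertex;
  tgt : arrow -> vertex
}.

Section Paths.
Variable Q : quiver.

Fixpoint composable (v : vertex Q) (s : seq (arrow Q)) : bool :=
  if s is a :: s' then (src a == v) && composable (tgt a) s' else true.

(* A path is its starting vertex together with its arrows listed in the order
   in which they are traversed; the vertex v is the path (v, [::]). *)
Record qpath := QPath {
  qpath_val :> vertex Q * seq (arrow Q);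
  qpath_valP : composable qpath_val.1 qpath_val.2
}.

HB.instance Definition _ := [isSub for qpath_val].
HB.instance Definition _ := [Choice of qpath by <:].

Definition pstart (p : qpath) : vertex Q := p.1.
Definition pend (p : qpath) : vertex Q := last p.1 (map (@tgt Q) p.2).
Definition plength (p : qpath) : nat := size p.2.

Definition vpath (v : vertex Q) : qpath := @QPath (v, [::]) isT.

Lemma apath_subproof (a : arrow Q) : composable (src a) [:: a].
Proof. by rewrite /= eqxx. Qed.

Definition apath (a : arrow Q) : qpath :=
  @QPath (src a, [:: a]) (apath_subproof a).

Lemma composable_cat v s t :
  composable v (s ++ t) =
  composable v s && composable (last v (map (@tgt Q) s)) t.
Proof. by elim: s v => //= a s IHs v; rewrite IHs andbA. Qed.

(* the path "p' after p", when its two pieces are composable *)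
Definition pcomp (p' p : qpath) : option qpath :=
  if pend p == pstart p' then insub (p.1, p.2 ++ p'.2) else None.

Lemma pcompP p' p q : pcomp p' p = Some q <->
  pend p = pstart p' /\ (q : vertex Q * seq (arrow Q)) = (p.1, p.2 ++ p'.2).
Proof.
rewrite /pcomp; case: eqP => [e|ne]; last by split=> // -[].
case: insubP => [u _ eu|/negP[]].
  split=> [[<-]|[_ eq]] //; congr Some; apply: val_inj.
  by rewrite /= in eu *; rewrite eu eq.
by rewrite /= composable_cat qpath_valP /= -/(pend p) e; apply: qpath_valP.
Qed.

Lemma pcompA p3 p2 p1 :
  obind (pcomp p3) (pcomp p2 p1) = obind (pcomp^~ p1) (pcomp p3 p2).
Proof.
have endc p q r : pcomp p q = Some r -> pend r = pend p.
  move=> /pcompP[e er]; rewrite /pend er /= map_cat last_cat.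
  by rewrite -/(pend q) e.
have startc p q r : pcomp p q = Some r -> pstart r = pstart q.
  by move=> /pcompP[_ er]; rewrite /pstart er.
have def p q : pend q = pstart p -> exists r, pcomp p q = Some r.
  move=> e; exists (insubd p (q.1, q.2 ++ p.2)); rewrite /pcomp e eqxx.
  rewrite /insubd; case: insubP => // /negP[].
  by rewrite /= composable_cat qpath_valP /= -/(pend q) e; apply: qpath_valP.
case e21: (pcomp p2 p1) => [q|]; case e32: (pcomp p3 p2) => [r|] //=.
- have [h1 k1] := (pcompP _ _ _).1 e21; have [h2 k2] := (pcompP _ _ _).1 e32.
  by rewrite /pcomp (endc _ _ _ e21) (startc _ _ _ e32) h1 h2 !eqxx k1 k2 catA.
- case e: (pcomp p3 q) => [r|] //; have [h _] := (pcompP _ _ _).1 e.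
  by have [|r'] := def p3 p2; rewrite ?e32 // -h (endc _ _ _ e21).
- case e: (pcomp r p1) => [q|] //; have [h _] := (pcompP _ _ _).1 e.
  by have [|r'] := def p2 p1; rewrite ?e21 // h (startc _ _ _ e32).
Qed.

Lemma pcomp_vl v p : pcomp (vpath v) p = if pend p == v then Some p else None.
Proof.
rewrite /pcomp /pstart /=; case: eqP => // _; rewrite cats0.
by rewrite -surjective_pairing; apply: valK.
Qed.

Lemma pcomp_vr v p : pcomp p (vpath v) = if pstart p == v then Some p else None.
Proof.
rewrite /pcomp /pend /= eq_sym; case: eqP => // <- /=.
by rewrite /pstart -surjective_pairing; apply: valK.
Qed.

End Paths.

HB.lock Definition path_elt (K : fieldType) (Q : quiver) (p : qpath Q)
  : {malg K[qpath Q]} := << p >>.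

Definition opath_elt (K : fieldType) (Q : quiver) (q : option (qpath Q))
  : {malg K[qpath Q]} := oapp (@path_elt K Q) 0 q.

(* bilinear extension of: p' * p = p'p if the paths are composable, else 0 *)
HB.lock Definition pa_mul (K : fieldType) (Q : quiver)
    (x y : {malg K[qpath Q]}) : {malg K[qpath Q]} :=
  \sum_(p' <- msupp x) \sum_(p <- msupp y)
    (x@_p' * y@_p) *: opath_elt K (pcomp p' p).

Section PathAlgebra.
Variables (K : fieldType) (Q : quiver).
Local Notation kQ := {malg K[qpath Q]}.
Local Notation pathb := (@path_elt K Q).
Local Notation opathb := (@opath_elt K Q).
Local Notation pa_mul := (@pa_mul K Q).

Definition pa_one : kQ := \sum_(v : vertex Q) pathb (vpath v).

Lemma pathbE p : pathb p = << p >>.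
Proof. by rewrite path_elt.unlock. Qed.

Lemma pa_mulE x y : pa_mul x y =
  \sum_(p' <- msupp x) \sum_(p <- msupp y)
    (x@_p' * y@_p) *: opathb (pcomp p' p).
Proof. by rewrite pa_mul.unlock. Qed.

Lemma pa_mulw (d1 d2 : {fset qpath Q}) (x y : kQ) :
  (msupp x `<=` d1)%fset -> (msupp y `<=` d2)%fset ->
  pa_mul x y =
  \sum_(p' <- d1) \sum_(p <- d2) (x@_p' * y@_p) *: opathb (pcomp p' p).
Proof.
move=> le_d1 le_d2; rewrite pa_mulE (big_fset_incl _ le_d1) /=.
  apply/eq_bigr=> k1 _; apply/big_fset_incl => // k _ /mcoeff_outdom ->.
  by rewrite mulr0 scale0r.
move=> k _ /mcoeff_outdom xk.
by rewrite big1 => // k' _; rewrite xk mul0r scale0r.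
Qed.

Lemma pa_mulDl : left_distributive pa_mul +%R.
Proof.
move=> x y z.
rewrite (pa_mulw (msuppD_le _ _) (fsubset_refl _)).
rewrite (@pa_mulw (msupp x `|` msupp y)%fset (msupp z) x) ?fsubsetUl //.
rewrite (@pa_mulw (msupp x `|` msupp y)%fset (msupp z) y) ?fsubsetUr //.
rewrite -big_split /=; apply/eq_bigr=> k1 _.
rewrite -big_split /=; apply/eq_bigr=> k2 _.
by rewrite mcoeffD mulrDl scalerDl.
Qed.

Lemma pa_mulDr : right_distributive pa_mul +%R.
Proof.
move=> z x y.
rewrite (pa_mulw (fsubset_refl _) (msuppD_le _ _)).
rewrite (@pa_mulw (msupp z) (msupp x `|` msupp y)%fset z x) ?fsubsetUl //.
rewrite (@pa_mulw (msupp z) (msupp x `|` msupp y)%fset z y) ?fsubsetUr //.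
rewrite -big_split /=; apply/eq_bigr=> k1 _.
rewrite -big_split /=; apply/eq_bigr=> k2 _.
by rewrite mcoeffD mulrDr scalerDl.
Qed.

Lemma pa_mul0 x : pa_mul 0 x = 0.
Proof. by apply: (addrI (pa_mul 0 x)); rewrite -pa_mulDl !addr0. Qed.

Lemma pa_mulx0 x : pa_mul x 0 = 0.
Proof. by apply: (addrI (pa_mul x 0)); rewrite -pa_mulDr !addr0. Qed.

Lemma pa_scaleAl c x y : c *: pa_mul x y = pa_mul (c *: x) y.
Proof.
rewrite (pa_mulw (msuppZ_le _ _) (fsubset_refl _)) pa_mulE scaler_sumr.
apply/eq_bigr=> k1 _; rewrite scaler_sumr; apply/eq_bigr=> k2 _.
by rewrite mcoeffZ scalerA mulrA.
Qed.

Lemma pa_scaleAr c x y : c *: pa_mul x y = pa_mul x (c *: y).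
Proof.
rewrite (pa_mulw (fsubset_refl _) (msuppZ_le _ _)) pa_mulE scaler_sumr.
apply/eq_bigr=> k1 _; rewrite scaler_sumr; apply/eq_bigr=> k2 _.
by rewrite mcoeffZ scalerA mulrCA.
Qed.

Lemma pa_mulbb p' p : pa_mul (pathb p') (pathb p) = opathb (pcomp p' p).
Proof.
rewrite !pathbE (pa_mulw msuppU_le msuppU_le) !big_seq_fset1 !mcoeffUU.
by rewrite mulr1 scale1r.
Qed.

Lemma pathalgE (x : kQ) : x = \sum_(p <- msupp x) x@_p *: pathb p.
Proof.
rewrite {1}[x]monalgE; apply: eq_bigr => p _; rewrite pathbE.
by apply/malgP=> k; rewrite (mcoeffU p x@_p) (mcoeffZ x@_p << p >>)
  (mcoeffU p 1) mulrnAr mulr1.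
Qed.

Lemma pa_suml I (r : seq I) (F : I -> kQ) y :
  pa_mul (\sum_(i <- r) F i) y = \sum_(i <- r) pa_mul (F i) y.
Proof. exact: (big_morph (pa_mul^~ y) (fun _ _ => pa_mulDl _ _ _) (pa_mul0 _)). Qed.

Lemma pa_sumr I (r : seq I) (F : I -> kQ) y :
  pa_mul y (\sum_(i <- r) F i) = \sum_(i <- r) pa_mul y (F i).
Proof. exact: (big_morph (pa_mul y) (fun _ _ => pa_mulDr _ _ _) (pa_mulx0 _)). Qed.

Lemma pa_mul1 : left_id pa_one pa_mul.
Proof.
move=> x; rewrite [x]pathalgE pa_sumr; apply: eq_bigr => p _.
rewrite -pa_scaleAr; congr (_ *: _).
rewrite pa_suml (bigD1 (pend p)) //= pa_mulbb pcomp_vl eqxx big1 ?addr0 //.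
by move=> v /negPf ne; rewrite pa_mulbb pcomp_vl eq_sym ne.
Qed.

Lemma pa_mulx1 : right_id pa_one pa_mul.
Proof.
move=> x; rewrite [x]pathalgE pa_suml; apply: eq_bigr => p _.
rewrite -pa_scaleAl; congr (_ *: _).
rewrite pa_sumr (bigD1 (pstart p)) //= pa_mulbb pcomp_vr eqxx big1 ?addr0 //.
by move=> v /negPf ne; rewrite pa_mulbb pcomp_vr eq_sym ne.
Qed.

Lemma pathalg_ext (f g : kQ -> kQ) :
  {morph f : x y / x + y} -> {morph g : x y / x + y} ->
  (forall c x, f (c *: x) = c *: f x) ->
  (forall c x, g (c *: x) = c *: g x) ->
  (forall p, f (pathb p) = g (pathb p)) -> f =1 g.
Proof.
move=> fD gD fZ gZ fg x.
have f0 : f 0 = 0 by rewrite -(scale0r (0 : kQ)) fZ !scale0r.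
have g0 : g 0 = 0 by rewrite -(scale0r (0 : kQ)) gZ !scale0r.
rewrite (pathalgE x) (big_morph f fD f0) (big_morph g gD g0).
by apply: eq_bigr => p _; rewrite fZ gZ fg.
Qed.

Lemma pa_mulA : associative pa_mul.
Proof.
move=> x y z; move: x.
apply: (pathalg_ext (f := pa_mul^~ (pa_mul y z))
                    (g := fun x => pa_mul (pa_mul x y) z)).
- by move=> u v; apply: pa_mulDl.
- by move=> u v /=; rewrite (pa_mulDl u v y) pa_mulDl.
- by move=> c u; apply/esym/pa_scaleAl.
- by move=> c u /=; rewrite (pa_scaleAl c (pa_mul u y) z) (pa_scaleAl c u y).
move=> p; move: y.
apply: (pathalg_ext (f := fun y => pa_mul (pathb p) (pa_mul y z))
                    (g := fun y => pa_mul (pa_mul (pathb p) y) z)).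
- by move=> u v /=; rewrite (pa_mulDl u v z) pa_mulDr.
- by move=> u v /=; rewrite (pa_mulDr _ u v) pa_mulDl.
- by move=> c u /=; rewrite (pa_scaleAr c (pathb p) (pa_mul u z)) (pa_scaleAl c u z).
- by move=> c u /=; rewrite (pa_scaleAl c (pa_mul (pathb p) u) z) (pa_scaleAr c (pathb p) u).
move=> q; move: z.
apply: (pathalg_ext (f := fun z => pa_mul (pathb p) (pa_mul (pathb q) z))
                    (g := pa_mul (pa_mul (pathb p) (pathb q)))).
- by move=> u v /=; rewrite (pa_mulDr _ u v) pa_mulDr.
- by move=> u v; apply: pa_mulDr.
- by move=> c u /=; rewrite (pa_scaleAr c (pathb p) (pa_mul (pathb q) u)) (pa_scaleAr c (pathb q) u).
- by move=> c u; apply/esym/pa_scaleAr.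
move=> r /=.
rewrite (pa_mulbb q r) (pa_mulbb p q); have := pcompA p q r.
case: (pcomp q r) => [s|]; case: (pcomp p q) => [t|] /= e //.
- by rewrite (pa_mulbb p s) (pa_mulbb t r) e.
- by rewrite (pa_mulbb p s) pa_mul0 e.
- by rewrite (pa_mulbb t r) pa_mulx0 -e.
- by rewrite pa_mul0 pa_mulx0.
Qed.

Definition pathalg := {malg K[qpath Q]}.
HB.instance Definition _ := GRing.Lmodule.on pathalg.
HB.instance Definition _ := GRing.Zmodule_isPzRing.Build pathalg
  pa_mulA pa_mul1 pa_mulx1 pa_mulDl pa_mulDr.

End PathAlgebra.

Definition ideal_gen (R : pzRingType) (X : set R) : set R :=
  [set x | exists2 s : seq (R * R * R), (forall t, t \in s -> X t.1.2)
         & x = \sum_(t <- s) t.1.1 * t.1.2 * t.2].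

Section TruncatedPathAlgebra.
Variables (K : fieldType) (Q : quiver) (L : nat).
Local Notation KQ := (pathalg K Q).

Definition long_paths : set KQ :=
  [set x | exists2 p : qpath Q, plength p = L.+1 & x = path_elt K p].

Definition trunc_ideal : {pred KQ} := fun x => `[< ideal_gen long_paths x >].

Lemma trunc_idealP x : reflect (ideal_gen long_paths x) (x \in trunc_ideal).
Proof. exact: asboolP. Qed.

Lemma trunc_ideal_mull a x : x \in trunc_ideal -> a * x \in trunc_ideal.
Proof.
move=> /trunc_idealP[s sX ->]; apply/trunc_idealP.
exists [seq (a * t.1.1, t.1.2, t.2) | t <- s] => [t /mapP[u us ->]|].
  exact: (sX u us).
by rewrite big_map mulr_sumr; apply: eq_bigr => t _; rewrite /= !mulrA.
Qed.

Lemma trunc_ideal_mulr a x : x \in trunc_ideal -> x * a \in trunc_ideal.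
Proof.
move=> /trunc_idealP[s sX ->]; apply/trunc_idealP.
exists [seq (t.1.1, t.1.2, t.2 * a) | t <- s] => [t /mapP[u us ->]|].
  exact: (sX u us).
by rewrite big_map mulr_suml; apply: eq_bigr => t _; rewrite /= !mulrA.
Qed.

Lemma trunc_ideal_zmod_closed : zmod_closed trunc_ideal.
Proof.
split=> [|x y xI /(trunc_ideal_mull (-1))]; rewrite ?mulN1r.
  by apply/trunc_idealP; exists [::]; rewrite ?big_nil.
move: xI => /trunc_idealP[s sX ->] /trunc_idealP[t tX ->].
apply/trunc_idealP; exists (s ++ t); rewrite ?big_cat // => u.
by rewrite mem_cat => /orP[/sX|/tX].
Qed.

HB.instance Definition _ :=
  GRing.isZmodClosed.Build KQ trunc_ideal trunc_ideal_zmod_closed.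

Definition tpalg := {ideal_quot trunc_ideal}.
HB.instance Definition _ := GRing.Zmodule.on tpalg.
HB.instance Definition _ := EqQuotient.on tpalg.

Definition tpi (x : KQ) : tpalg := \pi_tpalg x.

Lemma tpiP x y : tpi x = tpi y <-> x - y \in trunc_ideal.
Proof.
split=> [/eqP|h]; first by rewrite /tpi -Quotient.idealrBE.
by apply/eqP; rewrite /tpi -Quotient.idealrBE.
Qed.

Lemma tpi_repr (a : tpalg) : tpi (repr a) = a.
Proof. exact: reprK. Qed.

Lemma tpi_add x y : tpi (x + y) = tpi x + tpi y.
Proof. by rewrite /tpi raddfD. Qed.

End TruncatedPathAlgebra.

HB.lock Definition tp_mul (K : fieldType) (Q : quiver) (L : nat)
  (a b : tpalg K Q L) : tpalg K Q L := tpi L (repr a * repr b).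
HB.lock Definition tp_scale (K : fieldType) (Q : quiver) (L : nat)
  (c : K) (a : tpalg K Q L) : tpalg K Q L := tpi L (c *: repr a).

Section TruncatedPathAlgebraRing.
Variables (K : fieldType) (Q : quiver) (L : nat).
Local Notation KQ := (pathalg K Q).
Local Notation tpalg := (tpalg K Q L).
Local Notation tpi := (@tpi K Q L).
Local Notation tp_mul := (@tp_mul K Q L).
Local Notation tp_scale := (@tp_scale K Q L).

Lemma tpi_mul x y : tpi (x * y) = tp_mul (tpi x) (tpi y).
Proof.
rewrite tp_mul.unlock; apply/tpiP; set x' := repr _; set y' := repr _.
have -> : x * y - x' * y' = (x - x') * y + x' * (y - y').
  by rewrite mulrBl mulrBr addrA subrK.
rewrite rpredD //.
  by apply: trunc_ideal_mulr; apply/tpiP; rewrite tpi_repr.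
by apply: trunc_ideal_mull; apply/tpiP; rewrite tpi_repr.
Qed.

Lemma pathalg_scaleE (c : K) (x : KQ) : c *: x = (c *: (1 : KQ) : KQ) * x.
Proof. by rewrite -[in LHS](mul1r x); apply: pa_scaleAl. Qed.

Lemma tpi_scale c x : tpi (c *: x) = tp_scale c (tpi x).
Proof.
rewrite tp_scale.unlock; apply/tpiP; rewrite -scalerBr pathalg_scaleE; apply: trunc_ideal_mull.
by apply/tpiP; rewrite tpi_repr.
Qed.

Lemma tp_mulA : associative tp_mul.
Proof.
by move=> a b c; rewrite -[a]tpi_repr -[b]tpi_repr -[c]tpi_repr -!tpi_mul mulrA.
Qed.
Lemma tp_mul1 : left_id (tpi 1) tp_mul.
Proof. by move=> a; rewrite -[a]tpi_repr -tpi_mul mul1r. Qed.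
Lemma tp_mulx1 : right_id (tpi 1) tp_mul.
Proof. by move=> a; rewrite -[a]tpi_repr -tpi_mul mulr1. Qed.
Lemma tp_mulDl : left_distributive tp_mul +%R.
Proof.
move=> a b c; rewrite -[a]tpi_repr -[b]tpi_repr -[c]tpi_repr.
by rewrite -tpi_add -!tpi_mul mulrDl tpi_add.
Qed.
Lemma tp_mulDr : right_distributive tp_mul +%R.
Proof.
move=> a b c; rewrite -[a]tpi_repr -[b]tpi_repr -[c]tpi_repr.
by rewrite -tpi_add -!tpi_mul mulrDr tpi_add.
Qed.

HB.instance Definition _ := GRing.Zmodule_isPzRing.Build tpalg
  tp_mulA tp_mul1 tp_mulx1 tp_mulDl tp_mulDr.

Lemma tp_scaleA a b v : tp_scale a (tp_scale b v) = tp_scale (a * b) v.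
Proof. by rewrite -[v]tpi_repr -!tpi_scale scalerA. Qed.
Lemma tp_scale1 : left_id 1 tp_scale.
Proof. by move=> v; rewrite -[v]tpi_repr -!tpi_scale scale1r. Qed.
Lemma tp_scaleDr : right_distributive tp_scale +%R.
Proof.
move=> c a b; rewrite -[a]tpi_repr -[b]tpi_repr -tpi_add -!tpi_scale.
by rewrite scalerDr tpi_add.
Qed.
Lemma tp_scaleDl v : {morph tp_scale^~ v : a b / a + b}.
Proof. by move=> a b; rewrite -[v]tpi_repr -!tpi_scale scalerDl tpi_add. Qed.

HB.instance Definition _ := GRing.Zmodule_isLmodule.Build K tpalg
  tp_scaleA tp_scale1 tp_scaleDr tp_scaleDl.

End TruncatedPathAlgebraRing.

Definition generator (Q : quiver) : finType := (vertex Q + arrow Q)%type.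

Definition gen (K : fieldType) (Q : quiver) (L : nat) (g : generator Q) :
    tpalg K Q L :=
  match g with
  | inl v => tpi L (path_elt K (vpath v))
  | inr a => tpi L (path_elt K (apath a))
  end.

Section Modules.
Variable R : pzRingType.

Definition left_ideal (I : set R) : Prop :=
  [/\ I 0, forall x y, I x -> I y -> I (x + y) & forall a x, I x -> I (a * x)].

Definition maximal_left_ideal (I : set R) : Prop :=
  [/\ left_ideal I, ~ I 1 &
      forall I', left_ideal I' -> ~ I' 1 -> I `<=` I' -> I' `<=` I].

Definition jacobson_radical : set R :=
  [set x | forall I, maximal_left_ideal I -> I x].

Definition mul_span (J : set R) (M : lmodType R) (N : set M) : set M :=
  [set m | exists2 s : seq (R * M), (forall t, t \in s -> J t.1 /\ N t.2)
         & m = \sum_(t <- s) t.1 *: t.2].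

(* J^l M computed as J (J^(l-1) M), with J the Jacobson radical of R *)
Definition radpow (M : lmodType R) (l : nat) : set M :=
  iter l (@mul_span jacobson_radical M) setT.

(* For submodules W `<=` U of M: X is isomorphic to U / W, i.e. X is the image
   of a linear map defined on U with kernel W; the values of phi outside U are
   irrelevant. *)
Definition iso_subquot (M : lmodType R) (U W : set M) (X : lmodType R) : Prop :=
  exists phi : M -> X,
  [/\ forall u v, U u -> U v -> phi (u + v) = phi u + phi v,
      forall a u, U u -> phi (a *: u) = a *: phi u,
      forall x, exists2 u, U u & phi u = x &
      forall u, U u -> (phi u = 0 <-> W u)].

(* X is isomorphic to the direct sum of n i copies of T i, for i in I *)
Definition iso_direct_sum (I : finType) (T : I -> lmodType R) (n : I -> nat)
    (X : lmodType R) : Prop :=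
  exists iota : forall i, 'I_(n i) -> {linear T i -> X},
  bijective (fun y : forall i, 'I_(n i) -> T i =>
    \sum_(i : I) \sum_(a < n i) iota i a (y i a)).

Definition projective (P : lmodType R) : Prop :=
  forall (A B : lmodType R) (g : {linear A -> B}) (f : {linear P -> B}),
  (forall b, exists a, g a = b) ->
  exists h : {linear P -> A}, forall x, g (h x) = f x.

(* ... -> P 2 -> P 1 -> P 0 -> M -> 0 is exact, with P i projective for all i
   and P i = 0 for i > n *)
Definition has_projective_resolution (M : lmodType R) (n : nat) : Prop :=
  exists (P : nat -> lmodType R) (d : forall i, {linear P i.+1 -> P i})
         (eps : {linear P 0%N -> M}),
  [/\ forall i, projective (P i),
      forall m, exists x, eps x = m,
      forall x, eps x = 0 <-> exists y, d 0%N y = x,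
      forall i x, d i x = 0 <-> exists y, d i.+1 y = x &
      forall i, (n < i)%N -> forall x : P i, x = 0].

End Modules.

Arguments radpow {R} M l.

(* elements of N u {oo}, with None for oo *)
Definition enat := option nat.

Definition enat_lt (m n : enat) : bool :=
  match m, n with
  | Some m', Some n' => (m' < n')%N
  | Some _, None => true
  | None, _ => false
  end.

(* supremum of a nonempty set of natural numbers *)
Definition enat_sup (A : set nat) : enat :=
  match pselect (exists n, `[< forall m, A m -> (m <= n)%N >]) with
  | left h => Some (ex_minn h)
  | right _ => None
  end.

Definition enat_inf (A : set nat) : enat :=
  match pselect (exists n, `[< A n >]) with
  | left h => Some (ex_minn h)
  | right _ => None
  end.

Definition pdim (R : pzRingType) (M : lmodType R) : enat :=
  enat_inf [set n | has_projective_resolution M n].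

Definition clen (Q : quiver) (e : vertex Q) : enat :=
  enat_sup [set n | exists2 p : qpath Q, pstart p = e & plength p = n].

Definition ldeg (L l : nat) (c : enat) : enat :=
  omap (fun c' => c' %/ L.+1 + (c' + l) %/ L.+1)%N c.

Definition enat_succ (c : enat) : enat := omap S c.

(* The isomorphism type of a finitely generated semisimple Lambda-module, given
   by the multiplicities of S_1, ..., S_n; the sum of {ffun vertex Q -> nat} is
   the direct sum. *)
Definition ssmod (Q : quiver) : Type := {ffun vertex Q -> nat}.
HB.instance Definition _ (Q : quiver) := GRing.Nmodule.on (ssmod Q).

Definition ssseq (Q : quiver) (L : nat) : Type := 'I_L.+1 -> ssmod Q.

Definition direct_summand (Q : quiver) (A B : ssmod Q) : Prop :=
  exists C : ssmod Q, B = A + C.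

Definition ssseq_ge (Q : quiver) (L : nat) (S' S : ssseq Q L) : Prop :=
  \sum_(l < L.+1) S l = \sum_(l < L.+1) S' l /\
  forall r : nat, direct_summand (\sum_(l < L.+1 | (l <= r)%N) S l)
                                 (\sum_(l < L.+1 | (l <= r)%N) S' l).

(* total dimension; every S_j has dimension 1 over K *)
Definition tdim (Q : quiver) (L : nat) (S : ssseq Q L) : nat :=
  (\sum_(l < L.+1) \sum_(j : vertex Q) S l j)%N.

Section Representations.
Variables (K : fieldType) (Q : quiver) (L : nat).
Local Notation Lambda := (tpalg K Q L).

(* T is isomorphic to S_j = Lambda e_j / J e_j *)
Definition is_simple_at (j : vertex Q) (T : lmodType Lambda) : Prop :=
  let e := gen K L (inl j) in
  @iso_subquot Lambda Lambda^o
    [set x | exists a, x = a * e]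
    [set x | exists2 a, jacobson_radical a & x = a * e] T.

Definition has_radical_layering (M : lmodType Lambda) (S : ssseq Q L) : Prop :=
  forall l : 'I_L.+1,
  exists (X : lmodType Lambda) (T : vertex Q -> lmodType Lambda),
  [/\ iso_subquot (radpow M l) (radpow M l.+1) X,
      forall j, is_simple_at j (T j) &
      iso_direct_sum T (S l) X].

Definition point (d : nat) : Type := generator Q -> 'M[K]_d.

(* value at x of a noncommutative polynomial in variables indexed by the
   generators, the scalars being mapped to A by c *)
Definition nc_eval (A : pzRingType) (c : K -> A) (x : generator Q -> A)
    (f : {malg K[{fmonom generator Q}]}) : A :=
  \sum_(m <- msupp f) c f@_m * \prod_(g <- (m : seq (generator Q))) x g.

(* Mod_d(Lambda); 'M[K]_d acts on K^d = 'cV[K]_d from the left *)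
Definition Mod_d (d : nat) : set (point d) :=
  [set x | forall f : {malg K[{fmonom generator Q}]},
     nc_eval (fun c => c *: (1 : Lambda)) (gen K L) f = 0 ->
     nc_eval (fun c => c%:M) x f = 0].

(* M is isomorphic to the Lambda-module structure on K^d given by x *)
Definition represents (d : nat) (x : point d) (M : lmodType Lambda) : Prop :=
  exists phi : 'cV[K]_d -> M,
  [/\ bijective phi,
      forall u v, phi (u + v) = phi u + phi v,
      forall c v, phi (c *: v) = (c *: (1 : Lambda) : Lambda) *: phi v &
      forall g v, phi (x g *m v) = gen K L g *: phi v].

Definition ModS (S : ssseq Q L) : set (point (tdim S)) :=
  [set x | Mod_d x /\
     exists2 M : lmodType Lambda, represents x M & has_radical_layering M S].

Definition pdim_values (d : nat) (C : set (point d)) : set enat :=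
  [set v | exists x (M : lmodType Lambda),
     [/\ C x, represents x M & v = pdim M]].

(* p dim S, the common value of p dim on Mod(S) (chosen among the values of
   p dim on Mod(S); None if Mod(S) is empty) *)
Definition pdimS (S : ssseq Q L) : enat := xget None (pdim_values (@ModS S)).

Definition coordinate (d : nat) : finType := (generator Q * 'I_d * 'I_d)%type.

Definition coord (d : nat) (x : point d) (i : 'I_#|coordinate d|) : K :=
  let t := enum_val i in x t.1.1 t.1.2 t.2.

(* Closure for the Zariski topology on the set Mod_d(Lambda) of K-points; it is
   discrete when K is finite. *)
Definition zariski_closure (d : nat) (C : set (point d)) : set (point d) :=
  [set x | Mod_d x /\
     forall f : mpoly.mpoly #|coordinate d| K,
     (forall y, C y -> mpoly.meval (coord y) f = 0) ->
     mpoly.meval (coord x) f = 0].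

End Representations.

Arguments ModS K {Q L} S.
Arguments Mod_d K {Q} L d.

(* The K-points of the closure of Mod(S) as a K-variety: x lies in it if x is a
   zero of all polynomials over K which vanish on the points of Mod(S) with
   coordinates in arbitrary extension fields F of K. This is the meaningful
   notion of closure over a finite field, where Mod(S) has only finitely many
   K-points. *)
Definition variety_closure (K : fieldType) (Q : quiver) (L : nat)
    (S : ssseq Q L) : set (point K Q (tdim S)) :=
  [set x | Mod_d K L (tdim S) x /\
     forall f : mpoly.mpoly #|coordinate Q (tdim S)| K,
     (forall (F : fieldType) (iota : {rmorphism K -> F})
             (y : point F Q (tdim S)),
        ModS F S y -> mpoly.mmap iota (coord y) f = 0) ->
     mpoly.meval (coord x) f = 0].
Arguments variety_closure K {Q L} S.

(* Main.v *)
Require Import Defs.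
From HB Require Import structures.
From mathcomp Require Import all_boot all_order all_algebra.
From mathcomp Require mpoly.
From mathcomp Require Import finmap monalg zify.
From mathcomp Require Import boolp classical_sets cardinality.

(** A module over the truncated path algebra is a representation of the quiver
    in which all words of L+1 arrows act as zero, and its radical is generated
    by the images of the arrows. Write s(j,l) for the multiplicity of S_j in
    layer l of the module M. A pair (j,l) with 1 <= l <= L is critical when
    s(j,l) is smaller than the sum of s(i,l-1) over the arrows i -> j; the
    difference, the defect of M at (j,l), counts the relations of length l that
    end in j in a minimal presentation of M.

    Projective dimension. Let N be the kernel of a projective cover P -> M. In P
    the arrows act with independent images, and on the vectors at its source an
    arrow is injective modulo the last layer J^L P, so the dimension vector of
    J^r U can be computed for every submodule U of P ([full_dimv_iter]). For U = N
    this shows that the defect of N at (j,r) is the sum, over the paths of length r that end in j, of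
    the defects of M at (start of the path, L+1-r) ([syz_crit]). No basis of M
    that is adapted to the radical filtration has to be chosen. As M is
    projective exactly when it has no critical pair ([rcrit_projective]),
    dimension shifting ([resolution_shift]) shows that the projective dimension
    of M exceeds n exactly when some critical pair (j,l) starts a chain of n
    paths of lengths L+1-l, l, L+1-l and so on ([resolution_rcrit]). The paths of
    a chain compose to one path starting in j, hence a chain of n paths exists
    exactly when n <= l-deg(c(e_j)) ([chain_ldeg]). Therefore the projective
    dimension of M is 0 or the maximum of 1 + l-deg(c(e_j)) over the critical
    pairs ([layering_pdspec]); it depends on the layering only.

    Larger layerings. The pairs of degree at least D are closed under raising
    the layer and under passing to predecessors along arrows. On such a set of
    pairs a layering S' >= S without critical pairs there agrees with S, since
    its layers are generated by a larger top while its tails are smaller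
    ([upset_rigid]). Hence the projective dimension cannot drop
    ([pdspec_mono]), and if it rises, a simple of positive layer in S has exactly
    the degree that is responsible ([pdspec_larger]). Conversely S is the
    layering of a module with a basis on which the arrows act along the
    edges of a forest. Cutting the edge that leads to a basis vector in layer l >= 1 and at
    vertex j moves the tree above that vector to layer 0, and creates a critical
    pair (j,l) but no critical pair of larger degree than that or than those of
    S ([cut_pdspec]).

    Closures. The dimensions of the spaces e_j J^l M are ranks of matrices with
    polynomial entries, so they can only drop in the closure of Mod(S); this
    gives layerings above S ([closure_layering]). In the other direction the cut
    forest module is the value at t = 0 of the line of modules in which the cut
    edge acts with weight t, and all the other values lie in Mod(S)
    ([cut_point_variety], [cut_point_zariski]). Since the jumps of the projective
    dimension are realized by cut forests, all three sets coincide. *)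

Set Implicit Arguments.
Unset Strict Implicit.
Unset Printing Implicit Defensive.

Import GRing.Theory.
Local Open Scope classical_set_scope.
Local Open Scope ring_scope.

Local Notation point := Defs.point.

(** * Dimension shifting *)

Section LinearTools.
Variable R : pzRingType.

Lemma mk_linear (A B : lmodType R) (f : A -> B) :
  (forall u v, f (u + v) = f u + f v) -> (forall a u, f (a *: u) = a *: f u) ->
  exists g : {linear A -> B}, g =1 f.
Proof.
move=> fD fZ.
have lf : linear f by move=> a u v; rewrite fD fZ.
pose m := GRing.isLinear.Build R A B *:%R f lf.
by exists (HB.pack_for {linear A -> B} f m).
Qed.

Section Kernel.
Variables (A B : lmodType R) (f : {linear A -> B}).

Definition ker_pred : {pred A} := fun x => f x == 0.

Lemma ker_pred_submod : submod_closed ker_pred.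
Proof.
split=> [|a x y]; rewrite !unfold_in ?linear0 // => /eqP fx /eqP fy.
by rewrite linearP fx fy scaler0 addr0.
Qed.
HB.instance Definition _ := GRing.isSubmodClosed.Build R A ker_pred ker_pred_submod.

Definition ker_type := {x : A | ker_pred x}.
HB.instance Definition _ := SubType.on ker_type.
HB.instance Definition _ := [Choice of ker_type by <:].
HB.instance Definition _ := [SubChoice_isSubLmodule of ker_type by <:].
End Kernel.

Definition short_exact (N P M : lmodType R) (i : {linear N -> P})
    (p : {linear P -> M}) : Prop :=
  [/\ injective i, forall m, exists x, p x = m
    & forall x, p x = 0 <-> exists y, i y = x].

Lemma linear_iso_inv (A B : lmodType R) (f : {linear A -> B}) : bijective f ->
  exists g : {linear B -> A}, cancel f g /\ cancel g f.
Proof.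
case=> g fK gK.
have [||h hE] := @mk_linear B A g.
- by move=> u v; apply: (can_inj fK); rewrite linearD !gK.
- by move=> a u; apply: (can_inj fK); rewrite linearZ /= !gK.
by exists h; split=> x; rewrite hE.
Qed.

Lemma inj_surj_bij (A B : lmodType R) (f : {linear A -> B}) :
  injective f -> (forall b, exists a, f a = b) -> bijective f.
Proof.
move=> finj fsurj; have [g gE] := choice fsurj.
by exists g => // x; apply: finj; rewrite gE.
Qed.

Lemma kernel_short_exact (P M : lmodType R) (p : {linear P -> M}) :
  (forall m, exists x, p x = m) ->
  exists (N : lmodType R) (i : {linear N -> P}), short_exact i p.
Proof.
move=> psurj; pose i : ker_type p -> P := val.
have [||j jE] := @mk_linear _ _ i; [by []|by []|].
exists (ker_type p : lmodType R), j; split=> //.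
  by move=> x y; rewrite !jE => /val_inj.
move=> x; split=> [px|[y <-]]; last by rewrite jE; apply/eqP/(valP y).
have px' : ker_pred p x by apply/eqP.
by exists (exist _ x px'); rewrite jE.
Qed.

Lemma lift_inj (N P A : lmodType R) (i : {linear N -> P}) (f : {linear A -> P}) :
  injective i -> (forall a, exists y, i y = f a) ->
  exists g : {linear A -> N}, forall a, i (g a) = f a.
Proof.
move=> iinj h; have [g gE] := choice h.
have [||k kE] := @mk_linear _ _ g.
- by move=> u v; apply: iinj; rewrite linearD !gE linearD.
- by move=> a u; apply: iinj; rewrite linearZ /= !gE linearZ.
by exists k => a; rewrite kE.
Qed.

Lemma projective_iso (P P' : lmodType R) (f : {linear P -> P'}) :
  bijective f -> projective P -> projective P'.
Proof.
move=> /linear_iso_inv[g [fK gK]] prP A B q h qs.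
have [k kE] := prP A B q (h \o f : {linear _ -> _}) qs.
by exists (k \o g : {linear _ -> _}) => x /=; rewrite kE /= gK.
Qed.

Lemma projective_summand (P Q : lmodType R) : projective (P * Q : lmodType R)%type ->
  projective P.
Proof.
move=> pr A B q h qs.
have [||f fE] := @mk_linear (P * Q : lmodType R)%type B (fun x => h x.1).
- by move=> u v; rewrite -linearD.
- by move=> a u; rewrite -linearZ.
have [k kE] := pr A B q f qs.
have [||g gE] := @mk_linear P A (fun x => k (x, 0)).
- by move=> u v; rewrite -linearD; congr (k (_, _)); rewrite /= addr0.
- by move=> a u; rewrite -linearZ; congr (k (_, _)); rewrite /= scaler0.
by exists g => x; rewrite gE kE fE.
Qed.

Lemma projective_prod (P Q : lmodType R) : projective P -> projective Q ->
  projective (P * Q : lmodType R)%type.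
Proof.
move=> prP prQ A B q h qs.
have [||f1 f1E] := @mk_linear P B (fun x => h (x, 0)).
- by move=> u v; rewrite -linearD; congr (h (_, _)); rewrite /= addr0.
- by move=> a u; rewrite -linearZ; congr (h (_, _)); rewrite /= scaler0.
have [||f2 f2E] := @mk_linear Q B (fun x => h (0, x)).
- by move=> u v; rewrite -linearD; congr (h (_, _)); rewrite /= addr0.
- by move=> a u; rewrite -linearZ; congr (h (_, _)); rewrite /= scaler0.
have [k1 k1E] := prP A B q f1 qs; have [k2 k2E] := prQ A B q f2 qs.
have [||g gE] := @mk_linear (P * Q : lmodType R)%type A (fun x => k1 x.1 + k2 x.2).
- by move=> u v /=; rewrite !linearD addrACA.
- by move=> a u /=; rewrite !linearZ /= scalerDr.
exists g => -[x y]; rewrite gE linearD k1E k2E f1E f2E -linearD /=.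
by congr (h (_, _)); rewrite /= ?addr0 ?add0r.
Qed.

Lemma zero_lmod : exists Z : lmodType R, (forall x : Z, x = 0) /\ projective Z.
Proof.
exists ('M[R]_(0,0) : lmodType R); have e0 (x : 'M[R]_(0,0)) : x = 0.
  by apply/matrixP=> -[].
split=> // A B q h qs; exists (\0 : {linear _ -> _}) => x.
by rewrite (e0 x) linear0 linear0.
Qed.

End LinearTools.

Section Resolutions.
Variable R : pzRingType.
Implicit Types M N P Q : lmodType R.

Lemma resolution_iso M M' (f : {linear M -> M'}) n : bijective f ->
  has_projective_resolution M n -> has_projective_resolution M' n.
Proof.
move=> bf [P [d [eps [prP epsS ex0 ex fin]]]].
have [g [fK gK]] := linear_iso_inv bf.
exists P, d, (f \o eps : {linear _ -> _}); split=> //.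
  by move=> m; have [x xE] := epsS (g m); exists x; rewrite /= xE gK.
move=> x; rewrite -ex0 /=; split=> [|->]; last by rewrite linear0.
by move=> e; apply: (can_inj fK); rewrite e linear0.
Qed.

Lemma resolution0 M : has_projective_resolution M 0 <-> projective M.
Proof.
split=> [[P [d [eps [prP epsS ex0 ex fin]]]]|prM].
  apply: (projective_iso (f := eps)) (prP 0%N).
  apply: inj_surj_bij => // x y e; apply/eqP; rewrite -subr_eq0; apply/eqP.
  have /ex0[z <-] : eps (x - y) = 0 by rewrite linearB e subrr.
  by rewrite (fin 1%N isT z) linear0.
have [Z [Z0 prZ]] := zero_lmod R.
pose P i := if i is 0 then M else Z.
exists P, (fun i => \0 : {linear _ -> _}), (idfun : {linear _ -> _}); split.
- by case.
- by move=> m; exists m.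
- by move=> x; split=> [/= ->|[y /= <-]//]; exists 0.
- move=> i x; split=> _ //; exists 0; apply/esym.
  by case: i x => [|i] x; apply: Z0.
- by case=> // i _ x; apply: Z0.
Qed.

Lemma resolution_splice N P M (i : {linear N -> P}) (p : {linear P -> M}) n :
  short_exact i p -> projective P -> has_projective_resolution N n ->
  has_projective_resolution M n.+1.
Proof.
move=> [iinj ps ex0] prP [P' [d [eps [prP' epsS ex0' ex fin]]]].
pose F k := if k is k'.+1 then P' k' else P.
pose D k : {linear F k.+1 -> F k} :=
  match k with 0 => (i \o eps : {linear _ -> _}) | k'.+1 => d k' end.
exists F, D, p; split=> //.
- by case.
- move=> x; rewrite ex0; split=> [[y <-]|[y <-]]; last by exists (eps y).
  by have [z <-] := epsS y; exists z.
- case=> [|k] x; last exact: ex.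
  rewrite /= -ex0'; split=> [e|->]; last by rewrite linear0.
  by apply: iinj; rewrite e linear0.
- by case=> // k; apply: fin.
Qed.

Lemma resolution_unsplice M n : has_projective_resolution M n.+1 ->
  exists N P (i : {linear N -> P}) (p : {linear P -> M}),
  [/\ short_exact i p, projective P & has_projective_resolution N n].
Proof.
move=> [P [d [eps [prP epsS ex0 ex fin]]]].
have [N [i [iinj _ iex]]] := kernel_short_exact epsS.
exists N, (P 0%N), i, eps; split=> //.
have [|g gE] := lift_inj (f := d 0%N) iinj.
  by move=> a; apply/iex/ex0; exists a.
exists (fun k => P k.+1), (fun k => d k.+1), g; split=> //.
- move=> m; have /ex0[x xE] : eps (i m) = 0 by apply/iex; exists m.
  by exists x; apply: iinj; rewrite gE.
- move=> x; rewrite -ex -gE; split=> [->|e]; first by rewrite linear0.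
  by apply: iinj; rewrite e linear0.
- by move=> k kn; apply: fin.
Qed.

(** Only the last step of a resolution meets the extra summand: for n > 0 it is
    added to the projective module that covers [N], and the syzygy is unchanged. *)
Lemma resolution_prod N P n : projective P ->
  has_projective_resolution N n -> has_projective_resolution (N * P : lmodType R)%type n.
Proof.
move=> prP; case: n => [|n]; first by rewrite !resolution0 => /projective_prod; apply.
move=> /resolution_unsplice[N1 [P0 [i [p [[iinj ps ex] pr0 res]]]]].
have [||j jE] := @mk_linear R N1 (P0 * P : lmodType R)%type (fun x => (i x, 0)).
- by move=> u v; rewrite linearD; congr (_, _); rewrite /= addr0.
- by move=> a u; rewrite linearZ; congr (_, _); rewrite /= scaler0.
have [||q qE] := @mk_linear R (P0 * P : lmodType R)%type (N * P : lmodType R)%type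
   (fun x => (p x.1, x.2)).
- by move=> u v; rewrite linearD.
- by move=> a u; rewrite linearZ.
apply: (resolution_splice (i := j) (p := q)) => //; last exact: projective_prod.
split=> [x y|[m y]|[x y]].
- by rewrite !jE => -[/iinj].
- by have [x xE] := ps m; exists (x, y); rewrite qE /= xE.
rewrite qE; split=> [[/ex[z <-] ->]|[z]]; first by exists z; rewrite jE.
by rewrite jE => -[<- <-] /=; congr (_, _); apply/ex; exists z.
Qed.

(** For a projective module [P0] that maps onto [N * Q], the kernel of the map to
    [N] is the sum of the kernel of the map to [N * Q] and of a copy of [Q], which
    lifts to [P0]; so the syzygy changes by a projective summand only. *)
Lemma resolution_summand N Q n : projective Q ->
  has_projective_resolution (N * Q : lmodType R)%type n -> has_projective_resolution N n.
Proof.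
move=> prQ; case: n => [|n]; first by rewrite !resolution0 => /projective_summand.
move=> /resolution_unsplice[N1 [P0 [i [p [[iinj ps ex] pr0 res]]]]].
have [||q0 q0E] := @mk_linear R Q (N * Q : lmodType R)%type (fun x => (0, x)).
- by move=> u v; congr (_, _); rewrite /= addr0.
- by move=> a u; congr (_, _); rewrite /= scaler0.
have [s sE] := prQ _ _ p q0 ps.
have [||p1 p1E] := @mk_linear R P0 N (fun x => (p x).1).
- by move=> u v; rewrite linearD.
- by move=> a u; rewrite linearZ.
have [||j jE] := @mk_linear R (N1 * Q : lmodType R)%type P0 (fun x => i x.1 + s x.2).
- by move=> u v /=; rewrite !linearD addrACA.
- by move=> a u /=; rewrite !linearZ /= scalerDr.
have pi0 y : p (i y) = 0 by apply/ex; exists y.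
apply: (resolution_splice (i := j) (p := p1)) (resolution_prod prQ res) => //.
split.
- move=> x y; rewrite !jE => e; have := congr1 p e.
  rewrite !linearD !pi0 !add0r !sE !q0E => -[e2].
  move: e; rewrite e2 => /addIr/iinj e1.
  by rewrite [x]surjective_pairing e1 e2 -surjective_pairing.
- by move=> m; have [x xE] := ps (m, 0); exists x; rewrite p1E xE.
move=> x; rewrite p1E; split=> [px|[y <-]]; last first.
  by rewrite jE linearD pi0 sE q0E /= add0r.
have /ex[y yE] : p (x - s (p x).2) = 0.
  by rewrite linearB sE q0E [X in X - _]surjective_pairing px; apply: subrr.
by exists (y, (p x).2); rewrite jE /= yE subrK.
Qed.

(** Schanuel's lemma: the kernels of two projective presentations become
    isomorphic after adding projective summands, so either one can be used to
    shift dimension. *)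
Lemma resolution_schanuel N P N' P' M (i : {linear N -> P}) (p : {linear P -> M})
    (i' : {linear N' -> P'}) (p' : {linear P' -> M}) n :
  short_exact i p -> short_exact i' p' -> projective P -> projective P' ->
  has_projective_resolution N n -> has_projective_resolution N' n.
Proof.
move=> [iinj ps ex] [iinj' ps' ex'] pr pr' /(resolution_prod pr') res.
have [al alE] := pr _ _ p' p ps'; have [be beE] := pr' _ _ p p' ps.
have pi0 y : p (i y) = 0 by apply/ex; exists y.
have pi0' y : p' (i' y) = 0 by apply/ex'; exists y.
have [||f fE] := @mk_linear R (N * P' : lmodType R)%type P'
   (fun x => x.2 - al (i x.1 + be x.2)).
- by move=> u v /=; rewrite (linearD i) (linearD be) addrACA linearD opprD addrACA.
- by move=> a u /=; rewrite !linearZ /= -scalerDr linearZ /= scalerBr.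
have [|g gE] := lift_inj (f := f) iinj'.
  move=> a; apply/ex'; rewrite fE linearB alE linearD pi0 beE add0r.
  exact: subrr.
have [||h hE] := @mk_linear R (N * P' : lmodType R)%type (N' * P : lmodType R)%type
   (fun x => (g x, i x.1 + be x.2)).
- by move=> u v /=; congr (_, _); rewrite /= ?linearD // addrACA.
- by move=> a u /=; congr (_, _); rewrite /= !linearZ //= scalerDr.
apply: (resolution_summand pr); apply: (resolution_iso (f := h)) res.
apply: inj_surj_bij => [x y|[y x]].
  rewrite !hE => -[/(congr1 i') + e2]; rewrite !gE !fE e2 => /addIr e.
  move: e2; rewrite e => /addIr/iinj e1.
  by rewrite [x]surjective_pairing e1 e -surjective_pairing.
pose y' := i' y + al x.
have /ex[z zE] : p (x - be y') = 0.
  by rewrite linearB beE linearD pi0' alE add0r subrr.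
exists (z, y'); rewrite hE /= zE subrK; congr (_, _).
by apply: iinj'; rewrite gE fE /= zE subrK addrK.
Qed.

Lemma resolution_shift N P M (i : {linear N -> P}) (p : {linear P -> M}) n :
  short_exact i p -> projective P ->
  has_projective_resolution M n.+1 <-> has_projective_resolution N n.
Proof.
move=> ex pr; split; last exact: (resolution_splice ex pr).
move=> /resolution_unsplice[N' [P' [i' [p' [ex' pr' res]]]]].
exact: (resolution_schanuel ex' ex pr' pr res).
Qed.

End Resolutions.

(** * The truncated path algebra *)

(** The field acts on modules through these elements. The constant is locked, as
    is [opth], because unification would otherwise unfold the quotient that
    defines the algebra. *)
HB.lock Definition scalar1 (K : fieldType) (Q : quiver) (L : nat) (c : K) : tpalg K Q L :=
  c *: (1 : tpalg K Q L).
(** Composition of paths is partial; paths that do not compose give [None], whose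
    class is 0. *)
HB.lock Definition opth (K : fieldType) (Q : quiver) (L : nat)
  (o : option (qpath Q)) : tpalg K Q L := tpi L (opath_elt K o).

Arguments gen : simpl never.

Section Lambda.
Variables (K : fieldType) (Q : quiver) (L : nat).
Local Notation Lambda := (tpalg K Q L).
Local Notation kQ := (pathalg K Q).
Local Notation gen := (@gen K Q L).
Local Notation scalar1 := (@scalar1 K Q L).

Local Notation opth := (@opth K Q L).
Local Notation pth p := (opth (Some p)).

Lemma opthE o : opth o = tpi L (opath_elt K o).
Proof. by rewrite opth.unlock. Qed.

Lemma scalar1E c : scalar1 c = c *: (1 : Lambda).
Proof. by rewrite scalar1.unlock. Qed.

Lemma gen_vertexE v : gen (inl v) = pth (vpath v).
Proof. by rewrite opthE. Qed.

Lemma gen_arrowE a : gen (inr a) = pth (apath a).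
Proof. by rewrite opthE. Qed.

Lemma opthN : opth None = 0.
Proof. by rewrite opthE /= /tpi raddf0. Qed.

Lemma tpi_sum I (r : seq I) (F : I -> kQ) :
  tpi L (\sum_(i <- r) F i) = \sum_(i <- r) tpi L (F i).
Proof.
apply: (big_morph (tpi L) (@tpi_add K Q L)).
by rewrite /tpi raddf0.
Qed.

Lemma tpE (a : Lambda) : exists y : kQ, a = \sum_(p <- msupp y) y@_p *: pth p.
Proof.
exists (repr a); rewrite -[LHS]tpi_repr [in LHS](pathalgE (repr a)) tpi_sum.
by apply: eq_bigr => p _; rewrite opthE; apply: tpi_scale.
Qed.

Lemma tpM (x y : kQ) : tpi L (x * y) = tpi L x * tpi L y.
Proof. exact: tpi_mul. Qed.

Lemma tpZ c (x : kQ) : tpi L (c *: x) = c *: tpi L x.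
Proof. exact: tpi_scale. Qed.

Lemma tp_scalerAl c (a b : Lambda) : c *: (a * b) = (c *: a) * b.
Proof.
rewrite -[a]tpi_repr -[b]tpi_repr -tpM -!tpZ -tpM.
by congr (tpi L _); apply: pa_scaleAl.
Qed.

Lemma tp_scalerAr c (a b : Lambda) : c *: (a * b) = a * (c *: b).
Proof.
rewrite -[a]tpi_repr -[b]tpi_repr -tpM -!tpZ -tpM.
by congr (tpi L _); apply: pa_scaleAr.
Qed.

Lemma tp_scaleE c (a : Lambda) : c *: a = scalar1 c * a.
Proof. by rewrite scalar1E -tp_scalerAl mul1r. Qed.

Lemma opthM p q : pth p * pth q = opth (Defs.pcomp p q).
Proof.
rewrite !opthE -tpM; congr (tpi L _).
exact: (@pa_mulbb K Q p q).
Qed.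

Lemma sum_gen_vertex : \sum_v gen (inl v) = 1.
Proof. by rewrite -tpi_sum. Qed.

Lemma gen_vertexM v w :
  gen (inl v) * gen (inl w) = if v == w then gen (inl v) else 0.
Proof.
rewrite !gen_vertexE opthM pcomp_vl.
by rewrite eq_sym; case: eqP => [->|] //; rewrite opthN.
Qed.

Lemma gen_arrow_vertex a v :
  gen (inr a) * gen (inl v) = if src a == v then gen (inr a) else 0.
Proof.
rewrite gen_vertexE gen_arrowE opthM.
by rewrite pcomp_vr /pstart /=; case: eqP; rewrite ?opthN.
Qed.

Lemma gen_vertex_arrow a v :
  gen (inl v) * gen (inr a) = if tgt a == v then gen (inr a) else 0.
Proof.
rewrite gen_vertexE gen_arrowE opthM.
by rewrite pcomp_vl /pend /=; case: eqP; rewrite ?opthN.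
Qed.

Lemma opth_cons a s v : opth (insub (v, a :: s)) =
  if src a == v then opth (insub (tgt a, s)) * gen (inr a) else 0.
Proof.
case: (insubP _ (v, a :: s)) => [p /= /andP[av h] ep|/=].
  rewrite av; case: insubP => [q /= _ eq|]; last by rewrite h.
  rewrite gen_arrowE opthM; congr (opth _); apply/esym/pcompP.
  by rewrite /pend /pstart /= eq ep (eqP av).
case: eqP => //= _; last by rewrite opthN.
by case: insubP => [q /= -> //|_ _]; rewrite opthN mul0r.
Qed.

Lemma opth_long p : (L < plength p)%N -> pth p = 0.
Proof.
case: p => -[v s] h; rewrite /plength /= => Ls.
have /andP[h1 h2] : composable v (take L.+1 s) &&
    composable (last v (map (@tgt Q) (take L.+1 s))) (drop L.+1 s).
  by rewrite -composable_cat cat_take_drop.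
pose p1 : qpath Q := QPath (qpath_val := (v, _)) h1.
pose p2 : qpath Q := QPath (qpath_val := (_, _)) h2.
have -> : Some (QPath h) = Defs.pcomp p2 p1.
  by apply/esym/pcompP; rewrite /= cat_take_drop.
rewrite -opthM; suff -> : pth p1 = 0 by rewrite mulr0.
rewrite -[RHS]opthN !opthE; apply/tpiP; rewrite subr0.
apply/trunc_idealP; exists [:: (1, path_elt K p1, 1)] => [t|].
  rewrite inE => /eqP ->; exists p1 => //.
  by rewrite /plength /= size_takel.
by rewrite big_seq1 /= mul1r mulr1.
Qed.

(** Every element is a combination of classes of paths, so statements about the
    algebra that are stable under sums can be checked on multiples of paths. *)
Lemma opth_ind (P : Lambda -> Prop) : P 0 ->
  (forall a b, P a -> P b -> P (a + b)) ->
  (forall c p, P (c *: pth p)) -> forall a, P a.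
Proof.
move=> P0 PD PZ a; have [y ->] := tpE a.
by elim/big_ind: _ => // p _; apply: PZ.
Qed.

(** ** Modules *)

Definition word_act (M : lmodType Lambda) (m : M) (s : seq (arrow Q)) : M :=
  foldl (fun m a => gen (inr a) *: m) m s.

(** A word that is not composable acts as zero, which is why the class of the
    possibly undefined path is used. *)
Lemma opth_act (M : lmodType Lambda) v s (m : M) :
  opth (insub (v, s)) *: m = word_act (gen (inl v) *: m) s.
Proof.
elim: s v m => [|a s IHs] v m /=.
  case: insubP => // p _ ep; rewrite gen_vertexE; congr (opth (Some _) *: _).
  exact: val_inj.
rewrite opth_cons /word_act /= scalerA gen_arrow_vertex; case: eqP => _.
  rewrite -scalerA IHs /word_act; congr (foldl _ _ _).
  by rewrite scalerA gen_vertex_arrow eqxx.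
by rewrite !scale0r; elim: s {IHs} => //= b s; rewrite scaler0.
Qed.

Lemma pth_act (M : lmodType Lambda) p (m : M) :
  pth p *: m = word_act (gen (inl (pstart p)) *: m) p.2.
Proof.
rewrite -opth_act; congr (_ *: _); congr (opth _).
by case: p => -[v s] h; rewrite /pstart /= insubT.
Qed.

Lemma word_act_long (M : lmodType Lambda) (m : M) s : (L < size s)%N -> word_act m s = 0.
Proof.
case: s => // a s h.
have -> : word_act m (a :: s) = word_act (gen (inl (src a)) *: m) (a :: s).
  by rewrite /word_act /= scalerA gen_arrow_vertex eqxx.
rewrite -opth_act; case: insubP => [p _ ep|_]; last by rewrite opthN scale0r.
by rewrite opth_long ?scale0r // /plength ep.
Qed.

Lemma tp_scalerA (M : lmodType Lambda) c (a : Lambda) (m : M) :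
  (c *: a) *: m = scalar1 c *: (a *: m).
Proof. by rewrite tp_scaleE scalerA. Qed.

(** Classes of paths are products of generators, so an additive map only has to
    commute with scalars and generators. *)
Lemma gen_linear (M N : lmodType Lambda) (f : M -> N) :
  (forall u v, f (u + v) = f u + f v) ->
  (forall c m, f (scalar1 c *: m) = scalar1 c *: f m) ->
  (forall g m, f (gen g *: m) = gen g *: f m) ->
  forall a m, f (a *: m) = a *: f m.
Proof.
move=> fD fZ fG a m; have f0 : f 0 = 0 by apply: (addrI (f 0)); rewrite -fD !addr0.
elim/opth_ind: a => [|a b IHa IHb|c p]; first by rewrite !scale0r.
  by rewrite !scalerDl fD IHa IHb.
rewrite (tp_scalerA c _ m) (tp_scalerA c _ (f m)) fZ !pth_act -fG; congr (_ *: _).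
by move: (gen _ *: m); elim: (p.2) => //= a s IHs u; rewrite IHs fG.
Qed.

End Lambda.

(** * Representations of the quiver as modules *)

(** The module structure is kept apart from the vector space, so that subspaces
    and dimensions are available for the modules. Words are listed in the order
    in which their arrows act. *)
Record qrep (K : fieldType) (Q : quiver) (L : nat) := QRep {
  rV :> vectType K;
  rE : vertex Q -> 'End(rV);
  rX : arrow Q -> 'End(rV);
  rEE : forall v w m, rE v (rE w m) = if v == w then rE v m else 0;
  rE1 : forall m, \sum_v rE v m = m;
  rXE : forall a v m, rX a (rE v m) = if src a == v then rX a m else 0;
  rEX : forall a v m, rE v (rX a m) = if tgt a == v then rX a m else 0;
  rX0 : forall s m, size s = L.+1 -> foldl (fun m a => rX a m) m s = 0
}.

Arguments rV : simpl never.
Arguments rE : simpl never.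
Arguments rX : simpl never.

Section RepAction.
Variables (K : fieldType) (Q : quiver) (L : nat) (r : qrep K Q L).
Local Notation kQ := (pathalg K Q).

Definition rword (m : r) (s : seq (arrow Q)) : r := foldl (fun m a => rX r a m) m s.
Definition pact (p : qpath Q) (m : r) : r := rword (rE r (pstart p) m) p.2.
Definition kqact (y : {malg K[qpath Q]}) (m : r) : r :=
  \sum_(p <- msupp y) y@_p *: pact p m.

Lemma rword_cat m s t : rword m (s ++ t) = rword (rword m s) t.
Proof. exact: foldl_cat. Qed.

Lemma rword_lin s c (m m' : r) : rword (c *: m + m') s = c *: rword m s + rword m' s.
Proof. by elim: s m m' => //= a s IHs m m'; rewrite linearP IHs. Qed.

Lemma rword0 s : rword 0 s = 0.
Proof. by elim: s => //= a s IHs; rewrite linear0. Qed.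

Lemma rword_long m s : (L < size s)%N -> rword m s = 0.
Proof.
move=> h; rewrite -(cat_take_drop L.+1 s) rword_cat [rword m _]rX0 ?rword0 //.
by rewrite size_takel.
Qed.

Lemma rE_word v s m : composable v s ->
  rE r (last v (map (@tgt Q) s)) (rword (rE r v m) s) = rword (rE r v m) s.
Proof.
elim: s v m => [|a s IHs] v m /=; first by rewrite rEE eqxx.
move=> /andP[/eqP <- h]; rewrite rXE eqxx.
have -> : rX r a m = rE r (tgt a) (rX r a m) by rewrite rEX eqxx.
exact: IHs.
Qed.

Lemma pact_lin p c (m m' : r) : pact p (c *: m + m') = c *: pact p m + pact p m'.
Proof. by rewrite /pact linearP rword_lin. Qed.

Lemma pact_is_linear p : linear (pact p).
Proof. by move=> c m m'; apply: pact_lin. Qed.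
HB.instance Definition _ p := GRing.isLinear.Build K r r _ (pact p) (pact_is_linear p).

Lemma kqactw (d : {fset qpath Q}) y m : (msupp y `<=` d)%fset ->
  kqact y m = \sum_(p <- d) y@_p *: pact p m.
Proof.
move=> h; rewrite /kqact (big_fset_incl _ h) //= => k _ /mcoeff_outdom ->.
by rewrite scale0r.
Qed.

Lemma kqactD x y m : kqact (x + y) m = kqact x m + kqact y m.
Proof.
rewrite (kqactw _ (msuppD_le _ _)) (@kqactw (msupp x `|` msupp y)%fset x) ?fsubsetUl //.
rewrite (@kqactw (msupp x `|` msupp y)%fset y) ?fsubsetUr //.
by rewrite -big_split /=; apply: eq_bigr => p _; rewrite mcoeffD scalerDl.
Qed.

Lemma kqactZ c x m : kqact (c *: x) m = c *: kqact x m.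
Proof.
rewrite (kqactw _ (msuppZ_le _ _)) /kqact scaler_sumr.
by apply: eq_bigr => p _; rewrite mcoeffZ scalerA.
Qed.

Lemma kqact0 m : kqact 0 m = 0.
Proof. by apply: (addrI (kqact 0 m)); rewrite -kqactD !addr0. Qed.

Lemma kqact_sum I (s : seq I) F m :
  kqact (\sum_(i <- s) F i) m = \sum_(i <- s) kqact (F i) m.
Proof. exact: (big_morph (kqact^~ m) (fun x y => kqactD x y m) (kqact0 m)). Qed.

Lemma kqact_path p m : kqact (path_elt K p) m = pact p m.
Proof.
by rewrite pathbE (kqactw _ msuppU_le) big_seq_fset1 mcoeffUU scale1r.
Qed.

Lemma kqact_lin y c (m m' : r) : kqact y (c *: m + m') = c *: kqact y m + kqact y m'.
Proof.
rewrite /kqact scaler_sumr -big_split /=; apply: eq_bigr => p _.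
by rewrite pact_lin scalerDr !scalerA mulrC.
Qed.

Lemma pact_comp p q m :
  kqact (opath_elt K (Defs.pcomp p q)) m = pact p (pact q m).
Proof.
case e: Defs.pcomp => [t|] /=.
  have [h et] := (pcompP _ _ _).1 e; rewrite kqact_path /pact.
  have -> : pstart t = pstart q by rewrite /pstart et.
  rewrite et /= rword_cat; congr (rword _ _).
  by rewrite -h; apply/esym/rE_word/(qpath_valP q).
rewrite kqact0 {1}/pact.
suff -> : rE r (pstart p) (pact q m) = 0 by rewrite rword0.
rewrite /pact -(@rE_word (pstart q) q.2 m (qpath_valP q)) rEE.
rewrite -/(pend q); case: eqP => // h.
have : Defs.pcomp p q != None.
  rewrite /Defs.pcomp -h eqxx; case: insubP => // /negP[].
  by rewrite /= composable_cat qpath_valP /= -/(pend q) -h; apply: qpath_valP.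
by rewrite e.
Qed.

Lemma kqactM (x y : kQ) m : kqact (x * y) m = kqact x (kqact y m).
Proof.
change (kqact (pa_mul x y) m = kqact x (kqact y m)).
rewrite [in LHS](pathalgE x) pa_suml kqact_sum {2}/kqact.
apply: eq_bigr => p _; rewrite -pa_scaleAl kqactZ; congr (_ *: _).
rewrite [in LHS](pathalgE y) pa_sumr kqact_sum /kqact linear_sum.
apply: eq_bigr => q _; rewrite -pa_scaleAr linearZ /= -pact_comp -pa_mulbb.
exact: kqactZ.
Qed.

Lemma kqact1 m : kqact (pa_one K Q) m = m.
Proof.
rewrite /pa_one kqact_sum -[RHS](rE1 m); apply: eq_bigr => v _.
by rewrite kqact_path.
Qed.

Lemma kqactx0 y : kqact y 0 = 0.
Proof. by rewrite /kqact big1 // => p _; rewrite linear0 scaler0. Qed.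

(** This is what lets the action of the path algebra descend to the quotient. *)
Lemma kqact_ideal x m : x \in @trunc_ideal K Q L -> kqact x m = 0.
Proof.
move=> /trunc_idealP[s sX ->]; rewrite kqact_sum big_seq big1 // => t /sX[p sp ->].
rewrite !kqactM kqact_path.
by rewrite /pact rword_long ?kqactx0 // -/(plength p) sp.
Qed.
End RepAction.

HB.lock Definition lact (K : fieldType) (Q : quiver) (L : nat) (r : qrep K Q L)
  (a : tpalg K Q L) (m : r) : r := kqact (repr a) m.

Definition repmod (K : fieldType) (Q : quiver) (L : nat) (r : qrep K Q L) : Type := r.

Section RepModule.
Variables (K : fieldType) (Q : quiver) (L : nat) (r : qrep K Q L).
Local Notation Lambda := (tpalg K Q L).
Local Notation kQ := (pathalg K Q).
Local Notation gen := (@gen K Q L).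
Local Notation scalar1 := (@scalar1 K Q L).

Lemma lact_tpi (y : kQ) (m : r) : lact (tpi L y) m = kqact y m.
Proof.
rewrite lact.unlock; apply/eqP; rewrite -subr_eq0; set z := repr _.
have e : kqact (z - y : kQ) m = 0.
  by apply: kqact_ideal; apply/tpiP; rewrite tpi_repr.
rewrite -e kqactD; apply/eqP; congr (_ + _).
by rewrite -scaleN1r -kqactZ scaleN1r.
Qed.

Lemma lactA (a b : Lambda) (m : r) : lact a (lact b m) = lact (a * b) m.
Proof.
by rewrite -[a]tpi_repr -[b]tpi_repr -tpM !lact_tpi kqactM.
Qed.

Lemma lact1 : left_id 1 (@lact K Q L r).
Proof. by move=> m; rewrite (lact_tpi 1) kqact1. Qed.

Lemma lactDr : right_distributive (@lact K Q L r) +%R.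
Proof.
move=> a m m'; rewrite -[a]tpi_repr !lact_tpi.
by have := kqact_lin (repr a) 1 m m'; rewrite !scale1r.
Qed.

Lemma lactDl (m : r) : {morph (@lact K Q L r)^~ m : a b / a + b}.
Proof.
move=> a b; rewrite -[a]tpi_repr -[b]tpi_repr -tpi_add !lact_tpi.
exact: kqactD.
Qed.

HB.instance Definition _ := GRing.Zmodule.on (repmod r).
HB.instance Definition _ := GRing.Zmodule_isLmodule.Build Lambda (repmod r)
  lactA lact1 lactDr lactDl.

Lemma repmodE (a : Lambda) (m : repmod r) : a *: m = lact a m.
Proof. by []. Qed.

Lemma repmod_gen_vertex v (m : repmod r) : gen (inl v) *: m = rE r v m.
Proof. by rewrite repmodE lact_tpi kqact_path. Qed.

Lemma repmod_gen_arrow a (m : repmod r) : gen (inr a) *: m = rX r a m.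
Proof. by rewrite repmodE lact_tpi kqact_path /pact /= rXE eqxx. Qed.

Lemma repmod_scalar1 c (m : repmod r) : scalar1 c *: m = c *: (m : r).
Proof. by rewrite scalar1E repmodE -[1]/(tpi L _) -tpZ lact_tpi kqactZ kqact1. Qed.

End RepModule.

Section RepHom.
Variables (K : fieldType) (Q : quiver) (L : nat).

Definition rep_hom (r r' : qrep K Q L) (f : 'Hom(r, r')) : Prop :=
  (forall v m, f (rE r v m) = rE r' v (f m)) /\
  (forall a m, f (rX r a m) = rX r' a (f m)).

Lemma rep_hom_linear (r r' : qrep K Q L) (f : 'Hom(r, r')) : rep_hom f ->
  exists g : {linear repmod r -> repmod r'}, forall m : r, g m = f m.
Proof.
move=> [fE fX].
have [||g gE] := @mk_linear _ (repmod r) (repmod r') (fun m => f (m : r)).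
- by move=> u v; apply: linearD.
- apply: gen_linear => [u v|c m|[v|a] m].
  + exact: linearD.
  + by rewrite !repmod_scalar1; apply: linearZ.
  + by rewrite !repmod_gen_vertex.
  + by rewrite !repmod_gen_arrow.
by exists g.
Qed.

Lemma linear_rep_hom (r r' : qrep K Q L) (g : {linear repmod r -> repmod r'}) :
  exists2 f : 'Hom(r, r'), rep_hom f & forall m : r, f m = g m.
Proof.
pose g' (m : r) : r' := g m.
have [||f fE] := @mk_linear K r r' g'.
- by move=> u v; apply: linearD.
- by move=> c m; rewrite /g' -!repmod_scalar1 linearZ.
exists (linfun f); last by move=> m; rewrite lfunE fE.
split=> [v|a] m; rewrite !lfunE !fE /g'.
  by rewrite -!repmod_gen_vertex linearZ.
by rewrite -!repmod_gen_arrow linearZ.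
Qed.

End RepHom.

(** * The radical filtration of a representation *)

Section RadicalFiltration.
Variables (K : fieldType) (Q : quiver) (L : nat) (r : qrep K Q L).
Implicit Types (U W : {vspace r}) (v j : vertex Q).

Definition vpart j U : {vspace r} := (rE r j @: U)%VS.
Definition Jmul U : {vspace r} := (\sum_a rX r a @: U)%VS.
Definition Jpow l : {vspace r} := iter l Jmul fullv.
Definition vstable U : Prop := forall v, (vpart v U <= U)%VS.
Definition submodule U : Prop := vstable U /\ (Jmul U <= U)%VS.

Lemma rX_src a m : rX r a m = rX r a (rE r (src a) m).
Proof. by rewrite rXE eqxx. Qed.

Lemma rXU_src a U : (rX r a @: U)%VS = (rX r a @: vpart (src a) U)%VS.
Proof.
rewrite /vpart -limg_comp; apply: eq_in_limg => m _.
by rewrite comp_lfunE -rX_src.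
Qed.

Lemma memv_vpart j U m : vstable U ->
  (m \in vpart j U) = (m \in U) && (rE r j m == m).
Proof.
move=> sU; apply/idP/andP=> [h|[mU /eqP <-]]; last exact: memv_img.
split; first exact: (subvP (sU j)).
by have /memv_imgP[u _ ->] := h; rewrite rEE eqxx.
Qed.

Lemma vstableP U : vstable U -> forall v m, m \in U -> rE r v m \in U.
Proof. by move=> sU v m mU; apply: (subvP (sU v)); apply: memv_img. Qed.

Lemma vpartS j U W : (U <= W)%VS -> (vpart j U <= vpart j W)%VS.
Proof. exact: limgS. Qed.

Lemma JmulS U W : (U <= W)%VS -> (Jmul U <= Jmul W)%VS.
Proof.
move=> h; apply/subv_sumP=> a _; apply: subv_trans (limgS _ h) _.
exact: (sumv_sup a).
Qed.

Lemma rX_Jmul a m U : m \in U -> rX r a m \in Jmul U.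
Proof. by move=> mU; apply: (subvP (sumv_sup a _ (subvv _))) => //; apply: memv_img. Qed.

Lemma vpart_Jmul j U : vpart j (Jmul U) = (\sum_(a | tgt a == j) rX r a @: U)%VS.
Proof.
rewrite /vpart /Jmul limg_sum [in RHS]big_mkcond /=; apply: eq_bigr => a _.
rewrite -limg_comp; case: eqP => h.
  by apply: eq_in_limg => m _; rewrite comp_lfunE rEX h eqxx.
apply/eqP; rewrite -subv0; apply/subvP=> m /memv_imgP[u _ ->].
by rewrite comp_lfunE rEX; case: eqP h => // _ _; rewrite mem0v.
Qed.

Lemma vstable_Jmul U : vstable (Jmul U).
Proof.
move=> v; rewrite vpart_Jmul; apply/subv_sumP => a _; exact: (sumv_sup a).
Qed.

Lemma vstable_full : vstable fullv.
Proof. by move=> v; apply: subvf. Qed.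

Lemma vstable_cap U W : vstable U -> vstable W -> vstable (U :&: W)%VS.
Proof.
move=> sU sW v; apply/subvP=> m /memv_imgP[u]; rewrite memv_cap => /andP[uU uW] ->.
by rewrite memv_cap !vstableP.
Qed.

Lemma Jpow_sub l : (Jpow l.+1 <= Jpow l)%VS.
Proof. by elim: l => [|l IHl]; [apply: subvf | apply: JmulS]. Qed.

Lemma submodule_Jpow l : submodule (Jpow l).
Proof.
split; last exact: Jpow_sub.
by case: l => [|l]; [apply: vstable_full | apply: vstable_Jmul].
Qed.

Lemma submodule_full : submodule fullv.
Proof. exact: (submodule_Jpow 0). Qed.

(** A vector of [Jpow l] is a sum of images of words of length [l], and words of
    more than [L] arrows vanish. *)
Lemma Jpow_nil : Jpow L.+1 = 0%VS.
Proof.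
apply/eqP; rewrite -subv0; apply/subvP=> m.
suff: forall l s m, m \in Jpow l -> (size s + l)%N = L.+1 -> rword m s = 0.
  by move=> h hm; rewrite memv0; apply/eqP; apply: (h L.+1 [::]).
elim=> [|l IHl] s u; first by rewrite addn0 => _ h; apply: rword_long; rewrite h.
move=> /memv_sumP[f fJ ->] h.
have -> : rword (\sum_a f a) s = \sum_a rword (f a) s.
  elim/big_rec2: _ => [|a x y _ IH]; first exact: rword0.
  by rewrite -[f a]scale1r rword_lin IH !scale1r.
rewrite big1 // => a _; have /memv_imgP[w wJ ->] := fJ a isT.
by rewrite -[rword _ s]/(rword w (a :: s)); apply: IHl => //=; rewrite addSnnS.
Qed.

Lemma Jpow_mono l m : (l <= m)%N -> (Jpow m <= Jpow l)%VS.
Proof.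
elim: m => [|m IHm]; first by rewrite leqn0 => /eqP ->.
rewrite leq_eqVlt => /predU1P[-> //|/IHm]; exact: subv_trans (Jpow_sub _).
Qed.

Lemma dim_vstable U : vstable U -> \dim U = (\sum_j \dim (vpart j U))%N.
Proof.
move=> sU; have eU : U = (\sum_j vpart j U)%VS.
  apply/eqP; rewrite eqEsubv; apply/andP; split; last by apply/subv_sumP.
  apply/subvP=> m mU; rewrite -(rE1 m); apply: memv_sumr => j _.
  exact: memv_img.
rewrite {1}eU; have /directvP -> // : directv (\sum_j vpart j U).
apply/directv_sum_independent => f fU f0 j _.
have -> : f j = rE r j (\sum_i f i).
  rewrite linear_sum (bigD1 j) //= big1 ?addr0.
    by move: (fU j isT); rewrite memv_vpart // => /andP[_ /eqP].
  move=> i ij; move: (fU i isT); rewrite memv_vpart // => /andP[_ /eqP <-].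
  by rewrite rEE eq_sym (negPf ij).
by rewrite f0 linear0.
Qed.

Lemma vstable_eq U W : vstable U -> vstable W -> (U <= W)%VS ->
  (forall j, \dim (vpart j U) = \dim (vpart j W)) -> U = W.
Proof.
move=> sU sW UW h; apply/eqP; rewrite eqEdim UW (dim_vstable sU) (dim_vstable sW).
by rewrite leq_eqVlt (eq_bigr _ (fun i _ => h i)) eqxx.
Qed.

(** Nakayama's lemma. *)
Lemma Jmul_generate U : submodule U -> (U + Jmul fullv)%VS = fullv -> U = fullv.
Proof.
move=> [sU JU] h; have step l : (U + Jpow l)%VS = fullv.
  elim: l => [|l IHl]; first exact: addvf.
  apply/eqP; rewrite eqEsubv subvf /= -[X in (X <= _)%VS]h subv_add addvSl /=.
  rewrite -IHl; apply/subv_sumP=> a _; rewrite limgD.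
  apply: addvS; first by apply: subv_trans JU; apply: (sumv_sup a).
  exact: (sumv_sup a).
by have := step L.+1; rewrite Jpow_nil addv0.
Qed.

Lemma Jmul_fixed0 U : (U <= Jmul U)%VS -> U = 0%VS.
Proof.
move=> h; apply/eqP; rewrite -subv0 -Jpow_nil.
elim: L.+1 => [|l IHl]; first exact: subvf.
by apply: subv_trans h _; apply: JmulS.
Qed.

(** ** Subrepresentations *)

Section Subrep.
Variables (U : {vspace r}) (hU : submodule U).

Lemma subrep_E v m : m \in U -> rE r v m \in U.
Proof. exact: (vstableP hU.1). Qed.

Lemma subrep_X a m : m \in U -> rX r a m \in U.
Proof. by move=> mU; apply: (subvP hU.2); apply: rX_Jmul. Qed.

Definition subE v : 'End(subvs_of U) := linfun (vsproj U \o rE r v \o vsval).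
Definition subX a : 'End(subvs_of U) := linfun (vsproj U \o rX r a \o vsval).

Lemma subE_val v m : vsval (subE v m) = rE r v (vsval m).
Proof. by rewrite lfunE /= vsprojK // subrep_E // subvsP. Qed.

Lemma subX_val a m : vsval (subX a m) = rX r a (vsval m).
Proof. by rewrite lfunE /= vsprojK // subrep_X // subvsP. Qed.

Lemma subrep_rEE v w m : subE v (subE w m) = if v == w then subE v m else 0.
Proof. by apply: subvs_inj; rewrite !subE_val rEE; case: eqP; rewrite ?subE_val ?linear0. Qed.
Lemma subrep_rE1 m : \sum_v subE v m = m.
Proof.
apply: subvs_inj; rewrite linear_sum -[RHS](rE1 (vsval m)).
by apply: eq_bigr => v _; rewrite /= subE_val.
Qed.
Lemma subrep_rXE a v m : subX a (subE v m) = if src a == v then subX a m else 0.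
Proof.
by apply: subvs_inj; rewrite subX_val subE_val rXE; case: eqP; rewrite ?subX_val ?linear0.
Qed.
Lemma subrep_rEX a v m : subE v (subX a m) = if tgt a == v then subX a m else 0.
Proof.
by apply: subvs_inj; rewrite subE_val subX_val rEX; case: eqP; rewrite ?subX_val ?linear0.
Qed.
Lemma subrep_rX0 s m : size s = L.+1 -> foldl (fun m a => subX a m) m s = 0.
Proof.
move=> h; apply: subvs_inj; rewrite linear0 -[RHS](rX0 (vsval m) h).
by elim: s m {h} => //= a s IHs m; rewrite IHs subX_val.
Qed.

Definition subrep : qrep K Q L :=
  QRep subrep_rEE subrep_rE1 subrep_rXE subrep_rEX subrep_rX0.
End Subrep.
End RadicalFiltration.

Section RepHomFiltration.
Variables (K : fieldType) (Q : quiver) (L : nat) (r r' : qrep K Q L).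
Variables (f : 'Hom(r, r')) (hf : rep_hom f).

Lemma rep_hom_vpart j U : (f @: vpart j U)%VS = vpart j (f @: U)%VS.
Proof.
rewrite /vpart -!limg_comp; apply: eq_in_limg => m _.
by rewrite !comp_lfunE hf.1.
Qed.

Lemma rep_hom_Jmul U : (f @: Jmul U)%VS = Jmul (f @: U)%VS.
Proof.
rewrite /Jmul limg_sum; apply: eq_bigr => a _.
by rewrite -!limg_comp; apply: eq_in_limg => m _; rewrite !comp_lfunE hf.2.
Qed.

Lemma rep_hom_iter_Jmul l U : (f @: iter l (@Jmul _ _ _ r) U)%VS = iter l (@Jmul _ _ _ r') (f @: U)%VS.
Proof. by elim: l => //= l IHl; rewrite rep_hom_Jmul IHl. Qed.

Lemma rep_hom_submodule U : submodule U -> submodule (f @: U)%VS.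
Proof.
move=> [sU JU]; split=> [v|]; last by rewrite -rep_hom_Jmul limgS.
by rewrite -rep_hom_vpart limgS.
Qed.

Lemma rep_hom_ker : submodule (lker f).
Proof.
split=> [v|]; apply/subvP=> m.
  move=> /memv_imgP[u]; rewrite !memv_ker => /eqP fu ->.
  by rewrite hf.1 fu linear0.
move=> /memv_sumP[g gU ->]; rewrite memv_ker linear_sum big1 // => a _.
have /memv_imgP[u] := gU a isT; rewrite memv_ker => /eqP fu ->.
by rewrite /= hf.2 fu linear0.
Qed.

Lemma rep_hom_inj_dim j l : lker f == 0%VS ->
  \dim (vpart j (Jpow r l)) = \dim (vpart j (iter l (@Jmul _ _ _ r') (limg f))).
Proof.
move=> f0; rewrite -rep_hom_iter_Jmul -rep_hom_vpart limg_dim_eq //.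
by rewrite (eqP f0) capv0.
Qed.

Lemma rep_hom_bij_dim j l : lker f == 0%VS -> limg f = fullv ->
  \dim (vpart j (Jpow r l)) = \dim (vpart j (Jpow r' l)).
Proof. by move=> f0 fS; rewrite rep_hom_inj_dim // fS. Qed.

End RepHomFiltration.

Section SubrepIncl.
Variables (K : fieldType) (Q : quiver) (L : nat) (r : qrep K Q L).
Variables (U : {vspace r}) (hU : submodule U).

Definition incl : 'Hom(subrep hU, r) := linfun (@vsval K r U).

Lemma inclE m : incl m = vsval m.
Proof. exact: lfunE. Qed.

Lemma incl_hom : rep_hom incl.
Proof.
by split=> [v|a] m; rewrite !inclE; [apply: subE_val | apply: subX_val].
Qed.

Lemma incl_inj : lker incl == 0%VS.
Proof. by apply/lker0P=> x y; rewrite !inclE; apply: subvs_inj. Qed.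

Lemma incl_img : limg incl = U.
Proof.
apply/eqP; rewrite eqEsubv; apply/andP; split; apply/subvP=> m.
  by move=> /memv_imgP[u _ ->]; rewrite inclE; apply: subvsP.
by move=> mU; apply/memv_imgP; exists (vsproj U m); rewrite ?memvf // inclE vsprojK.
Qed.

Lemma dim_subrep j l :
  \dim (vpart j (Jpow (subrep hU) l)) = \dim (vpart j (iter l (@Jmul _ _ _ r) U)).
Proof. by rewrite (rep_hom_inj_dim incl_hom) ?incl_inj // incl_img. Qed.

End SubrepIncl.

(** * The Jacobson radical *)

Section Jacobson.
Variables (K : fieldType) (Q : quiver) (L : nat).
Local Notation Lambda := (tpalg K Q L).
Local Notation gen := (@gen K Q L).
Local Notation scalar1 := (@scalar1 K Q L).
Local Notation opth := (@opth K Q L).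
Local Notation pth p := (opth (Some p)).

(** The [k]-th power of the ideal generated by the arrows. *)
Inductive arrow_pow (k : nat) : Lambda -> Prop :=
| arrow_pow0 : arrow_pow k 0
| arrow_powD a b : arrow_pow k a -> arrow_pow k b -> arrow_pow k (a + b)
| arrow_pow_path c p : (k <= plength p)%N -> arrow_pow k (c *: pth p).

Lemma arrow_pow_all a : arrow_pow 0 a.
Proof. by elim/opth_ind: a => [|a b|c p]; [apply: arrow_pow0 | apply: arrow_powD | apply: arrow_pow_path]. Qed.

Lemma arrow_pow_mono k l a : (l <= k)%N -> arrow_pow k a -> arrow_pow l a.
Proof.
move=> lk; elim=> [|b c _ + _|c p kp]; [exact: arrow_pow0 | exact: arrow_powD | apply: arrow_pow_path].
exact: leq_trans kp.
Qed.

Lemma arrow_powM k l a b : arrow_pow k a -> arrow_pow l b -> arrow_pow (k + l) (a * b).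
Proof.
move=> da db; elim: da => [|x y _ IHx _ IHy|c p kp].
- by rewrite mul0r; apply: arrow_pow0.
- by rewrite mulrDl; apply: arrow_powD.
elim: db => [|x y _ IHx _ IHy|d q lq].
- by rewrite mulr0; apply: arrow_pow0.
- by rewrite mulrDr; apply: arrow_powD.
rewrite -tp_scalerAl -tp_scalerAr scalerA opthM.
case e: Defs.pcomp => [t|]; last by rewrite opthN scaler0; apply: arrow_pow0.
apply: arrow_pow_path; have [_ et] := (pcompP _ _ _).1 e.
by rewrite /plength et size_cat addnC leq_add.
Qed.

Lemma arrow_pow_nil a : arrow_pow L.+1 a -> a = 0.
Proof.
elim=> [//|x y _ -> _ ->|c p h]; first by rewrite addr0.
by rewrite opth_long ?scaler0.
Qed.

(** If [a] were outside the maximal left ideal [I], then [1 = x + b * a] with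
    [x] in [I], and [a = a * x + a * b * a], where [a * b * a] lies in a higher
    power of the arrow ideal. As these powers end in 0, descending induction puts
    [a] into [I]. *)
Lemma arrow_pow_maximal I k a : maximal_left_ideal I -> (1 <= k)%N -> arrow_pow k a -> I a.
Proof.
move=> [[I0 ID IM] I1 Imax].
have [n] : exists n, (L.+1 - k <= n)%N by exists (L.+1 - k)%N.
elim: n k a => [|n IHn] k a; rewrite ?leqn0 ?subn_eq0 => hn k1 da.
  by rewrite (arrow_pow_nil (arrow_pow_mono hn da)).
apply: contrapT => nIa.
pose I' := [set y | exists x b, I x /\ y = x + b * a] : set Lambda.
have /contrapT[x [b [Ix e1]]] : ~ ~ I' 1.
  move=> nI1; apply: nIa; apply: (Imax I') => //.
  - split.
    + by exists 0, 0; split=> //; rewrite mul0r addr0.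
    + move=> _ _ [x [b [Ix ->]]] [y [c [Iy ->]]].
      by exists (x + y), (b + c); split; [apply: ID | rewrite mulrDl addrACA].
    + move=> c _ [x [b [Ix ->]]]; exists (c * x), (c * b).
      by split; [apply: IM | rewrite mulrDr mulrA].
  - by move=> x Ix; exists x, 0; rewrite mul0r addr0.
  - by exists 0, 1; split=> //; rewrite mul1r add0r.
apply: nIa; rewrite -[a]mulr1 e1 mulrDr; apply: ID; first exact: IM.
apply: (IHn k.+1) => //; first by rewrite leq_subLR addSnnS -leq_subLR.
apply: (@arrow_pow_mono (k + (0 + k))); first by rewrite add0n -addn1 leq_add2l.
exact: arrow_powM (arrow_powM (arrow_pow_all b) da).
Qed.

Lemma arrow_pow_jacobson a : arrow_pow 1 a -> jacobson_radical a.
Proof. by move=> da I hI; apply: (arrow_pow_maximal hI (k := 1)). Qed.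

Lemma gen_arrow_jacobson a : jacobson_radical (gen (inr a)).
Proof. by apply: arrow_pow_jacobson; rewrite gen_arrowE -[opth _]scale1r; apply: arrow_pow_path. Qed.

Lemma vertex_arrow_pow a : exists (c : vertex Q -> K) (b : Lambda),
  arrow_pow 1 b /\ a = \sum_v c v *: gen (inl v) + b.
Proof.
elim/opth_ind: a => [|a1 a2 [c1 [b1 [d1 ->]]] [c2 [b2 [d2 ->]]]|c p].
- exists (fun=> 0), 0; split; first exact: arrow_pow0.
  by rewrite big1 ?addr0 // => v _; rewrite scale0r.
- exists (fun v => c1 v + c2 v), (b1 + b2); split; first exact: arrow_powD.
  rewrite addrACA -big_split /=; congr (_ + _).
  by apply: eq_bigr => v _; rewrite scalerDl.
case: (posnP (plength p)) => h.
  exists (fun v => if v == pstart p then c else 0), 0; split; first exact: arrow_pow0.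
  rewrite addr0 (bigD1 (pstart p)) //= eqxx big1 ?addr0 => [|v /negPf ->].
    rewrite gen_vertexE; congr (_ *: opth (Some _)); apply: val_inj => /=.
    by rewrite [LHS]surjective_pairing (size0nil h).
  by rewrite scale0r.
exists (fun=> 0), (c *: pth p); split; first exact: arrow_pow_path.
by rewrite big1 ?add0r // => v _; rewrite scale0r.
Qed.

(** ** The simple modules *)

Section Simple.
Variable j : vertex Q.

Definition simE v : 'End(K^o : vectType K) := if v == j then \1%VF else 0.
Definition simX (a : arrow Q) : 'End(K^o : vectType K) := 0.

Lemma sim_rEE v w m : simE v (simE w m) = if v == w then simE v m else 0.
Proof.
rewrite /simE; case: (v =P w) => [->|vw].
  by case: (w == j); rewrite ?id_lfunE ?zero_lfunE.
case: (v =P j) => [vj|_]; last by rewrite zero_lfunE.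
by rewrite -vj eq_sym; case: eqP vw => // _ _; rewrite id_lfunE zero_lfunE.
Qed.
Lemma sim_rE1 m : \sum_v simE v m = m.
Proof.
rewrite (bigD1 j) //= big1 => [|v /negPf vj]; rewrite /simE ?eqxx ?vj.
  by rewrite id_lfunE addr0.
by rewrite zero_lfunE.
Qed.
Lemma sim_rXE a v m : simX a (simE v m) = if src a == v then simX a m else 0.
Proof. by rewrite /simX !zero_lfunE; case: eqP. Qed.
Lemma sim_rEX a v m : simE v (simX a m) = if tgt a == v then simX a m else 0.
Proof. by rewrite /simX !zero_lfunE linear0; case: eqP. Qed.
Lemma sim_rX0 s m : size s = L.+1 -> foldl (fun m a => simX a m) m s = 0.
Proof.
case: s => //= a s _; rewrite /simX zero_lfunE.
by elim: s => //= b s; rewrite zero_lfunE.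
Qed.

Definition simrep : qrep K Q L := QRep sim_rEE sim_rE1 sim_rXE sim_rEX sim_rX0.

Definition sim1 : repmod simrep := (1 : K).

Lemma arrow_pow_sim a (m : repmod simrep) : arrow_pow 1 a -> a *: m = 0.
Proof.
elim=> [|x y _ e1 _ e2|c p h]; first by rewrite scale0r.
  by rewrite scalerDl e1 e2 addr0.
rewrite tp_scalerA pth_act; move: h; rewrite /plength.
move: (gen _ *: m) (p.2) => u [|b s] //= _.
rewrite /word_act /= repmod_gen_arrow [X in foldl _ X _]zero_lfunE.
have -> : foldl (fun (m : repmod simrep) a => gen (inr a) *: m) 0 s = 0.
  by elim: s => //= c' s; rewrite scaler0.
by rewrite scaler0.
Qed.

Lemma simE1 v (m : repmod simrep) : gen (inl v) *: m = if v == j then m else 0.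
Proof.
rewrite repmod_gen_vertex -[rE _ _]/(simE v) /simE; case: eqP => _.
  exact: id_lfunE.
exact: zero_lfunE.
Qed.

Lemma sim_scale c (a : Lambda) (m : repmod simrep) : (c *: a) *: m = c * (a *: m).
Proof. by rewrite tp_scalerA repmod_scalar1. Qed.

Lemma sim_coef (c : vertex Q -> K) b :
  arrow_pow 1 b -> (\sum_v c v *: gen (inl v) + b) *: sim1 = c j.
Proof.
move=> db; rewrite scalerDl (arrow_pow_sim _ db).
have -> : (\sum_v c v *: gen (inl v)) *: sim1 = c j.
  rewrite scaler_suml (bigD1 j) //= big1 => [|v /negPf vj].
    by rewrite sim_scale simE1 eqxx [LHS]addr0; apply: mulr1.
  by rewrite sim_scale simE1 vj; apply: mulr0.
exact: addr0.
Qed.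

(** The annihilators of the one-dimensional modules are the maximal left ideals
    that cut the radical down to the arrow ideal. *)
Lemma sim_ann_maximal : maximal_left_ideal [set a : Lambda | a *: sim1 = 0].
Proof.
split=> /= [||I' [I0 ID IM] I1 II' x I'x].
- split=> /= [|x y ex ey|a x ex]; first exact: scale0r.
    by rewrite scalerDl ex ey addr0.
  by rewrite -scalerA ex scaler0.
- by rewrite scale1r; apply/eqP/oner_neq0.
apply: contrapT => /= /eqP; set c := (x *: sim1 : K) => c0.
apply: I1; rewrite -[1](subrK (scalar1 c^-1 * x)); apply: ID; last exact: IM.
apply: II' => /=; rewrite scalerBl scale1r -scalerA repmod_scalar1.
by rewrite [X in _ - X]mulVf ?subrr.
Qed.

Lemma jacobson_sim a : jacobson_radical a -> a *: sim1 = 0.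
Proof. by move=> /(_ _ sim_ann_maximal). Qed.

End Simple.

Lemma jacobson_arrow_pow a : jacobson_radical a <-> arrow_pow 1 a.
Proof.
split=> [|/arrow_pow_jacobson //].
have [c [b [db ->]]] := vertex_arrow_pow a => Ja.
rewrite big1 ?add0r // => v _; have := jacobson_sim v Ja.
by rewrite sim_coef // => ->; rewrite scale0r.
Qed.

Lemma simrep_simple j : is_simple_at j (repmod (simrep j) : lmodType Lambda).
Proof.
exists (fun a : Lambda => a *: sim1 j); split.
- by move=> u v _ _; rewrite scalerDl.
- by move=> a u _; rewrite scalerA.
- move=> x; exists (scalar1 x * gen (inl j)); first by exists (scalar1 x).
  by rewrite -scalerA simE1 eqxx repmod_scalar1; apply: mulr1.
move=> _ [a ->] /=; split=> [|[b Jb ->]]; last first.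
  by rewrite -scalerA simE1 eqxx jacobson_sim.
have [c [b [db ->]]] := vertex_arrow_pow a.
rewrite -scalerA simE1 eqxx sim_coef // => cj.
exists b; first exact: arrow_pow_jacobson.
rewrite mulrDl mulr_suml big1 ?add0r // => v _.
rewrite -tp_scalerAl gen_vertexM; case: eqP => [->|_]; last by rewrite scaler0.
by rewrite cj scale0r.
Qed.

Lemma simple_generator j (T : lmodType Lambda) : is_simple_at j T ->
  exists t : T, [/\ forall i, gen (inl i) *: t = if i == j then t else 0,
    forall x, exists c, x = scalar1 c *: t & t <> 0].
Proof.
move=> [phi [phiD phiZ phiS phi0]]; set e := gen (inl j) in phiD phiZ phiS phi0 *.
have Ue a : [set x | exists a, x = a * e] (a * e : Lambda^o) by exists a.
have p0 : phi 0 = 0.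
  have U0 : [set x | exists a, x = a * e] (0 : Lambda^o) by exists 0; rewrite mul0r.
  by apply: (addrI (phi 0)); rewrite -phiD // !addr0.
have ee : e = e * e by rewrite /e gen_vertexM eqxx.
have Uee : [set x | exists a, x = a * e] (e : Lambda^o) by exists e.
exists (phi e); split=> [i|x|].
- rewrite -phiZ //; have -> : gen (inl i) *: (e : Lambda^o) = gen (inl i) * e by [].
  rewrite gen_vertexM; case: eqP => [->|_] //.
- have [u [a ->] <-] := phiS x.
  have [c [b [db ->]]] := vertex_arrow_pow a; exists (c j).
  have -> : (\sum_v c v *: gen (inl v) + b) * e = scalar1 (c j) * e + b * e.
    rewrite mulrDl; congr (_ + _); rewrite mulr_suml (bigD1 j) //= big1.
      by rewrite addr0 -tp_scalerAl -/e -ee tp_scaleE.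
    by move=> v /negPf vj; rewrite -tp_scalerAl gen_vertexM vj scaler0.
  rewrite phiD // -phiZ //.
  have -> : phi (b * e) = 0.
    by apply/phi0 => //; exists b => //; apply: arrow_pow_jacobson.
  by rewrite addr0.
move=> /phi0[] // a Ja ea; have := jacobson_sim j Ja.
have : e *: sim1 j = 0 by rewrite ea -scalerA simE1 eqxx; apply: jacobson_sim.
by rewrite simE1 eqxx => /eqP; rewrite (negPf (oner_neq0 _)).
Qed.

(** ** The radical powers of a representation *)

Section Radpow.
Variable r : qrep K Q L.

Lemma arrow_pow_Jmul a (U : {vspace r}) (m : r) : submodule U -> arrow_pow 1 a -> m \in U ->
  (a *: (m : repmod r) : r) \in Jmul U.
Proof.
move=> hU da mU; elim: da => [|x y _ h1 _ h2|c p h].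
- by rewrite scale0r; apply: mem0v.
- by rewrite scalerDl; apply: rpredD.
rewrite tp_scalerA repmod_scalar1; apply: rpredZ; rewrite pth_act.
move: h; rewrite /plength.
have : (gen (inl (pstart p)) *: (m : repmod r) : r) \in U.
  by rewrite repmod_gen_vertex; apply: subrep_E.
move: (gen _ *: _) (p.2) => u s uU; case/lastP: s => // s b _.
rewrite /word_act foldl_rcons repmod_gen_arrow; apply: rX_Jmul.
elim: s u uU => //= d s IHs u uU; apply: IHs.
by rewrite repmod_gen_arrow; apply: subrep_X.
Qed.

Lemma radpow_rep l : radpow (repmod r) l = [set m | (m : r) \in Jpow r l].
Proof.
apply/funext => m; apply/propext; elim: l m => [|l IHl] m.
  by split=> // _; apply: memvf.
rewrite /radpow iterS -[iter l _ _]/(radpow (repmod r) l); split=> /=.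
  move=> [s hs ->]; rewrite big_seq; apply: memv_suml => t /hs[Jt /IHl Mt].
  by apply: arrow_pow_Jmul => //; [exact: submodule_Jpow | apply/jacobson_arrow_pow].
move=> /memv_sumP[f fJ ->].
have h a : exists u, u \in Jpow r l /\ f a = rX r a u.
  by have /memv_imgP[u uJ ->] := fJ a isT; exists u.
have [u uE] := choice h.
exists [seq (gen (inr a), u a : repmod r) | a <- index_enum (arrow Q)].
  move=> t /mapP[a _ ->] /=; split; first exact: gen_arrow_jacobson.
  by apply/IHl; case: (uE a).
rewrite big_map; apply: eq_bigr => a _.
by rewrite repmod_gen_arrow; case: (uE a).
Qed.

End Radpow.
End Jacobson.

(** * Radical layerings and dimensions *)

Section LayeringIso.
Variables (R : pzRingType) (M N : lmodType R) (f : {linear M -> N}).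
Hypothesis bf : bijective f.

Lemma radpow_iso l m : radpow N l (f m) <-> radpow M l m.
Proof.
have [g [fK gK]] := linear_iso_inv bf.
elim: l m => [//|l IHl] m; split=> -[s sJ].
  move=> /(congr1 g); rewrite fK linear_sum => ->.
  exists [seq (t.1, g t.2) | t <- s].
    move=> _ /mapP[t ts ->] /=; have [Jt Nt] := sJ t ts; split=> //.
    by apply/IHl; rewrite gK.
  by rewrite big_map; apply: eq_bigr => t _; rewrite linearZ.
move=> ->; rewrite linear_sum; exists [seq (t.1, f t.2) | t <- s].
  move=> _ /mapP[t ts ->] /=; have [Jt Nt] := sJ t ts; split=> //.
  exact/IHl.
by rewrite big_map; apply: eq_bigr => t _; rewrite linearZ.
Qed.
End LayeringIso.

Section Layering.
Variables (K : fieldType) (Q : quiver) (L : nat).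
Local Notation Lambda := (tpalg K Q L).
Local Notation gen := (@gen K Q L).
Local Notation scalar1 := (@scalar1 K Q L).

Lemma scalar1_comm (a : Lambda) c : a * scalar1 c = scalar1 c * a.
Proof. by rewrite scalar1E -tp_scalerAr mulr1 -tp_scalerAl mul1r. Qed.

Lemma layering_iso (M N : lmodType Lambda) (f : {linear M -> N}) S :
  bijective f -> has_radical_layering M S -> has_radical_layering N S.
Proof.
move=> bf h l; have [X [T [[phi [pD pZ pS p0]] hT hX]]] := h l.
have [g [fK gK]] := linear_iso_inv bf.
have rM k n : radpow N k n -> radpow M k (g n).
  by move=> h'; apply/(radpow_iso bf); rewrite gK.
exists X, T; split=> //; exists (fun n => phi (g n)); split.
- by move=> u v /rM Mu /rM Mv; rewrite linearD pD.
- by move=> a u /rM Mu; rewrite linearZ pZ.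
- move=> x; have [u Mu <-] := pS x; exists (f u); last by rewrite fK.
  exact/(radpow_iso bf).
- move=> u /rM Mu; rewrite p0 //; split=> [|/rM //].
  by move=> /(radpow_iso bf); rewrite gK.
Qed.

(** The given isomorphism of the layer with a sum of simples provides vectors of
    [e_j J^l] that form a basis of [e_j J^l] modulo [e_j J^(l+1)]. *)
Lemma layering_dim (r : qrep K Q L) S (l : 'I_L.+1) j :
  has_radical_layering (repmod r : lmodType Lambda) S ->
  \dim (vpart j (Jpow r l)) = (S l j + \dim (vpart j (Jpow r l.+1)))%N.
Proof.
move=> /(_ l)[X [T [[phi [pD pZ pS p0]] hT [iota bij]]]].
rewrite !radpow_rep /= in pD pZ pS p0.
set U := Jpow r l in pD pZ pS p0 *; set W := Jpow r l.+1 in p0 *.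
have UU : submodule U by apply: submodule_Jpow.
have WU : (W <= U)%VS by apply: Jpow_sub.
have sW : vstable W by case: (submodule_Jpow r l.+1).
set n := S l j; have t_ i := cid (simple_generator (hT i)).
pose t i := sval (t_ i).
have tE v i : gen (inl v) *: t i = if v == i then t i else 0.
  by rewrite /t; case: (t_ i) => ? [].
have tS i x : exists c, x = scalar1 c *: t i by rewrite /t; case: (t_ i) => ? [].
have t0 i : t i <> 0 by rewrite /t; case: (t_ i) => ? [].
have phi0 : phi 0 = 0.
  by apply: (addrI (phi 0)); rewrite -pD ?addr0 //; apply: mem0v.
have phi_sum (I : finType) (F : I -> r) : (forall i, F i \in U) ->
    phi (\sum_i F i : r) = \sum_i phi (F i).
  move=> FU; suff [] : phi (\sum_i F i : r) = \sum_i phi (F i) /\ \sum_i F i \in U by [].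
  elim/big_rec2: _ => [|i x y _ [e xU]]; first by split=> //; apply: mem0v.
  by split; [rewrite pD // e | apply: rpredD].
have phiK c (m : r) : m \in U -> phi (c *: m : r) = scalar1 c *: phi m.
  by move=> mU; rewrite -pZ // repmod_scalar1.
have phiE v (m : r) : m \in U -> phi (rE r v m) = gen (inl v) *: phi m.
  by move=> mU; rewrite -pZ // repmod_gen_vertex.
have phiB (x y : r) : x \in U -> y \in U -> phi (x - y : r) = phi x - phi y.
  by move=> xU yU; apply: (addIr (phi y)); rewrite -pD ?subrK //; apply: rpredB.
have iotaG i a v x : gen (inl v) *: iota i a x = iota i a (gen (inl v) *: x).
  by rewrite linearZ.
pose Phi (y : forall i, 'I_(S l i) -> T i) := \sum_i \sum_(a < S l i) iota i a (y i a).
have uX a : exists m : r, m \in vpart j U /\ phi m = iota j a (t j).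
  have [m mU e] := pS (iota j a (t j)).
  exists (rE r j m); split; first exact: memv_img.
  by rewrite phiE // e -linearZ tE eqxx.
have [u uP] := choice uX.
have uU a : u a \in U.
  by have [h _] := uP a; apply: (subvP (UU.1 j)).
(* prescribing coefficients at all vertices at once avoids casts between
   the types of the modules [T i] *)
pose d (c : 'rV[K]_n) i (a : 'I_(S l i)) : K :=
  if i == j then oapp (c 0) 0 (insub (val a)) else 0.
have dE c a : d c j a = c 0 a by rewrite /d eqxx valK.
have PhiD c : Phi (fun i a => scalar1 (d c i a) *: t i) = phi (\sum_a c 0 a *: u a : r).
  rewrite phi_sum => [|a]; last exact: rpredZ.
  rewrite /Phi (bigD1 j) //= [X in _ + X]big1 ?addr0 => [|i /negPf ij].
    by apply: eq_bigr => a _; rewrite dE linearZ phiK // (uP a).2.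
  by rewrite big1 // => a _; rewrite /d ij scalar1E scale0r scale0r linear0.
have key1 (c : 'rV[K]_n) : \sum_a c 0 a *: u a \in W -> c = 0.
  move=> cW; have : phi (\sum_a c 0 a *: u a : r) = 0.
    by apply/p0 => //; apply: (subvP WU).
  rewrite -PhiD => e; have : Phi (fun i a => scalar1 (d c i a) *: t i) = Phi (fun i a => 0).
    by rewrite e /Phi big1 // => i _; rewrite big1 // => a _; rewrite linear0.
  move=> /(bij_inj bij)/(congr1 (fun y => y j)) e'.
  apply/rowP=> a; rewrite mxE; move/(congr1 (fun y => y a)): e' => /=.
  rewrite dE; case: (eqVneq (c 0 a) 0) => // ca /(congr1 (fun x => scalar1 (c 0 a)^-1 *: x)).
  rewrite scalerA scaler0; have -> : scalar1 (c 0 a)^-1 * scalar1 (c 0 a) = 1.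
    by rewrite !scalar1E -tp_scalerAl mul1r scalerA mulVf // scale1r.
  by rewrite scale1r => /t0.
have key2 m : m \in vpart j U -> exists c : 'rV[K]_n, m - \sum_a c 0 a *: u a \in vpart j W.
  rewrite memv_vpart; last exact: UU.1.
  move=> /andP[mU /eqP mj]; have [g gK Kg] := bij.
  have h i a : exists c, g (phi m) i a = scalar1 c *: t i by apply: tS.
  pose c i a := sval (cid (h i a)).
  have cE i a : g (phi m) i a = scalar1 (c i a) *: t i by rewrite /c; case: cid.
  have e : phi m = \sum_a scalar1 (c j a) *: iota j a (t j).
    rewrite -[in LHS]mj phiE // -[phi m]Kg scaler_sumr (bigD1 j) //=.
    rewrite [X in _ + X]big1 ?addr0 => [|i /negPf ij].
      rewrite scaler_sumr; apply: eq_bigr => a _.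
      by rewrite cE iotaG scalerA scalar1_comm -scalerA tE eqxx linearZ.
    rewrite scaler_sumr big1 // => a _.
    by rewrite cE iotaG scalerA scalar1_comm -scalerA tE eq_sym ij scaler0 linear0.
  exists (\row_a c j a); rewrite memv_vpart //; apply/andP; split; last first.
    apply/eqP; rewrite linearB /= mj linear_sum; congr (_ - _); apply: eq_bigr => a _.
    rewrite linearZ /=; congr (_ *: _); have [h' _] := uP a.
    by move: h'; rewrite memv_vpart; [case/andP=> _ /eqP | exact: UU.1].
  have sU : \sum_a (\row_a c j a) 0 a *: u a \in U by apply: rpred_sum => a _; apply: rpredZ.
  apply/p0; first exact: rpredB.
  rewrite phiB // e phi_sum => [|a]; last exact: rpredZ.
  apply/eqP; rewrite subr_eq0; apply/eqP; apply: eq_bigr => a _.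
  by rewrite mxE phiK // (uP a).2.
pose h (c : 'rV[K]_n) : r := \sum_a c 0 a *: u a.
have hlin : linear h.
  move=> k c c'; rewrite /h scaler_sumr -big_split /=; apply: eq_bigr => a _.
  by rewrite !mxE scalerDl scalerA.
pose hL := GRing.isLinear.Build K 'rV[K]_n r _ h hlin.
pose H : 'Hom('rV[K]_n, r) := linfun (HB.pack_for {linear 'rV[K]_n -> r} h hL).
have HE c : H c = h c by rewrite lfunE.
have HU : (limg H <= vpart j U)%VS.
  apply/subvP=> _ /memv_imgP[c _ ->]; rewrite HE; apply: rpred_sum => a _.
  by apply: rpredZ; case: (uP a).
have -> : vpart j U = (limg H + vpart j W)%VS.
  apply/eqP; rewrite eqEsubv subv_add HU vpartS // !andbT; apply/subvP=> m /key2[c hc].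
  rewrite -[m](addrNK (h c)) addrC; apply: memv_add => //.
  by rewrite -HE; apply: memv_img; apply: memvf.
rewrite dimv_disjoint_sum; last first.
  apply/eqP; rewrite -subv0; apply/subvP=> m /memv_capP[/memv_imgP[c _ ->]].
  rewrite HE => hW; have /key1 -> : h c \in W by apply: (subvP (sW j)).
  by rewrite memv0 /h big1 // => a _; rewrite mxE scale0r.
have H0 : lker H = 0%VS.
  apply/eqP; rewrite -subv0; apply/subvP=> c; rewrite memv_ker HE => /eqP hc.
  by rewrite memv0; apply/eqP/key1; rewrite -/(h c) hc mem0v.
congr (_ + _)%N; rewrite limg_dim_eq ?H0 ?capv0 //.
by rewrite dimvf dim_matrix; apply: mul1n.
Qed.

(** ** Realizing a layering *)

Section Semisimple.
Variable n : vertex Q -> nat.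
Let I := {j : vertex Q & 'I_(n j)}.
Local Notation V := ({ffun I -> K^o} : vectType K).

Definition ssE0 v (f : V) : V := [ffun k => if tag k == v then f k else 0].
Lemma ssE_lin v : linear (ssE0 v).
Proof.
move=> c f g; apply/ffunP=> k; rewrite !ffunE; case: eqP => //.
by rewrite scaler0 addr0.
Qed.
HB.instance Definition _ v := GRing.isLinear.Build K V V _ (ssE0 v) (ssE_lin v).
Definition ssE v : 'End(V) := linfun (ssE0 v).
Definition ssX (a : arrow Q) : 'End(V) := 0.

Lemma ssEE v f k : ssE v f k = if tag k == v then f k else 0.
Proof. by rewrite lfunE /= ffunE. Qed.

Lemma ss_rEE v w m : ssE v (ssE w m) = if v == w then ssE v m else 0.
Proof.
apply/ffunP=> k; rewrite !ssEE; case: (v =P w) => [->|vw]; rewrite ?ssEE ?ffunE.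
  by case: eqP.
by case: (_ =P v) => // ->; case: eqP vw.
Qed.
Lemma ss_rE1 m : \sum_v ssE v m = m.
Proof.
apply/ffunP=> k; rewrite sum_ffunE (bigD1 (tag k)) //= ssEE eqxx big1 ?addr0 //.
by move=> v /negPf h; rewrite ssEE eq_sym h.
Qed.
Lemma ss_rXE a v m : ssX a (ssE v m) = if src a == v then ssX a m else 0.
Proof. by rewrite /ssX !zero_lfunE; case: eqP. Qed.
Lemma ss_rEX a v m : ssE v (ssX a m) = if tgt a == v then ssX a m else 0.
Proof. by rewrite /ssX !zero_lfunE linear0; case: eqP. Qed.
Lemma ss_rX0 s m : size s = L.+1 -> foldl (fun m a => ssX a m) m s = 0.
Proof.
case: s => //= a s _; rewrite /ssX zero_lfunE.
by elim: s => //= b s; rewrite zero_lfunE.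
Qed.

Definition ssrep : qrep K Q L := QRep ss_rEE ss_rE1 ss_rXE ss_rEX ss_rX0.

Lemma ssrep_direct_sum :
  iso_direct_sum (fun j => repmod (simrep K L j) : lmodType Lambda) n (repmod ssrep).
Proof.
pose io0 i (a : 'I_(n i)) (c : K) : V :=
  [ffun k => if k == Tagged (fun i => 'I_(n i)) a then c else 0].
have ex i a : exists f : {linear repmod (simrep K L i) -> repmod ssrep},
    forall c, f c = io0 i a c.
  have [||f fE] := @mk_linear _ (repmod (simrep K L i)) (repmod ssrep) (io0 i a).
  - move=> u v; apply/ffunP=> k; rewrite !ffunE; case: eqP => // _.
    by rewrite addr0.
  - apply: gen_linear => [u v|c m|[v|b] m].
    + by apply/ffunP=> k; rewrite !ffunE; case: eqP => // _; rewrite addr0.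
    + rewrite !repmod_scalar1; apply/ffunP=> k; rewrite !ffunE.
      by case: eqP => // _; rewrite scaler0.
    + rewrite !repmod_gen_vertex /rE; apply/ffunP=> k; rewrite ssEE !ffunE /= /simE.
      case: (k =P Tagged _ a) => [->|_]; last by case: eqP.
      by rewrite /= eq_sym; case: eqP => _; rewrite ?id_lfunE ?zero_lfunE.
    + rewrite !repmod_gen_arrow /rX; apply/ffunP=> k; rewrite !ffunE /= /simX /ssX.
      by rewrite !zero_lfunE ffunE; case: eqP.
  by exists f.
pose io i a := sval (cid (ex i a)).
have ioE i a c : io i a c = io0 i a c by rewrite /io; case: cid.
exists io.
have sE (y : forall i, 'I_(n i) -> K) (k : I) :
    (\sum_i \sum_(a < n i) io i a (y i a) : V) k = y (tag k) (tagged k).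
  case: k => i a; rewrite sum_ffunE (bigD1 i) //= sum_ffunE (bigD1 a) //=.
  rewrite ioE ffunE eqxx big1 => [|b /negPf ba]; last first.
    by rewrite ioE ffunE eq_Tagged /= eq_sym ba.
  rewrite addr0 big1 ?addr0 // => i' /negPf ii; rewrite sum_ffunE big1 // => b _.
  by rewrite ioE ffunE -tag_eqE /tag_eq /= eq_sym ii.
exists (fun (f : V) i a => f (Tagged (fun i => 'I_(n i)) a)) => [y|f].
  by apply/functional_extensionality_dep => i; apply/funext=> a; rewrite sE.
by apply/ffunP=> -[i a]; rewrite sE.
Qed.
End Semisimple.

(** Complements of [e_j J^(l+1)] in [e_j J^l], one for each vertex, map the layer
    onto a semisimple module through the coordinates in their bases. *)
Lemma dim_layering (r : qrep K Q L) (S : ssseq Q L) :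
  (forall (l : 'I_L.+1) j,
    \dim (vpart j (Jpow r l)) = (S l j + \dim (vpart j (Jpow r l.+1)))%N) ->
  has_radical_layering (repmod r : lmodType Lambda) S.
Proof.
move=> hd l; exists (repmod (ssrep (S l)) : lmodType Lambda).
exists (fun j => repmod (simrep K L j) : lmodType Lambda).
split; [| by move=> j; apply: simrep_simple | exact: ssrep_direct_sum].
rewrite !radpow_rep; set U := Jpow r l; set W := Jpow r l.+1.
have UU : submodule U by apply: submodule_Jpow.
have WU : (W <= U)%VS by apply: Jpow_sub.
have sW : vstable W by case: (submodule_Jpow r l.+1).
pose C j := (vpart j U :\: vpart j W)%VS.
have CW j : (C j :&: vpart j W = 0)%VS by apply: capv_diff.
have CU j : (C j + vpart j W = vpart j U)%VS.
  by rewrite addv_diff; apply/addv_idPl/vpartS.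
have dC j : \dim (C j) = S l j.
  apply/(@addIn (\dim (vpart j W))); rewrite -hd -/U -CU.
  by rewrite dimv_disjoint_sum.
have exb j : exists b : (S l j).-tuple r, basis_of (C j) b.
  by rewrite -dC; exists (vbasis (C j)); apply: vbasisP.
pose b j := sval (cid (exb j)).
have bC j : basis_of (C j) (b j) by rewrite /b; case: cid.
pose pi j := daddv_pi (C j) (vpart j W).
pose phi0 (u : r) : ssrep (S l) :=
  [ffun k : {j & 'I_(S l j)} => coord (b (tag k)) (tagged k) (pi (tag k) (rE r (tag k) u))].
have phil : linear phi0.
  by move=> c u v; apply/ffunP=> k; rewrite !ffunE !linearP.
pose phiL := GRing.isLinear.Build K r (ssrep (S l)) _ phi0 phil.
pose phi : 'Hom(r, ssrep (S l)) := linfun (HB.pack_for {linear r -> ssrep (S l)} phi0 phiL).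
have phiE u k : phi u k = coord (b (tag k)) (tagged k) (pi (tag k) (rE r (tag k) u)).
  by rewrite lfunE /= ffunE.
have piW j w : w \in vpart j W -> pi j w = 0.
  move=> wW; have := @daddv_pi_add _ _ (C j) (vpart j W) w (CW j).
  rewrite (subvP (addvSr _ _)) // => /(_ isT).
  rewrite [daddv_pi (vpart j W) _ _]daddv_pi_id // 1?capvC // => e.
  by apply: (addIr w); rewrite e add0r.
have phiW w : w \in W -> phi w = 0.
  move=> wW; apply/ffunP=> k; rewrite phiE piW ?linear0 ?ffunE //.
  exact: memv_img.
have phiW' w : w \in U -> phi w = 0 -> w \in W.
  move=> wU e; rewrite -(rE1 w); apply: rpred_sum => j _.
  have rU : rE r j w \in vpart j U by apply: memv_img.
  have pi0 : pi j (rE r j w) = 0.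
    rewrite (coord_basis (bC j) (memv_pi _ _ _)) big1 // => a _.
    by have := congr1 (fun f : ssrep (S l) => f (Tagged (fun j => 'I_(S l j)) a)) e; rewrite phiE ffunE => ->; rewrite scale0r.
  have := @daddv_pi_add _ _ (C j) (vpart j W) (rE r j w) (CW j).
  rewrite CU rU => /(_ isT); rewrite -/(pi j) pi0 add0r => <-.
  exact: (subvP (sW j) _ (memv_pi _ _ _)).
have homf : rep_hom (phi \o incl UU)%VF.
  split=> [v|a] u; rewrite !comp_lfunE ?(incl_hom UU).1 ?(incl_hom UU).2.
    apply/ffunP=> k; rewrite [RHS]ssEE !phiE rEE.
    by case: eqP => // _; rewrite !linear0.
  rewrite [RHS]zero_lfunE; apply: phiW; apply: rX_Jmul.
  by rewrite inclE; apply: subvsP.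
have [g gE] := rep_hom_linear homf.
have [q qE] := rep_hom_linear (incl_hom UU).
have qi : injective q by move=> x y; rewrite !qE !inclE; apply: subvs_inj.
pose p (u : repmod r) : repmod (subrep UU) := vsproj U (u : r).
have pE u : (u : r) \in U -> q (p u) = u by move=> uU; rewrite qE inclE /p vsprojK.
have gp u : (u : r) \in U -> g (p u) = phi u.
  by move=> uU; rewrite gE comp_lfunE -qE pE.
exists (fun u => g (p u)); split=> /=.
- by move=> u v uU vU; rewrite !gp //; [apply: linearD | apply: rpredD].
- move=> a u uU; rewrite -linearZ; congr (g _); apply: qi.
  have aU : (a *: u : r) \in U.
    have -> : a *: u = q (a *: p u) by rewrite linearZ /= pE.
    by rewrite qE inclE; apply: subvsP.
  by rewrite linearZ /= !pE.
- move=> x; pose xf : {ffun {j : vertex Q & 'I_(S l j)} -> K^o} := x.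
  pose u : r := \sum_k xf k *: (b (tag k))`_(tagged k).
  have bk (k : {j : vertex Q & 'I_(S l j)}) : (b (tag k))`_(tagged k) \in vpart (tag k) U.
    rewrite -CU; apply: (subvP (addvSl _ _)); apply: (basis_mem (bC _)).
    by apply: mem_nth; rewrite size_tuple.
  have uU : u \in U.
    by apply: rpred_sum => k _; apply: rpredZ; apply: (subvP (UU.1 (tag k))).
  exists u => //; rewrite gp //; apply/ffunP=> k; rewrite phiE /u !linear_sum /=.
  have bE (k' : {j : vertex Q & 'I_(S l j)}) : rE r (tag k) (b (tag k'))`_(tagged k') =
      if tag k == tag k' then (b (tag k'))`_(tagged k') else 0.
    have := bk k'; rewrite memv_vpart; last exact: UU.1.
    by case/andP=> _ /eqP <-; rewrite rEE; case: eqP => [->|].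
  have bC' (k' : {j : vertex Q & 'I_(S l j)}) : (b (tag k'))`_(tagged k') \in C (tag k').
    by apply: (basis_mem (bC _)); apply: mem_nth; rewrite size_tuple.
  rewrite (bigD1 k) //= linearZ /= bE eqxx linearZ /= daddv_pi_id //.
  rewrite linearZ /= coord_free ?eqxx ?(basis_free (bC _)) // mulr1.
  rewrite big1 ?addr0 // => k' kk'; rewrite linearZ /= bE.
  case: eqP => [ek|_]; last by rewrite !linear0.
  case: k k' kk' ek {bE} => i a [i' a'] /= kk' ek; subst i'.
  rewrite linearZ /= daddv_pi_id ?(bC' (Tagged (fun j => 'I_(S l j)) a')) //.
  rewrite linearZ /= coord_free ?(basis_free (bC _)) //.
  case: eqP => [e|]; last by rewrite mulr0.
  by move: kk'; rewrite e eqxx.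
- move=> u uU; rewrite gp //; split=> [|/phiW //]; exact: phiW'.
Qed.

End Layering.

(** * Points of the module variety *)

Section NcEval.
Variables (K : fieldType) (Q : quiver) (A : pzRingType) (c : K -> A).
Variable x : generator Q -> A.
Hypotheses (cD : {morph c : a b / a + b}) (c0 : c 0 = 0).
Local Notation poly := {malg K[{fmonom generator Q}]}.
Local Notation nce := (@nc_eval K Q A c x).

Lemma nc_evalw (d : {fset {fmonom generator Q}}) (f : poly) : (msupp f `<=` d)%fset ->
  nce f = \sum_(m <- d) c f@_m * \prod_(g <- (m : seq (generator Q))) x g.
Proof.
move=> h; rewrite /nc_eval (big_fset_incl _ h) //= => k _ /mcoeff_outdom ->.
by rewrite c0 mul0r.
Qed.

Lemma nc_evalD f g : nce (f + g) = nce f + nce g.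
Proof.
rewrite (nc_evalw (msuppD_le _ _)) (@nc_evalw (msupp f `|` msupp g)%fset f) ?fsubsetUl //.
rewrite (@nc_evalw (msupp f `|` msupp g)%fset g) ?fsubsetUr //.
by rewrite -big_split /=; apply: eq_bigr => p _; rewrite mcoeffD cD mulrDl.
Qed.

Lemma nc_eval0 : nce 0 = 0.
Proof. by apply: (addrI (nce 0)); rewrite -nc_evalD !addr0. Qed.

Lemma nc_eval_word k w :
  nce << k *g FMonom w >> = c k * \prod_(g <- w) x g.
Proof. by rewrite (nc_evalw msuppU_le) big_seq_fset1 mcoeffUU. Qed.

Lemma nc_eval_words (s : seq (K * seq (generator Q))) :
  nce (\sum_(t <- s) << t.1 *g FMonom t.2 >>) =
  \sum_(t <- s) c t.1 * \prod_(g <- t.2) x g.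
Proof.
rewrite (big_morph _ nc_evalD nc_eval0).
by apply: eq_bigr => t _; apply: nc_eval_word.
Qed.
End NcEval.

Section Points.
Variables (K : fieldType) (Q : quiver) (L d : nat).
Local Notation Lambda := (tpalg K Q L).
Local Notation gen := (@gen K Q L).
Implicit Types x : point K Q d.

Record point_rel x : Prop := PointRel {
  prEE : forall v w, x (inl v) *m x (inl w) = if v == w then x (inl v) else 0;
  prE1 : \sum_v x (inl v) = 1%:M;
  prXE : forall a v, x (inr a) *m x (inl v) = if src a == v then x (inr a) else 0;
  prEX : forall a v, x (inl v) *m x (inr a) = if tgt a == v then x (inr a) else 0;
  prX0 : forall s (m : 'cV_d), size s = L.+1 ->
    foldl (fun m a => x (inr a) *m m) m s = 0
}.

Section PointRep.
Variables (x : point K Q d) (hx : point_rel x).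
Local Notation V := ('cV[K]_d : vectType K).

Definition ptE v : 'End(V) := linfun (mulmx (x (inl v))).
Definition ptX a : 'End(V) := linfun (mulmx (x (inr a))).

Lemma pt_rEE v w m : ptE v (ptE w m) = if v == w then ptE v m else 0.
Proof. by rewrite !lfunE /= mulmxA prEE //; case: eqP; rewrite ?mul0mx. Qed.
Lemma pt_rE1 m : \sum_v ptE v m = m.
Proof.
rewrite -[RHS]mul1mx -(prE1 hx) mulmx_suml.
by apply: eq_bigr => v _; rewrite lfunE.
Qed.
Lemma pt_rXE a v m : ptX a (ptE v m) = if src a == v then ptX a m else 0.
Proof. by rewrite !lfunE /= mulmxA prXE //; case: eqP; rewrite ?mul0mx. Qed.
Lemma pt_rEX a v m : ptE v (ptX a m) = if tgt a == v then ptX a m else 0.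
Proof. by rewrite !lfunE /= mulmxA prEX //; case: eqP; rewrite ?mul0mx. Qed.
Lemma pt_rX0 s m : size s = L.+1 -> foldl (fun m a => ptX a m) m s = 0.
Proof.
move=> h; rewrite -[RHS](prX0 hx m h); elim: s m {h} => //= a s IHs m.
by rewrite -IHs lfunE.
Qed.

Definition prep : qrep K Q L := QRep pt_rEE pt_rE1 pt_rXE pt_rEX pt_rX0.

Lemma prepE v (m : prep) : rE prep v m = x (inl v) *m m.
Proof. exact: lfunE. Qed.

Lemma prepX a (m : prep) : rX prep a m = x (inr a) *m m.
Proof. exact: lfunE. Qed.

Lemma prep_gen g (m : repmod prep) : gen g *: m = x g *m (m : 'cV[K]_d).
Proof.
by case: g => [v|a]; [rewrite repmod_gen_vertex prepE | rewrite repmod_gen_arrow prepX].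
Qed.

Lemma prep_word (w : seq (generator Q)) (m : repmod prep) :
  (\prod_(g <- w) gen g) *: m = (\prod_(g <- w) x g) *m (m : 'cV[K]_d).
Proof.
elim: w m => [|g w IHw] m; first by rewrite !big_nil scale1r mul1mx.
by rewrite !big_cons -scalerA IHw prep_gen mulmxA.
Qed.

Lemma point_rel_Mod_d : Mod_d K L d x.
Proof.
move=> f f0; set B := nc_eval _ _ _.
suff h : forall m : 'cV[K]_d, B *m m = 0.
  apply/matrixP => i j; have := h (delta_mx j 0).
  by rewrite -colE => /matrixP/(_ i 0); rewrite !mxE.
move=> m; pose m' : repmod prep := m.
rewrite -[RHS](scale0r m') -f0 /B /nc_eval mulmx_suml scaler_suml.
apply: eq_bigr => w _; rewrite -[RHS]scalerA -scalar1E repmod_scalar1 prep_word.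
by rewrite -[_ * _]/(_ *m _) -mulmxA mul_scalar_mx.
Qed.

Lemma prep_represents : represents x (repmod prep : lmodType Lambda).
Proof.
exists (fun m => m); split=> //; first by exists id.
  by move=> c v; rewrite -scalar1E repmod_scalar1.
by move=> g v; rewrite prep_gen.
Qed.

Lemma represents_iso (M : lmodType Lambda) : represents x M ->
  exists f : {linear repmod prep -> M}, bijective f.
Proof.
move=> [phi [bphi pD pZ pG]].
have [||f fE] := @mk_linear _ (repmod prep) M phi.
- exact: pD.
- apply: gen_linear => [u v|c m|g m]; first exact: pD.
    by rewrite repmod_scalar1 pZ -scalar1E.
  by rewrite prep_gen pG.
by exists f; case: bphi => psi h1 h2; exists psi => m; rewrite fE.
Qed.

End PointRep.

Lemma Mod_d_words x (s : seq (K * seq (generator Q))) : Mod_d K L d x ->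
  \sum_(t <- s) t.1 *: \prod_(g <- t.2) gen g = 0 ->
  \sum_(t <- s) t.1 *: \prod_(g <- t.2) x g = 0.
Proof.
move=> hx h; have := hx (\sum_(t <- s) << t.1 *g FMonom t.2 >>).
rewrite !nc_eval_words; first last.
- by rewrite scale0r.
- by move=> a b; rewrite scalerDl.
- by rewrite raddf0.
- by move=> a b; rewrite raddfD.
move=> h'; under eq_bigr => t _ do rewrite -mul_scalar_mx.
apply: h'; rewrite -[RHS]h; apply: eq_bigr => t _.
by rewrite [RHS]tp_scaleE scalar1E.
Qed.

Lemma word_act_prod (M : lmodType Lambda) (m : M) s :
  word_act m s = (\prod_(a <- rev s) gen (inr a)) *: m.
Proof.
elim: s m => [|a s IHs] m; first by rewrite big_nil scale1r.
by rewrite rev_cons -cats1 big_cat big_seq1 /= -scalerA -IHs.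
Qed.

(** The relations that define representations hold among the generators of the
    algebra, so they are among the equations of the module variety. *)
Lemma Mod_d_point_rel x : Mod_d K L d x -> point_rel x.
Proof.
move=> hx.
have two g g' h : gen g * gen g' = gen h -> x g *m x g' = x h.
  move=> e; have := @Mod_d_words x [:: (1, [:: g; g']); (-1, [:: h])] hx.
  rewrite !(big_cons, big_nil) /= !mulr1 !addr0 !scale1r !scaleN1r e subrr.
  by move=> /(_ erefl)/eqP; rewrite subr_eq0 => /eqP.
have zero (w : seq (generator Q)) : \prod_(g <- w) gen g = 0 -> \prod_(g <- w) x g = 0.
  move=> e; have := @Mod_d_words x [:: (1, w)] hx.
  by rewrite !big_seq1 /= e !scale1r; apply.
have two0 g g' : gen g * gen g' = 0 -> x g *m x g' = 0.
  by move=> e; have := zero [:: g; g']; rewrite !(big_cons, big_nil) !mulr1; apply.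
split.
- by move=> v w; case: eqP => h; [apply: two | apply: two0];
    rewrite gen_vertexM; case: eqP h => // ->.
- have := @Mod_d_words x ((-1, [::]) :: [seq (1, [:: inl v]) | v <- index_enum (vertex Q)]) hx.
  rewrite !big_cons !big_map !big_nil /=.
  have -> : \sum_v 1 *: \prod_(g <- [:: inl v]) gen g = 1.
    by rewrite -[RHS]sum_gen_vertex; apply: eq_bigr => v _; rewrite big_seq1 scale1r.
  have -> : \sum_v 1 *: \prod_(g <- [:: inl v]) x g = \sum_v x (inl v).
    by apply: eq_bigr => v _; rewrite big_seq1 scale1r.
  rewrite !scaleN1r addNr => /(_ erefl)/eqP.
  by rewrite addrC subr_eq0 => /eqP.
- by move=> a v; case: eqP => h; [apply: two | apply: two0];
    rewrite gen_arrow_vertex; case: eqP h => // ->.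
- by move=> a v; case: eqP => h; [apply: two | apply: two0];
    rewrite gen_vertex_arrow; case: eqP h => // ->.
move=> s m hs.
have -> : foldl (fun m a => x (inr a) *m m) m s = (\prod_(g <- map inr (rev s)) x g) *m m.
  elim: s m {hs} => [|a s IHs] m; first by rewrite big_nil mul1mx.
  by rewrite /= IHs !big_map rev_cons -cats1 big_cat big_seq1 /= mulmxA.
rewrite zero ?mul0mx // big_map -[LHS]mulr1 -[LHS]/(_ *: (1 : Lambda^o)) -word_act_prod.
by rewrite word_act_long // hs.
Qed.

End Points.

(** * Forests and their modules *)

(** A forest encodes a module with a basis on which every arrow acts as a partial
    injection: [fpar y = Some (a, x)] means that the arrow [a] sends the basis
    vector [x] to [y]. The level [flam] is the distance to the root. *)
Record forest (Q : quiver) (L d : nat) := Forest {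
  fv : 'I_d -> vertex Q;
  flam : 'I_d -> nat;
  fpar : 'I_d -> option (arrow Q * 'I_d);
  fparS : forall y a x, fpar y = Some (a, x) ->
    [/\ fv y = tgt a, fv x = src a & flam y = (flam x).+1];
  fparN : forall y, fpar y = None -> flam y = 0%N;
  fpar_inj : forall y y' p, fpar y = Some p -> fpar y' = Some p -> y = y';
  flamL : forall y, (flam y <= L)%N
}.

(** No basis vector is killed by an arrow that starts at its vertex, unless the
    truncation forces it. *)
Definition full_forest Q L d (F : forest Q L d) : Prop :=
  forall x a, fv F x = src a -> (flam F x < L)%N -> exists y, fpar F y = Some (a, x).

Section SupportDim.
Variables (K : fieldType) (d : nat).

Lemma dim_support (P : pred 'I_d) (U : {vspace 'cV[K]_d}) :
  (forall m : 'cV[K]_d, reflect (forall x, ~~ P x -> m x 0 = 0) (m \in U)) ->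
  \dim U = #|P|.
Proof.
move=> hU; pose b (x : 'I_d) : 'cV[K]_d := delta_mx x 0.
have bE x y : b x y 0 = (y == x)%:R by rewrite mxE eqxx andbT.
have eU : U = (\sum_(x | P x) <[b x]>)%VS.
  apply/eqP; rewrite eqEsubv; apply/andP; split; last first.
    apply/subv_sumP=> x Px; rewrite -memvE; apply/hU => y nPy; rewrite bE.
    by case: eqP nPy => // ->; rewrite Px.
  apply/subvP=> m /hU hm; have -> : m = \sum_(x | P x) m x 0 *: b x.
    apply/colP=> y; rewrite summxE; case Py: (P y); last first.
      rewrite hm ?Py // big1 // => x Px; rewrite !mxE andbT.
      by case: eqP => [e|_]; [rewrite e Px in Py | rewrite mulr0].
    rewrite (bigD1 y) //= !mxE !eqxx mulr1 big1 ?addr0 // => x /andP[_ /negPf xy].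
    by rewrite !mxE andbT eq_sym xy mulr0.
  by apply: memv_sumr => x Px; apply: rpredZ; apply: memv_line.
rewrite eU; have /directvP -> /= : directv (\sum_(x | P x) <[b x]>)%VS.
  apply/directv_sum_independent => f fb f0 x Px.
  have [k ek] := vlineP _ _ (fb x Px); rewrite ek.
  have := congr1 (fun m : 'cV_d => m x 0) f0; rewrite /= summxE (bigD1 x) //=.
  rewrite ek mxE bE eqxx mulr1 mxE big1 ?addr0 => [->|y /andP[Py yx]].
    by rewrite scale0r.
  have [k' ->] := vlineP _ _ (fb y Py).
  by rewrite mxE bE eq_sym (negPf yx) mulr0.
rewrite (eq_bigr (fun=> 1%N)) => [|x _]; first by rewrite sum1_card.
rewrite dim_vline; suff -> : b x != 0 by [].
by apply/eqP => /(congr1 (fun m : 'cV_d => m x 0)); rewrite bE eqxx mxE => /eqP; rewrite oner_eq0.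
Qed.
End SupportDim.

Section ForestModule.
Variables (K : fieldType) (Q : quiver) (L d : nat) (F : forest Q L d).
Variable w : 'I_d -> K.

(** The weight [w y] is the coefficient with which the arrow that leads to [y]
    acts; letting one weight tend to zero cuts the forest at [y]. *)
Definition fpt : point K Q d := fun g => match g with
  | inl v => \matrix_(y, x) ((y == x) && (fv F x == v))%:R
  | inr a => \matrix_(y, x) if fpar F y == Some (a, x) then w y else 0
  end.

Lemma fptE v m (u : 'M[K]_(d, m)) y i :
  (fpt (inl v) *m u) y i = if fv F y == v then u y i else 0.
Proof.
rewrite mxE (bigD1 y) //= mxE eqxx /= big1 ?addr0 => [|x /negPf xy].
  by case: eqP; rewrite ?mul1r ?mul0r.
by rewrite mxE eq_sym xy mul0r.
Qed.

Lemma fptX a m (u : 'M[K]_(d, m)) y i :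
  (fpt (inr a) *m u) y i =
  \sum_x if fpar F y == Some (a, x) then w y * u x i else 0.
Proof.
by rewrite mxE; apply: eq_bigr => x _; rewrite mxE; case: eqP; rewrite ?mul0r.
Qed.

Lemma fptXS a m (u : 'M[K]_(d, m)) y x i : fpar F y = Some (a, x) ->
  (fpt (inr a) *m u) y i = w y * u x i.
Proof.
move=> e; rewrite fptX (bigD1 x) //= e eqxx big1 ?addr0 // => z /negPf zx.
by rewrite (inj_eq (@Some_inj _)) xpair_eqE eqxx eq_sym zx.
Qed.

Lemma fpt_supp a m (u : 'M[K]_(d, m)) y i k :
  (forall x, (flam F x < k)%N -> u x i = 0) -> (flam F y < k.+1)%N ->
  (fpt (inr a) *m u) y i = 0.
Proof.
move=> h hy; rewrite fptX big1 // => x _; case: eqP => // /fparS[_ _ e].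
by rewrite h ?mulr0 // -ltnS -e.
Qed.

Lemma fpt_rel : point_rel L fpt.
Proof.
split.
- move=> v v'; apply/matrixP=> y x; rewrite fptE mxE.
  case: (v =P v') => [->|ne]; rewrite !mxE; case: (y =P x) => [->|_] //=; case: eqP => //.
  by move=> ->; case: eqP ne.
- apply/matrixP=> y x; rewrite summxE (bigD1 (fv F x)) //= !mxE eqxx andbT.
  by rewrite big1 ?addr0 // => v /negPf h; rewrite mxE [fv F x == v]eq_sym h andbF.
- move=> a v; apply/matrixP=> y x; rewrite fptX.
  under eq_bigr => z _ do rewrite mxE.
  case: (src a =P v) => h; rewrite mxE.
    rewrite (bigD1 x) //= eqxx /= big1 ?addr0 => [|z /negPf zx].
      case: eqP => // /fparS[_ -> _]; by rewrite h eqxx mulr1.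
    by rewrite zx mulr0; case: eqP.
  rewrite big1 // => z _; case: eqP => // /fparS[_ e _].
  case: (z =P x) => [<-|_]; last by rewrite mulr0.
  by rewrite e; case: eqP h => // _ _; rewrite mulr0.
- move=> a v; apply/matrixP=> y x; rewrite fptE.
  case: (tgt a =P v) => h; rewrite !mxE.
    by case: (fpar F y =P Some (a, x)) => [/fparS[-> _ _]|_]; [rewrite h eqxx | case: eqP].
  by case: (fpar F y =P Some (a, x)) => [/fparS[-> _ _]|_]; [case: eqP h | case: eqP].
move=> s m hs; apply/colP => y; rewrite [RHS]mxE.
suff h k (u : 'cV[K]_d) : (forall x, (flam F x < k)%N -> u x 0 = 0) ->
    (flam F y < k + size s)%N -> foldl (fun m a => fpt (inr a) *m m) u s y 0 = 0.
  by apply: (h 0%N) => //; rewrite hs add0n ltnS flamL.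
elim: s k u {hs} => [|a s IHs] k u hu; first by rewrite addn0; apply: hu.
rewrite /= addnS -addSn; apply: IHs => x hx; exact: fpt_supp hu hx.
Qed.

Definition frep : qrep K Q L := prep fpt_rel.

Lemma frepE v (m : frep) y : rE frep v m y 0 = if fv F y == v then m y 0 else 0.
Proof. by rewrite prepE fptE. Qed.

Lemma frepX a (m : frep) y : rX frep a m y 0 =
  \sum_x if fpar F y == Some (a, x) then w y * m x 0 else 0.
Proof. by rewrite prepX fptX. Qed.

Lemma frepXS a (m : frep) y x : fpar F y = Some (a, x) ->
  rX frep a m y 0 = w y * m x 0.
Proof. by move=> e; rewrite prepX (fptXS _ _ e). Qed.

Definition fb (x : 'I_d) : frep := delta_mx x 0.

Lemma fbE x y : fb x y 0 = (y == x)%:R.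
Proof. by rewrite mxE eqxx andbT. Qed.

Lemma frepZ c (m : frep) y : (c *: m) y 0 = c * m y 0.
Proof. exact: mxE. Qed.

Lemma fb_span (m : frep) : m = \sum_x m x 0 *: fb x.
Proof.
apply/colP=> y; rewrite summxE (bigD1 y) //= frepZ fbE eqxx mulr1 big1 ?addr0 //.
by move=> x /negPf h; rewrite frepZ fbE eq_sym h mulr0.
Qed.

Lemma frepX_fb a x y : fpar F y = Some (a, x) -> rX frep a (fb x) = w y *: fb y.
Proof.
move=> e; apply/colP=> z; rewrite prepX frepZ fbE fptX.
case: (z =P y) => [->|zy].
  rewrite (bigD1 x) //= e eqxx fbE eqxx big1 ?addr0 // => t /negPf tx.
  by rewrite fbE tx mulr0; case: eqP.
rewrite mulr0 big1 // => t _; case: eqP => // e'.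
case: (t =P x) => [tx|/eqP/negPf tx]; last by rewrite fbE tx mulr0.
by case: zy; apply: fpar_inj e' _; rewrite tx.
Qed.

Lemma frepE_fb v x : rE frep v (fb x) = if fv F x == v then fb x else 0.
Proof.
apply/colP=> y; rewrite frepE fbE; case: (y =P x) => [->|yx].
  by case: eqP; rewrite ?fbE ?eqxx ?mxE.
by rewrite if_same; case: eqP; rewrite ?fbE ?mxE //; case: eqP yx.
Qed.

Hypothesis w0 : forall y, w y != 0.

(** Every basis vector of positive level is, up to its nonzero weight, the image
    of its parent. *)
Lemma mem_frep_Jpow l (m : frep) :
  reflect (forall x, (flam F x < l)%N -> m x 0 = 0) (m \in Jpow frep l).
Proof.
apply: (iffP idP).
  elim: l m => [|l IHl] m // /memv_sumP[f fJ ->] x hx.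
  rewrite summxE big1 // => a _; have /memv_imgP[u uJ ->] := fJ a isT.
  by rewrite prepX; apply: fpt_supp hx; apply: IHl.
elim: l m => [|l IHl] m h; first exact: memvf.
rewrite [m]fb_span; apply: rpred_sum => y _.
case: (ltnP (flam F y) l.+1) => hy; first by rewrite h // scale0r mem0v.
apply: rpredZ; case e: (fpar F y) => [[a x]|]; last by rewrite (fparN e) in hy.
have [_ _ e'] := fparS e; have -> : fb y = rX frep a ((w y)^-1 *: fb x).
  by rewrite linearZ /= (frepX_fb e) scalerA mulVf // scale1r.
apply: rX_Jmul; apply: rpredZ; apply: IHl => z; rewrite fbE; case: eqP => // ->.
by move=> hx; rewrite e' ltnS leqNgt hx in hy.
Qed.

Lemma dim_frep j l :
  \dim (vpart j (Jpow frep l)) = #|[pred x | (fv F x == j) && (l <= flam F x)%N]|.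
Proof.
pose P x := (fv F x == j) && (l <= flam F x)%N.
suff H (m : frep) : reflect (forall x, ~~ P x -> m x 0 = 0) (m \in vpart j (Jpow frep l)).
  exact: (dim_support H).
rewrite memv_vpart /P; last by case: (submodule_Jpow frep l).
apply: (iffP andP) => [[/mem_frep_Jpow h /eqP e] x /=|h].
  rewrite negb_and -ltnNge => /orP[/negPf hx|]; last exact: h.
  by rewrite -e frepE hx.
split; first by apply/mem_frep_Jpow => x hx; apply: h; rewrite /= negb_and -ltnNge hx orbT.
apply/eqP/colP => y; rewrite frepE; case: eqP => // /eqP hy.
by rewrite h //= negb_and hy.
Qed.

Lemma dim_frep_step j l :
  \dim (vpart j (Jpow frep l)) =
  (#|[pred x | (fv F x == j) && (flam F x == l)]| + \dim (vpart j (Jpow frep l.+1)))%N.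
Proof.
rewrite !dim_frep -(cardID [pred x | flam F x == l]); congr (_ + _)%N; apply: eq_card => x.
  by rewrite !inE /= -andbA; congr (_ && _); case: eqP => [->|]; rewrite ?leqnn ?andbT ?andbF.
by rewrite !inE /= ltn_neqAle eq_sym; case: (fv F x == j); rewrite ?andbF.
Qed.

End ForestModule.

Section FullForest.
Variables (K : fieldType) (Q : quiver) (L d : nat) (F : forest Q L d).
Hypothesis fullF : full_forest F.
Local Notation Lambda := (tpalg K Q L).
Local Notation gen := (@gen K Q L).
Local Notation scalar1 := (@scalar1 K Q L).
Local Notation Fr := (frep F (fun=> 1 : K)).
Local Notation fb := (@fb K Q L d F (fun=> 1 : K)).

(** ** Full forests are projective *)

Section Universal.
Variables (A : lmodType Lambda) (z : 'I_d -> A).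
Hypothesis zE : forall x, fpar F x = None -> gen (inl (fv F x)) *: z x = z x.

Fixpoint fext_rec n y : A :=
  if n is n'.+1 then
    (if fpar F y is Some (a, x) then gen (inr a) *: fext_rec n' x else z y)
  else z y.
Definition fext y := fext_rec (flam F y) y.

Lemma fextS y a x : fpar F y = Some (a, x) -> fext y = gen (inr a) *: fext x.
Proof. by move=> e; rewrite /fext; have [_ _ ->] := fparS e; rewrite /= e. Qed.

Lemma fextN y : fpar F y = None -> fext y = z y.
Proof. by move=> e; rewrite /fext (fparN e). Qed.

Lemma fext_vertex v y : gen (inl v) *: fext y = if fv F y == v then fext y else 0.
Proof.
case e: (fpar F y) => [[a x]|].
  have [ey _ _] := fparS e; rewrite (fextS e) scalerA gen_vertex_arrow ey.
  by case: eqP; rewrite ?scale0r.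
rewrite (fextN e) -(zE e) scalerA gen_vertexM eq_sym.
by case: eqP => [->|]; rewrite ?scale0r.
Qed.

Lemma fext_word y : exists m s, size s = flam F y /\ fext y = word_act m s.
Proof.
have [n] : exists n, flam F y = n by exists (flam F y).
elim: n y => [|n IHn] y hn; first by exists (fext y), [::]; rewrite hn.
case e: (fpar F y) => [[a x]|]; last by rewrite (fparN e) in hn.
have [_ _ e'] := fparS e; have [|m [s [hs es]]] := IHn x.
  by apply/succn_inj; rewrite -hn e'.
exists m, (rcons s a); split; first by rewrite size_rcons hs e'.
by rewrite (fextS e) /word_act foldl_rcons es.
Qed.

Lemma fext_arrow a x :
  gen (inr a) *: fext x = \sum_(y | fpar F y == Some (a, x)) fext y.
Proof.
case: (pickP (fun y => fpar F y == Some (a, x))) => [y /eqP e|no].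
  rewrite (bigD1 y) ?e //= (fextS e) big1 ?addr0 // => y' /andP[/eqP e' /eqP[]].
  exact: fpar_inj e' e.
rewrite big_pred0 //; case: (fv F x =P src a) => h; last first.
  have -> : fext x = gen (inl (fv F x)) *: fext x by rewrite fext_vertex eqxx.
  by rewrite scalerA gen_arrow_vertex eq_sym; case: eqP h; rewrite ?scale0r.
case: (ltnP (flam F x) L) => hx.
  by have [y e] := fullF h hx; have := no y; rewrite e eqxx.
have [m [s [hs ->]]] := fext_word x.
have -> : gen (inr a) *: word_act m s = word_act m (rcons s a) by rewrite /word_act foldl_rcons.
by rewrite word_act_long // size_rcons ltnS hs.
Qed.

(** The images of the roots can be prescribed freely: the image of [y] is
    obtained by applying to the image of its root the arrows that lead to [y].
    Arrows that leave the last level cause no condition, since words of [L.+1]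
    arrows vanish in every module. *)
Lemma full_universal :
  exists h : {linear repmod Fr -> A}, forall x, fpar F x = None -> h (fb x) = z x.
Proof.
pose h0 (u : repmod Fr) : A := \sum_x scalar1 ((u : 'cV[K]_d) x 0) *: fext x.
have scalar1D (c c' : K) : scalar1 (c + c') = scalar1 c + scalar1 c' by rewrite !scalar1E scalerDl.
have scalar10 : scalar1 0 = 0 by rewrite scalar1E scale0r.
have [||h hE] := @mk_linear _ (repmod Fr) A h0.
- move=> u v; rewrite /h0 -big_split /=; apply: eq_bigr => x _.
  by rewrite mxE scalar1D scalerDl.
- apply: gen_linear => [u v|c m|[v|a] m].
  + rewrite /h0 -big_split /=; apply: eq_bigr => x _.
    by rewrite mxE scalar1D scalerDl.
  + rewrite repmod_scalar1 /h0 scaler_sumr; apply: eq_bigr => x _.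
    by rewrite mxE scalerA !scalar1E -tp_scalerAl mul1r scalerA.
  + rewrite repmod_gen_vertex /h0 scaler_sumr; apply: eq_bigr => x _.
    rewrite frepE scalerA scalar1_comm -scalerA fext_vertex; case: eqP => // _.
    by rewrite scalar10 scale0r scaler0.
  rewrite repmod_gen_arrow /h0 scaler_sumr.
  transitivity (\sum_x \sum_(y | fpar F y == Some (a, x)) scalar1 ((m : 'cV[K]_d) x 0) *: fext y).
    rewrite (exchange_big_dep predT) //=; apply: eq_bigr => y _.
    rewrite frepX (big_morph scalar1 scalar1D scalar10) scaler_suml [RHS]big_mkcond.
    by apply: eq_bigr => x _; case: eqP; rewrite ?mul1r // scalar10 scale0r.
  apply: eq_bigr => x _; rewrite scalerA scalar1_comm -scalerA fext_arrow.
  by rewrite scaler_sumr.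
exists h => x ex; rewrite hE /h0 (bigD1 x) //= fbE eqxx big1 ?addr0.
  by rewrite (fextN ex) scalar1E scale1r scale1r.
by move=> y /negPf yx; rewrite fbE yx scalar10 scale0r.
Qed.

End Universal.

Lemma full_ext (A : lmodType Lambda) (h h' : {linear repmod Fr -> A}) :
  (forall x, fpar F x = None -> h (fb x) = h' (fb x)) -> h =1 h'.
Proof.
move=> e u; have eb y : h (fb y) = h' (fb y).
  have [n] : exists n, flam F y = n by exists (flam F y).
  elim: n y => [|n IHn] y hn; case ey: (fpar F y) => [[a x]|]; try exact: e.
    by have [_ _] := fparS ey; rewrite hn.
  have [_ _ e'] := fparS ey.
  have -> : (fb y : repmod Fr) = gen (inr a) *: (fb x : repmod Fr).
    by rewrite repmod_gen_arrow (frepX_fb _ ey) scale1r.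
  by rewrite !linearZ IHn //; apply/succn_inj; rewrite -hn e'.
have -> : u = \sum_x scalar1 ((u : 'cV[K]_d) x 0) *: (fb x : repmod Fr).
  rewrite [LHS](fb_span (u : Fr)); apply: eq_bigr => x _.
  by rewrite repmod_scalar1.
by rewrite !linear_sum; apply: eq_bigr => x _; rewrite !linearZ eb.
Qed.

Lemma full_projective : projective (repmod Fr : lmodType Lambda).
Proof.
move=> A B g f gS.
have [s sE] := choice (fun x => gS (f (fb x))).
have [|h hE] := @full_universal A (fun x => gen (inl (fv F x)) *: s x).
  by move=> x _; rewrite scalerA gen_vertexM eqxx.
exists h => u.
apply: (full_ext (h := g \o h : {linear _ -> _})) => x ex /=.
rewrite hE // linearZ /= sE -linearZ; congr (f _).
by rewrite repmod_gen_vertex frepE_fb eqxx.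
Qed.

(** ** Dimensions in a full forest *)

Local Notation mem_Jpow := (@mem_frep_Jpow K Q L d F (fun=> 1) (fun=> oner_neq0 K)).

(** In a full forest an arrow kills, among the vectors at its source, exactly
    those of the last layer. *)
Lemma full_ker a (N : {vspace Fr}) : vstable N ->
  (vpart (src a) N :&: lker (rX Fr a))%VS = vpart (src a) (N :&: Jpow Fr L)%VS.
Proof.
move=> sN; apply/vspaceP=> m; rewrite memv_cap memv_ker !memv_vpart //; last first.
  by apply: vstable_cap => //; case: (submodule_Jpow Fr L).
rewrite memv_cap; case mN: (m \in N) => //=; case: eqP => //= e; last by rewrite andbF.
rewrite andbT; apply/eqP/mem_Jpow => [h x hx|h].
  case: (fv F x =P src a) => [ex|/eqP/negPf ex]; last by rewrite -e frepE ex.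
  have [y ey] := fullF ex hx; have := congr1 (fun u : 'cV[K]_d => u y 0) h.
  by rewrite (frepXS _ ey) mul1r mxE.
have mL : m \in Jpow Fr L by apply/mem_Jpow.
by have := rX_Jmul a mL; rewrite -[Jmul _]/(Jpow Fr L.+1) Jpow_nil memv0 => /eqP.
Qed.

(** The images of different arrows are supported on disjoint sets of basis
    vectors, so that their dimensions add up. *)
Lemma full_dim_Jmul j (N : {vspace Fr}) : vstable N ->
  (\dim (vpart j (Jmul N)) + \sum_(a | tgt a == j) \dim (vpart (src a) (N :&: Jpow Fr L)) =
   \sum_(a | tgt a == j) \dim (vpart (src a) N))%N.
Proof.
move=> sN; rewrite vpart_Jmul.
have /directvP -> /= : directv (\sum_(a | tgt a == j) rX Fr a @: N)%VS.
  apply/directv_sum_independent => f fN f0 a aj; apply/colP=> y; rewrite mxE.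
  have supp b : tgt b == j -> (if fpar F y is Some (c, _) then c != b else true) -> f b y 0 = 0.
    move=> bj hb; have /memv_imgP[u _ ->] := fN b bj.
    rewrite frepX big1 // => x _; case: eqP => // e.
    by move: hb; rewrite e eqxx.
  case e: (fpar F y) => [[c x]|]; last by apply: supp => //; rewrite e.
  case: (c =P a) => [ca|/eqP ca]; last by apply: supp => //; rewrite e.
  have := congr1 (fun u : 'cV[K]_d => u y 0) f0; rewrite /= summxE (bigD1 a) //= mxE.
  rewrite [X in _ + X]big1 ?addr0 // => b /andP[bj ba]; apply: supp => //.
  by rewrite e ca eq_sym.
rewrite -big_split /=; apply: eq_bigr => a _.
by rewrite rXU_src -full_ker // addnC limg_ker_dim.
Qed.

(** The arrows shift the levels by one without cancellation. *)
Lemma full_cap_Jmul m (N : {vspace Fr}) : vstable N -> (m <= L)%N ->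
  (Jmul N :&: Jpow Fr m.+1)%VS = Jmul (N :&: Jpow Fr m)%VS.
Proof.
move=> sN mL; apply/eqP; rewrite eqEsubv; apply/andP; split; last first.
  by rewrite subv_cap; apply/andP; split; apply: JmulS; [apply: capvSl | apply: capvSr].
apply/subvP=> u /memv_capP[/memv_sumP[f fN ->] /mem_Jpow h].
apply: rpred_sum => a _; have /memv_imgP[n nN en] := fN a isT.
rewrite en rX_src; apply: rX_Jmul; rewrite memv_cap vstableP //=.
apply/mem_Jpow => x hx; rewrite frepE; case: eqP => // ex.
have [y ey] := fullF ex (leq_trans hx mL); have [_ _ e'] := fparS ey.
have := h y; rewrite e' ltnS => /(_ hx); rewrite summxE (bigD1 a) //= en.
rewrite (frepXS _ ey) mul1r [X in _ + X]big1 ?addr0 // => b ba.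
have /memv_imgP[n' _ ->] := fN b isT; rewrite frepX big1 // => t _.
by case: eqP => //; rewrite ey => -[e _]; rewrite e eqxx in ba.
Qed.

End FullForest.

(** ** Forests with prescribed layers *)

Section ForestExists.
Variables (Q : quiver) (L : nat).

(** The value beyond the last layer is 0. *)
Definition lay (S : ssseq Q L) (l : nat) (j : vertex Q) : nat :=
  oapp (fun l' : 'I_L.+1 => S l' j) 0%N (insub l).

Definition lay_count d (F : forest Q L d) (l : nat) (j : vertex Q) : nat :=
  #|[pred x | (fv F x == j) && (flam F x == l)]|.

Lemma layE (S : ssseq Q L) (l : 'I_L.+1) j : lay S l j = S l j.
Proof. by rewrite /lay valK. Qed.

Lemma lay_big (S : ssseq Q L) l j : (L < l)%N -> lay S l j = 0%N.
Proof. by move=> h; rewrite /lay; case: insubP => //= i; rewrite ltnS leqNgt h. Qed.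

Lemma sum_lay (S : ssseq Q L) : tdim S = (\sum_(l < L.+1) \sum_j lay S l j)%N.
Proof. by apply: eq_bigr => l _; apply: eq_bigr => j _; rewrite layE. Qed.

Lemma count_tnth (T : eqType) (s : seq T) (p : pred T) :
  #|[pred x : 'I_(size s) | p (tnth (in_tuple s) x)]| = count p s.
Proof. by rewrite -sum1_count big_tnth sum1_card. Qed.

Lemma lay_enum (S : ssseq Q L) : exists s : seq (vertex Q * nat),
  size s = tdim S /\ forall l j, count_mem (j, l) s = lay S l j.
Proof.
pose s := flatten [seq nseq (S p.1 p.2) (p.2, val p.1) |
   p <- enum {: 'I_L.+1 * vertex Q}].
exists s; split=> [|l j].
  rewrite size_flatten /shape -map_comp sumnE big_map big_enum /= /tdim pair_big.
  by apply: eq_bigr => p _; rewrite size_nseq.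
rewrite /s count_flatten -map_comp sumnE big_map big_enum /=.
under eq_bigr => p _ do rewrite count_nseq /=.
case: (ltnP L l) => hl.
  rewrite lay_big // big1 // => p _; rewrite xpair_eqE.
  have -> : (val p.1 == l) = false by apply/negbTE; rewrite neq_ltn (leq_trans _ hl) ?ltn_ord.
  by rewrite andbF mul0n.
pose l' : 'I_L.+1 := Ordinal (hl : (l < L.+1)%N).
rewrite -[l]/(val l') layE (bigD1 (l', j)) //= eqxx mul1n big1 ?addn0 // => -[l1 j1] h.
by rewrite xpair_eqE andbC -[val l1 == l]/(l1 == l') -[_ && _]/((l1, j1) == (l', j)) (negPf h).
Qed.

(** The vectors of level [l.+1] at [j] are mapped injectively to the pairs of an
    arrow ending in [j] and a vector of level [l] at its source; the hypothesis
    says that there are enough such pairs. *)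
Lemma forest_exists (S : ssseq Q L) :
  (forall l j, (l < L)%N -> lay S l.+1 j <= \sum_(a | tgt a == j) lay S l (src a))%N ->
  exists F : forest Q L (tdim S), (forall l j, lay_count F l j = lay S l j) /\
  ((forall l j, (l < L)%N -> lay S l.+1 j = \sum_(a | tgt a == j) lay S l (src a))%N ->
   full_forest F).
Proof.
move=> hS; have [s [<- cnt]] := lay_enum S.
pose v (x : 'I_(size s)) := (tnth (in_tuple s) x).1.
pose lam (x : 'I_(size s)) := (tnth (in_tuple s) x).2.
have cE l j : #|[pred x | (v x == j) && (lam x == l)]| = lay S l j.
  rewrite -cnt -count_tnth; apply: eq_card => x.
  by rewrite !inE /v /lam -xpair_eqE -surjective_pairing.
have lamL x : (lam x <= L)%N.
  rewrite leqNgt; apply/negP => h; have := cE (lam x) (v x).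
  by rewrite (lay_big _ _ h) => /card0_eq/(_ x); rewrite !inE !eqxx.
pose Y j l := [seq y <- enum 'I_(size s) | (v y == j) && (lam y == l.+1)].
pose Z j l := [seq p <- enum {: arrow Q * 'I_(size s)} |
   [&& tgt p.1 == j, src p.1 == v p.2 & lam p.2 == l]].
have sY j l : size (Y j l) = lay S l.+1 j.
  by rewrite /Y size_filter -cE -sum1_count big_enum_cond sum1_card; apply: eq_card => y; rewrite !inE.
have sZ j l : size (Z j l) = (\sum_(a | tgt a == j) lay S l (src a))%N.
  rewrite /Z size_filter -sum1_count big_enum_cond /=.
  under [RHS]eq_bigr => a _ do rewrite -cE -sum1_card.
  rewrite pair_big_dep /=; apply: eq_bigl => p; rewrite !inE /=.
  by rewrite [v p.2 == _]eq_sym.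
have YZ j l : (l < L)%N -> (size (Y j l) <= size (Z j l))%N.
  by move=> h; rewrite sY sZ; apply: hS.
pose par y := if lam y is l.+1 then
  nth None [seq Some p | p <- Z (v y) l] (index y (Y (v y) l)) else None.
have parE y l : lam y = l.+1 -> exists2 p, par y = Some p &
    p \in Z (v y) l /\ index p (Z (v y) l) = index y (Y (v y) l).
  move=> e; rewrite /par e.
  have yY : y \in Y (v y) l by rewrite mem_filter eqxx e eqxx mem_enum.
  have lL : (l < L)%N by rewrite -e; apply: lamL.
  have hi : (index y (Y (v y) l) < size (Z (v y) l))%N.
    by apply: leq_trans (YZ _ _ lL); rewrite index_mem.
  case eZ: (Z (v y) l) hi => [//|p0 s0]; rewrite -eZ => hi.
  exists (nth p0 (Z (v y) l) (index y (Y (v y) l))).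
    by rewrite (nth_map p0).
  split; first exact: mem_nth.
  by rewrite index_uniq // filter_uniq // enum_uniq.
have par1 y a x : par y = Some (a, x) -> [/\ v y = tgt a, v x = src a & lam y = (lam x).+1].
  case e: (lam y) => [|l]; first by rewrite /par e.
  have [p -> [pZ _]] := parE y l e => -[ep]; move: pZ; rewrite ep mem_filter /=.
  by case/andP=> /and3P[/eqP <- /eqP <- /eqP ->].
have par2 y : par y = None -> lam y = 0%N.
  by case e: (lam y) => [//|l]; have [p -> _] := parE y l e.
have par3 y y' p : par y = Some p -> par y' = Some p -> y = y'.
  case: p => a x e e'; have [vy _ ly] := par1 _ _ _ e; have [vy' _ ly'] := par1 _ _ _ e'.
  have [p ep [_ ip]] := parE _ _ ly; have [p' ep' [_ ip']] := parE _ _ ly'.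
  have yY : y \in Y (tgt a) (lam x) by rewrite mem_filter vy ly !eqxx mem_enum.
  have yY' : y' \in Y (tgt a) (lam x) by rewrite mem_filter vy' ly' !eqxx mem_enum.
  move: ep ep' ip ip'; rewrite e e' => -[<-] [<-]; rewrite vy vy' => -> ii.
  by rewrite -(nth_index y yY) ii nth_index.
exists (Forest par1 par2 par3 lamL); split; first exact: cE.
move=> hfull x a /= ex lx; set l := lam x.
have pZ : (a, x) \in Z (tgt a) l by rewrite mem_filter mem_enum /= ex !eqxx.
have hi : (index (a, x) (Z (tgt a) l) < size (Y (tgt a) l))%N.
  by rewrite sY hfull // -sZ index_mem.
have y0 : 'I_(size s) := x.
pose y := nth y0 (Y (tgt a) l) (index (a, x) (Z (tgt a) l)).
have yY : y \in Y (tgt a) l by apply: mem_nth.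
have := yY; rewrite mem_filter => /andP[/andP[/eqP vy /eqP ly] _].
exists y; have [p -> [pZ' ip]] := parE _ _ ly; congr Some.
rewrite vy in pZ' ip; have : index y (Y (tgt a) l) = index (a, x) (Z (tgt a) l).
  by rewrite index_uniq // filter_uniq // enum_uniq.
rewrite -ip => ii;
by rewrite -(nth_index p pZ') ii nth_index.
Qed.

End ForestExists.

(** ** Counting arrows *)

Section Transfer.
Variable Q : quiver.
Implicit Types f g : {ffun vertex Q -> int}.

(** Transport of dimension vectors along the arrows. *)
Definition trans f : {ffun vertex Q -> int} := [ffun j => \sum_(a | tgt a == j) f (src a)].

Lemma transB f g : trans (f - g) = trans f - trans g.
Proof.
apply/ffunP=> j; rewrite !ffunE -sumrB; apply: eq_bigr => a _.
by rewrite !ffunE.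
Qed.

Lemma iter_transB r f g : iter r trans (f - g) = iter r trans f - iter r trans g.
Proof. by elim: r => //= r ->; rewrite transB. Qed.

Fixpoint reach r (i j : vertex Q) : Prop :=
  if r is r'.+1 then exists2 a : arrow Q, tgt a = j & reach r' i (src a) else i = j.

Lemma iter_trans_ge0 r f j : (forall i, 0 <= f i) -> 0 <= iter r trans f j.
Proof.
move=> f0; elim: r j => //= r IHr j; rewrite ffunE.
by apply: Num.Theory.sumr_ge0 => a _.
Qed.

Lemma iter_trans_gt0 r f j : (forall i, 0 <= f i) ->
  0 < iter r trans f j <-> exists i, 0 < f i /\ reach r i j.
Proof.
move=> f0; elim: r j => [|r IHr] j /=.
  by split=> [h|[i [h <-]]] //; exists j.
rewrite ffunE; split=> [h|[i [fi [a ea ra]]]].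
  have [a /andP[/eqP ea ha]] : exists a, (tgt a == j) && (0 < iter r trans f (src a)).
    apply/existsP; apply: contraTT h; rewrite negb_exists => /forallP h.
    rewrite -Order.TotalTheory.leNgt Num.Theory.sumr_le0 // => a aj.
    by have := h a; rewrite aj -Order.TotalTheory.leNgt.
  by have [i [fi ri]] := (IHr _).1 ha; exists i; split=> //; exists a.
rewrite (bigD1 a) ?ea //=; apply: Num.Theory.ltr_pwDl.
  by apply/IHr; exists i.
by apply: Num.Theory.sumr_ge0 => b _; apply: iter_trans_ge0.
Qed.

End Transfer.

(** * Syzygies *)

Lemma sumPoz (I : finType) (P : pred I) (f : I -> nat) :
  (\sum_(i | P i) f i)%N%:Z = \sum_(i | P i) (f i)%:Z.
Proof. exact: (big_morph Posz PoszD). Qed.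

Section Crit.
Variables (K : fieldType) (Q : quiver) (L : nat) (r : qrep K Q L).

Definition dimvec (U : {vspace r}) : {ffun vertex Q -> int} :=
  [ffun j => (\dim (vpart j U))%:Z].
(** Multiplicities of the simples in layer [l], as a vector of integers. *)
Definition rlayer l : {ffun vertex Q -> int} := dimvec (Jpow r l) - dimvec (Jpow r l.+1).
(** The defect in layer [l.+1], which is positive at the critical pairs. The
    index is that of the layer from which the arrows start. *)
Definition rcrit l : {ffun vertex Q -> int} := trans (rlayer l) - rlayer l.+1.

Lemma dim_Jmul_le j (U U' : {vspace r}) : (U' <= U)%VS ->
  (\dim (vpart j (Jmul U)) + \sum_(a | tgt a == j) \dim (vpart (src a) U') <=
   \dim (vpart j (Jmul U')) + \sum_(a | tgt a == j) \dim (vpart (src a) U))%N.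
Proof.
move=> UU; pose C a := (vpart (src a) U :\: vpart (src a) U')%VS.
have eC (a : arrow Q) : (C a + vpart (src a) U')%VS = vpart (src a) U.
  by rewrite addv_diff; apply/addv_idPl/vpartS.
have dC (a : arrow Q) : (\dim (C a) + \dim (vpart (src a) U') = \dim (vpart (src a) U))%N.
  by rewrite -eC dimv_disjoint_sum // capv_diff.
rewrite -(eq_bigr _ (fun a _ => dC a)) big_split /= addnA leq_add2r.
have -> : vpart j (Jmul U) = (vpart j (Jmul U') + \sum_(a | tgt a == j) rX r a @: C a)%VS.
  rewrite !vpart_Jmul -big_split /=; apply: eq_bigr => a _.
  by rewrite rXU_src -eC limgD addvC -rXU_src.
have h1 : (\dim (vpart j (Jmul U') + \sum_(a | tgt a == j) rX r a @: C a) <=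
  \dim (vpart j (Jmul U')) + \dim (\sum_(a | tgt a == j) rX r a @: C a))%N.
  by rewrite -dimv_sum_cap leq_addr.
apply: leq_trans h1 _; rewrite leq_add2l; apply: leq_trans (dimv_leq_sum _ _ _) _.
by apply: leq_sum => a _; rewrite -(limg_ker_dim (rX r a) (C a)) leq_addl.
Qed.

Lemma rcrit_ge0 l j : 0 <= rcrit l j.
Proof.
have /= h := @dim_Jmul_le j _ _ (Jpow_sub r l).
rewrite /rcrit /rlayer !ffunE; under eq_bigr => a _ do rewrite !ffunE.
rewrite sumrB -!sumPoz; move: h; rewrite -!lez_nat !PoszD /=; lia.
Qed.

End Crit.

Section FullDim.
Variables (K : fieldType) (Q : quiver) (L d : nat) (F : forest Q L d).
Hypothesis fullF : full_forest F.
Local Notation Fr := (frep F (fun=> 1 : K)).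

Lemma full_dimv_Jmul (N : {vspace Fr}) : vstable N ->
  dimvec (Jmul N) = trans (dimvec N - dimvec (N :&: Jpow Fr L)%VS).
Proof.
move=> sN; apply/ffunP=> j; rewrite !ffunE.
under eq_bigr => a _ do rewrite !ffunE.
have /(congr1 Posz) := full_dim_Jmul fullF j sN; rewrite PoszD => h.
rewrite sumrB -!sumPoz; lia.
Qed.

(** The paths of length [n] act with independent images, and among the vectors at
    its start such a path kills those of [Jpow (L.+1 - n)]. *)
Lemma full_dimv_iter n (N : {vspace Fr}) : vstable N -> (n <= L.+1)%N ->
  dimvec (iter n (@Jmul _ _ _ Fr) N) =
  iter n (@trans Q) (dimvec N - dimvec (N :&: Jpow Fr (L.+1 - n))%VS).
Proof.
have sF m : vstable (Jpow Fr m) by case: (submodule_Jpow Fr m).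
elim: n N => [|n IHn] N sN hn.
  rewrite subn0 Jpow_nil capv0 /=; apply/ffunP=> j; rewrite !ffunE.
  by rewrite /vpart limg0 dimv0 subr0.
rewrite iterSr IHn; [|exact: vstable_Jmul|exact: ltnW].
rewrite iterSr; congr iter.
have -> : (L.+1 - n = (L - n).+1)%N by lia.
rewrite full_cap_Jmul ?leq_subr // !full_dimv_Jmul //; last exact: vstable_cap.
have -> : (N :&: Jpow Fr (L - n) :&: Jpow Fr L = N :&: Jpow Fr L)%VS.
  by rewrite -capvA; congr (_ :&: _)%VS; apply/capv_idPr/Jpow_mono/leq_subr.
by rewrite -transB opprB addrA subrK subSS.
Qed.

Lemma full_rlayer l : (l < L)%N -> rlayer Fr l.+1 = trans (rlayer Fr l).
Proof.
move=> lL; have h m : (m <= L)%N -> dimvec (Jpow Fr m.+1) = trans (dimvec (Jpow Fr m) - dimvec (Jpow Fr L)).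
  move=> mL; rewrite -[Jpow Fr m.+1]/(Jmul (Jpow Fr m)) full_dimv_Jmul; last by case: (submodule_Jpow Fr m).
  by congr (trans (_ - dimvec _)); apply/capv_idPr/Jpow_mono.
rewrite /rlayer [in LHS](h l (ltnW lL)) [in LHS](h l.+1 lL) -transB; congr trans.
by rewrite opprB addrA subrK.
Qed.

End FullDim.

Section Cover.
Variables (K : fieldType) (Q : quiver) (L : nat) (r : qrep K Q L).
Local Notation Lambda := (tpalg K Q L).

(** Lifts of a basis of the top of [r] are the images of the roots of the full
    forest with the same top; they generate [r] by Nakayama's lemma. *)
Lemma projective_cover : exists d (F : forest Q L d) (p : 'Hom(frep F (fun=> 1 : K), r)),
  [/\ full_forest F, rep_hom p, limg p = fullv &
      rlayer (frep F (fun=> 1 : K)) 0 = rlayer r 0].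
Proof.
pose C j := (vpart j fullv :\: vpart j (Jpow r 1))%VS.
have eC j : (C j + vpart j (Jpow r 1))%VS = vpart j fullv.
  by rewrite addv_diff; apply/addv_idPl/vpartS/subvf.
have dC j : (\dim (C j) + \dim (vpart j (Jpow r 1)) = \dim (vpart j (fullv : {vspace r})))%N.
  by rewrite -eC dimv_disjoint_sum // capv_diff.
pose n := fix n l (j : vertex Q) :=
  if l is l'.+1 then (\sum_(a | tgt a == j) n l' (src a))%N else \dim (C j).
pose S : ssseq Q L := fun l => [ffun j => n l j].
have layS l j : (l <= L)%N -> lay S l j = n l j.
  by rewrite -ltnS => h; rewrite -[l]/(val (Ordinal h)) layE ffunE.
have hS l j : (l < L)%N -> lay S l.+1 j = (\sum_(a | tgt a == j) lay S l (src a))%N.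
  move=> lL; rewrite layS //=; apply: eq_bigr => a _; rewrite layS //; exact: ltnW.
have [|F [cF fF]] := @forest_exists Q L S.
  by move=> l j /hS ->.
have {}fF := fF hS.
pose root (x : 'I_(tdim S)) := flam F x == 0%N.
pose rj j := [seq x <- enum 'I_(tdim S) | (fv F x == j) && root x].
have srj j : size (rj j) = \dim (C j).
  have := cF 0%N j; rewrite layS //= => <-.
  by rewrite /rj size_filter -sum1_count big_enum_cond sum1_card; apply: eq_card => y; rewrite !inE.
pose z x : r := (vbasis (C (fv F x)))`_(index x (rj (fv F x))).
have rootN x : fpar F x = None <-> root x.
  split=> [/fparN/eqP//|/eqP hx]; case e: (fpar F x) => [[a y]|] //.
  by have [_ _] := fparS e; rewrite hx.
have rrj x : root x -> x \in rj (fv F x) by move=> h; rewrite mem_filter eqxx h mem_enum.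
have zC x : root x -> z x \in C (fv F x).
  move=> /rrj h; apply: vbasis_mem; apply: mem_nth; rewrite size_tuple -srj.
  by rewrite index_mem.
have CV j : (C j <= vpart j fullv)%VS by apply: diffvSl.
have [|h hE] := @full_universal K Q L _ F fF (repmod r : lmodType Lambda) z.
  move=> x /rootN/zC/(subvP (CV _)).
  by rewrite memv_vpart ?repmod_gen_vertex; [case/andP=> _ /eqP | apply: vstable_full].
have [p hp pE] := linear_rep_hom h.
exists (tdim S), F, p; split=> //.
  apply: Jmul_generate; first by apply: rep_hom_submodule => //; apply: submodule_full.
  apply/eqP; rewrite eqEsubv subvf /=; apply/subvP=> m _.
  rewrite -(rE1 m); apply: rpred_sum => j _.
  have : rE r j m \in vpart j fullv by apply: memv_img; apply: memvf.
  rewrite -eC; apply/subvP; apply: addvS; last by case: (submodule_Jpow r 1) => + _; apply.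
  rewrite -[X in (X <= _)%VS](span_basis (vbasisP _)); apply/span_subvP=> u.
  move=> /(nthP 0)[i hi <-]; rewrite size_tuple -srj in hi.
  have x0 : 'I_(tdim S) by case: (rj j) hi.
  pose x := nth x0 (rj j) i; have : x \in rj j by apply: mem_nth.
  rewrite mem_filter => /andP[/andP[/eqP xj rx] _].
  have -> : (vbasis (C j))`_i = z x.
    by rewrite /z xj index_uniq // filter_uniq // enum_uniq.
  by rewrite -hE; [rewrite -pE; apply: memv_img; apply: memvf | apply/rootN].
apply/ffunP=> j; rewrite /rlayer !ffunE -[Jpow r 0]/fullv -dC.
rewrite (dim_frep_step F (w := fun=> 1)); last by move=> _; apply: oner_neq0.
rewrite -/(lay_count F 0 j) cF layS // !PoszD /= !addrK //.
Qed.

End Cover.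

Section Syzygy.
Variables (K : fieldType) (Q : quiver) (L : nat) (r : qrep K Q L).
Local Notation Lambda := (tpalg K Q L).
Variables (d : nat) (F : forest Q L d).
Local Notation Fr := (frep F (fun=> 1 : K)).
Variable p : 'Hom(Fr, r).
Hypotheses (fullF : full_forest F) (hp : rep_hom p) (pS : limg p = fullv).
Hypothesis top : rlayer Fr 0 = rlayer r 0.

Lemma syz_dim m : dimvec (lker p :&: Jpow Fr m)%VS = dimvec (Jpow Fr m) - dimvec (Jpow r m).
Proof.
have sF : vstable (Jpow Fr m) by case: (submodule_Jpow Fr m).
have sK : vstable (lker p) by case: (rep_hom_ker hp).
apply/ffunP=> j; rewrite !ffunE.
have := limg_ker_dim p (vpart j (Jpow Fr m)); rewrite rep_hom_vpart // rep_hom_iter_Jmul // pS.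
have -> : (vpart j (Jpow Fr m) :&: lker p = vpart j (lker p :&: Jpow Fr m))%VS.
  apply/vspaceP=> u; rewrite memv_cap !memv_vpart //; last exact: vstable_cap.
  by rewrite memv_cap [LHS]andbC andbA.
rewrite -[iter m _ _]/(Jpow r m) => <-; rewrite PoszD addrK //.
Qed.

(** The top of the cover has the same dimension as the top of [r], so the kernel
    lies in the radical: the cover is minimal. *)
Lemma syz_top : (lker p <= Jpow Fr 1)%VS.
Proof.
have sK : vstable (lker p) by case: (rep_hom_ker hp).
have sF : vstable (Jpow Fr 1) by case: (submodule_Jpow Fr 1).
rewrite -[lker p](@vstable_eq _ _ _ _ (lker p :&: Jpow Fr 1)%VS); first exact: capvSr.
- exact: vstable_cap.
- by [].
- exact: capvSl.
move=> j; have h1 := syz_dim 1.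
have h0 : dimvec (lker p) = dimvec (Jpow Fr 0) - dimvec (Jpow r 0) by rewrite -syz_dim capvf.
have : dimvec (lker p) = dimvec (lker p :&: Jpow Fr 1)%VS.
  rewrite h0 h1; have := top; rewrite /rlayer => e; apply/ffunP=> i.
  by have := congr1 (fun f : {ffun _ -> _} => f i) e; rewrite !ffunE; lia.
by move=> /ffunP/(_ j); rewrite !ffunE => -[].
Qed.

Definition syz : qrep K Q L := subrep (rep_hom_ker hp).

Lemma syz_exact : exists (i : {linear repmod syz -> repmod Fr})
    (q : {linear repmod Fr -> repmod r}),
  [/\ short_exact i q, forall m, (q m : r) = p m & forall m, (i m : Fr) = vsval m].
Proof.
have [q qE] := rep_hom_linear hp.
have [i iE] := rep_hom_linear (incl_hom (rep_hom_ker hp)).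
exists i, q; split=> //; last by move=> m; rewrite iE inclE.
split.
- by move=> x y; rewrite !iE !inclE; apply: subvs_inj.
- move=> m; have : (m : r) \in limg p by rewrite pS memvf.
  by move=> /memv_imgP[u _ e]; exists u; rewrite qE.
move=> x; rewrite qE; split=> [e|[y <-]].
  have xK : (x : Fr) \in lker p by rewrite memv_ker e.
  by exists (vsproj _ (x : Fr)); rewrite iE inclE vsprojK.
by rewrite iE inclE; apply/eqP; rewrite -memv_ker; apply: subvsP.
Qed.

Lemma syz_resolution n : has_projective_resolution (repmod r : lmodType Lambda) n.+1 <->
  has_projective_resolution (repmod syz : lmodType Lambda) n.
Proof.
have [i [q [ex _ _]]] := syz_exact.
exact: (resolution_shift _ ex (full_projective fullF)).
Qed.

Lemma syz_dimv n : (n <= L.+1)%N ->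
  dimvec (Jpow syz n) = iter n (@trans Q)
    (dimvec (Jpow Fr 0) - dimvec (Jpow r 0) - (dimvec (Jpow Fr (L.+1 - n)) - dimvec (Jpow r (L.+1 - n)))).
Proof.
move=> hn; have -> : dimvec (Jpow syz n) = dimvec (iter n (@Jmul _ _ _ Fr) (lker p)).
  by apply/ffunP=> j; rewrite !ffunE dim_subrep.
rewrite full_dimv_iter //; last by case: (rep_hom_ker hp).
by rewrite -!syz_dim -[Jpow Fr 0]/fullv capvf.
Qed.

(** All dimension vectors of the powers [J^n N] of the syzygy are images under
    [trans] of differences between the cover and [r]. In the defect of the syzygy
    the contributions of the full forest cancel. *)
Lemma syz_crit k : (k < L)%N -> rcrit syz k = iter k.+1 (@trans Q) (rcrit r (L.-1 - k)).
Proof.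
move=> kL; rewrite /rcrit /rlayer !syz_dimv; try lia.
set m := (L.-1 - k)%N.
have -> : (L.+1 - k = m.+2)%N by rewrite /m; lia.
have -> : (L.+1 - k.+1 = m.+1)%N by rewrite /m; lia.
have -> : (L.+1 - k.+2 = m)%N by rewrite /m; lia.
have mL : (m < L)%N by rewrite /m; lia.
have := full_rlayer K fullF mL; rewrite /rlayer => e.
(* the defect of differences of powers of [trans] is a power of [trans] *)
have key (A B C : {ffun vertex Q -> int}) :
    trans (iter k (@trans Q) A - iter k.+1 (@trans Q) B) -
      (iter k.+1 (@trans Q) B - iter k.+2 (@trans Q) C) =
    iter k.+1 (@trans Q) (A - B - trans (B - C)).
  rewrite [RHS]iter_transB -iterSr !iter_transB transB -!iterS.
  move: (iter _ _ A) (iter k.+1 _ B) (iter k.+2 _ B) (iter _ _ C) => x y y' z.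
  by rewrite !opprB addrACA [RHS]addrACA [- y' + _]addrC.
rewrite key; congr iter.
move: (dimvec (Jpow Fr 0) - dimvec (Jpow r 0)) e => a e.
move: (dimvec (Jpow Fr m)) (dimvec (Jpow Fr m.+1)) (dimvec (Jpow Fr m.+2)) e => f0 f1 f2 e.
move: (dimvec (Jpow r m)) (dimvec (Jpow r m.+1)) (dimvec (Jpow r m.+2)) => v0 v1 v2.
have sub2 (x y z : {ffun vertex Q -> int}) : x - y - (x - z) = z - y.
  by rewrite opprB addrC addrA subrK.
have sub4 (x y z t : {ffun vertex Q -> int}) : x - y - (z - t) = x - z - (y - t).
  by rewrite !opprD addrACA.
by rewrite !sub2 (sub4 f1 v1) (sub4 f0 v0) transB -e sub2.
Qed.

(** Without critical pairs the cover and [r] have the same layers, hence the same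
    dimension. *)
Lemma syz_nil : (forall k, (k < L)%N -> rcrit r k = 0) -> lker p = 0%VS.
Proof.
move=> c0; have e k : (k <= L)%N -> rlayer Fr k = rlayer r k.
  elim: k => [//|k IHk] kL; rewrite full_rlayer // IHk; last exact: ltnW.
  by have /eqP := c0 k kL; rewrite /rcrit subr_eq0 => /eqP.
have e' k : (k <= L.+1)%N -> dimvec (Jpow Fr (L.+1 - k)) = dimvec (Jpow r (L.+1 - k)).
  elim: k => [_|k IHk kL].
    by rewrite subn0 !Jpow_nil; apply/ffunP=> j; rewrite !ffunE /vpart !limg0 !dimv0.
  have := e (L.+1 - k.+1)%N; rewrite subSS leq_subr /rlayer => /(_ isT).
  have := IHk (ltnW kL); have -> : (L.+1 - k = (L - k).+1)%N by lia.
  by move=> -> /addIr.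
have := syz_dim 0; have := e' L.+1 (leqnn _); rewrite subnn => ->; rewrite subrr capvf => h.
have sK : vstable (lker p) by case: (rep_hom_ker hp).
apply/eqP; rewrite -dimv_eq0 (dim_vstable sK) big1 // => j _.
by have := congr1 (fun f : {ffun _ -> _} => f j) h; rewrite !ffunE => -[].
Qed.

End Syzygy.

(** ** Projective dimension *)

Section Pdim.
Variables (K : fieldType) (Q : quiver) (L : nat).
Local Notation Lambda := (tpalg K Q L).

(** If [r] is projective, its cover [p] splits. The projection of the cover onto
    the kernel of [p] along the splitting maps the radical, which contains the
    kernel, into the radical of the kernel. So the kernel is equal to its own
    radical and vanishes. *)
Lemma rcrit_projective (r : qrep K Q L) :
  projective (repmod r : lmodType Lambda) <-> forall k, (k < L)%N -> rcrit r k = 0.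
Proof.
have [d [F [p [fullF hp pS top]]]] := projective_cover r.
have [i [q [[iinj qS ex] qE iE]]] := syz_exact hp pS.
split=> [pr|c0]; last first.
  have k0 := syz_nil fullF hp pS top c0.
  apply: (projective_iso (f := q)) (full_projective fullF).
  apply: inj_surj_bij => // x y e.
  have : (x - y : frep F (fun=> 1 : K)) \in lker p.
    by rewrite memv_ker -qE linearB e subrr.
  by rewrite k0 memv0 subr_eq0 => /eqP.
have [s sE] := pr _ _ q (idfun : {linear _ -> _}) qS.
(* the projection onto the kernel along the splitting [s] *)
have [g gE] : exists g : {linear repmod (frep F (fun=> 1 : K)) -> repmod (frep F (fun=> 1 : K))},
    forall x, g x = x - s (q x).
  have [||g gE] := @mk_linear _ (repmod (frep F (fun=> 1 : K))) (repmod (frep F (fun=> 1 : K)))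
     (fun x => x - s (q x)); last by exists g.
  - by move=> u v; rewrite (linearD q) (linearD s) opprD addrACA.
  - move=> a u; have -> : q (a *: u) = a *: q u by apply: linearZ.
    have -> : s (a *: q u) = a *: s (q u) by apply: linearZ.
    by rewrite scalerBr.
have [rho hrho rhoE] := linear_rep_hom g.
have k0 : lker p = 0%VS.
  apply: Jmul_fixed0.
  have -> : lker p = (rho @: lker p)%VS.
    apply/vspaceP=> x; apply/idP/memv_imgP => [xk|[u uk ->]].
      exists x => //; rewrite rhoE gE; move: (xk); rewrite memv_ker -qE => /eqP ->.
      by rewrite linear0 [X in _ = X]subr0.
    rewrite rhoE gE memv_ker -qE linearB.
    by have /= -> := sE (q u); rewrite subrr.
  apply: (@subv_trans _ _ (rho @: Jpow (frep F (fun=> 1 : K)) 1)%VS).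
    by apply: limgS; apply: syz_top.
  rewrite -[Jpow _ 1]/(Jmul fullv) rep_hom_Jmul //; apply: JmulS.
  apply/subvP=> _ /memv_imgP[u _ ->].
  have qv : q (rho u) = 0 by rewrite rhoE gE linearB; have /= -> := sE (q u); rewrite subrr.
  have -> : rho u = rho (rho u) by rewrite [RHS]rhoE gE qv linear0 [RHS]subr0.
  by apply: memv_img; rewrite memv_ker -qE qv.
have p0 : lker p == 0%VS by rewrite k0.
have e l : dimvec (Jpow (frep F (fun=> 1 : K)) l) = dimvec (Jpow r l).
  by apply/ffunP=> j; rewrite !ffunE (rep_hom_bij_dim hp) ?p0 // pS.
move=> k kL; rewrite /rcrit /rlayer -!e.
by have := full_rlayer K fullF kL; rewrite /rlayer => ->; rewrite subrr.
Qed.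

(** The index [k] stands for layer [k.+1]; a path of length [L - k] leads from a
    critical pair of a module to one in layer [L - k] of its syzygy, whose index
    is [L.-1 - k]. *)
Fixpoint chain n k (j : vertex Q) : Prop :=
  if n is n'.+1 then exists2 i, reach (L - k)%N j i & chain n' (L.-1 - k)%N i else True.

Theorem resolution_rcrit (r : qrep K Q L) n :
  has_projective_resolution (repmod r : lmodType Lambda) n <->
  forall k j, (k < L)%N -> 0 < rcrit r k j -> ~ chain n k j.
Proof.
elim: n r => [|n IHn] r.
  rewrite resolution0 rcrit_projective; split=> [h k j kL|h k kL].
    by rewrite h // ffunE.
  apply/ffunP=> j; rewrite [RHS]ffunE; apply/eqP; rewrite eq_sym.
  have := rcrit_ge0 r k j; rewrite Order.POrderTheory.le_eqVlt => /predU1P[->//|hj].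
  by case: (h k j kL hj).
have [d [F [p [fullF hp pS top]]]] := projective_cover r.
rewrite (syz_resolution fullF hp pS) IHn; split=> h k j kL.
  move=> cj [i ri ci]; apply: (h (L.-1 - k)%N i) ci; first by lia.
  rewrite (syz_crit fullF hp pS); last by lia.
  apply/iter_trans_gt0; first by move=> ?; apply: rcrit_ge0.
  exists j; have -> : (L.-1 - (L.-1 - k) = k)%N by lia.
  by have -> : ((L.-1 - k).+1 = L - k)%N by lia.
rewrite (syz_crit fullF hp pS) // => /iter_trans_gt0[?|i [ci ri]]; first exact: rcrit_ge0.
move=> cj; apply: (h (L.-1 - k)%N i) ci _; first by lia.
exists j; first by have -> : (L - (L.-1 - k) = k.+1)%N by lia.
by have -> : (L.-1 - (L.-1 - k) = k)%N by lia.
Qed.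

End Pdim.

(** * Lengths of paths and degrees *)

Definition enat_le (m n : enat) : bool :=
  match m, n with
  | _, None => true
  | None, Some _ => false
  | Some a, Some b => (a <= b)%N
  end.

Lemma enat_le_refl m : enat_le m m. Proof. by case: m => /=. Qed.

Lemma enat_le_trans m n p : enat_le m n -> enat_le n p -> enat_le m p.
Proof. by case: m n p => [m|] [n|] [p|] //=; apply: leq_trans. Qed.

Lemma enat_le_anti m n : enat_le m n -> enat_le n m -> m = n.
Proof. by case: m n => [m|] [n|] //= h h'; congr Some; apply/eqP; rewrite eqn_leq h. Qed.

Lemma enat_leNgt m n : enat_le m n = ~~ enat_lt n m.
Proof. by case: m n => [m|] [n|] //=; rewrite -leqNgt. Qed.

Lemma enat_ltSS m n : enat_lt (enat_succ m) (enat_succ n) = enat_lt m n.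
Proof. by case: m n => [m|] [n|]. Qed.

Lemma enat_le_total m n : enat_le m n || enat_le n m.
Proof. by case: m n => [m|] [n|] //=; apply: leq_total. Qed.

Lemma enat_ltW m n : enat_lt m n -> enat_le m n.
Proof. by case: m n => [m|] [n|] //=; apply: ltnW. Qed.

Lemma enat_max (I : finType) (P : I -> Prop) (f : I -> enat) : (exists i, P i) ->
  exists i, P i /\ forall i', P i' -> enat_le (f i') (f i).
Proof.
move=> [i0 P0]; suff: forall s : seq I, exists i, P i /\ forall i', i' \in s -> P i' -> enat_le (f i') (f i).
  by move=> /(_ (enum I))[i [Pi h]]; exists i; split=> // i'; apply: h; rewrite mem_enum.
elim=> [|a s [i [Pi h]]]; first by exists i0.
have [[Pa ha]|na] := pselect (P a /\ enat_le (f i) (f a)).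
  exists a; split=> // i'; rewrite inE => /predU1P[->|/h h' /h' e]; first by rewrite enat_le_refl.
  exact: enat_le_trans e ha.
exists i; split=> // i'; rewrite inE => /predU1P[-> Pa|/h //].
by case/orP: (enat_le_total (f i) (f a)) => // e; case: na.
Qed.

Section Lengths.
Variables (Q : quiver) (L : nat).

Lemma reach_add m n (i j : vertex Q) :
  reach (m + n) i j <-> exists2 x, reach m i x & reach n x j.
Proof.
elim: n j => [|n IHn] j; rewrite ?addn0 ?addnS /=.
  by split=> [h|[x h <-]] //; exists j.
split=> [[a ea /IHn[x h1 h2]]|[x h1 [a ea h2]]].
  by exists x => //; exists a.
by exists a => //; apply/IHn; exists x.
Qed.

Lemma reach_path n (i : vertex Q) : (exists j, reach n i j) <->
  exists2 p : qpath Q, pstart p = i & plength p = n.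
Proof.
have h j : reach n i j -> exists p : qpath Q, [/\ pstart p = i, pend p = j & plength p = n].
  elim: n j => [|n IHn] j /=; first by move=> <-; exists (vpath i).
  move=> [a <- /IHn[p [pi pe pl]]].
  have hc : composable (pstart p, rcons p.2 a).1 (pstart p, rcons p.2 a).2.
    by rewrite /= -cats1 composable_cat qpath_valP /= andbT -/(pend p) pe.
  exists (QPath hc); split=> //; first by rewrite /pend /= map_rcons last_rcons.
  by rewrite /plength /= size_rcons -/(plength p) pl.
split=> [[j /h[p [pi _ pl]]]|[[[v s] hc] /= <-]]; first by exists p.
rewrite /plength /pstart /= => <- {n h}; exists (last v (map (@tgt Q) s)).
move: hc => /=; elim/last_ind: s => [|s a IHs] //=.
rewrite -cats1 composable_cat /= andbT => /andP[hc /eqP ea].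
rewrite size_cat addn1 map_cat last_cat /=; exists a => //; rewrite ea; exact: IHs.
Qed.

Definition long m (i : vertex Q) : Prop := exists j, reach m i j.

Lemma long_anti m n i : (m <= n)%N -> long n i -> long m i.
Proof.
by move=> /subnKC <- [j /reach_add[x hx _]]; exists x.
Qed.

Lemma long_clen m i : long m i <-> enat_le (Some m) (clen i).
Proof.
have eA n : (exists2 p : qpath Q, pstart p = i & plength p = n) <-> long n i.
  by rewrite -reach_path.
rewrite /clen /enat_sup; case: pselect => [h|nh].
  case: ex_minnP => n /asboolP hn hmin /=; split=> [/eA/hn //|mn].
  apply: long_anti mn _; apply: contrapT => nl.
  have n0 : (0 < n)%N.
    by rewrite lt0n; apply/eqP=> e; apply: nl; rewrite e; exists i.
  have : (n <= n.-1)%N.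
    apply: hmin; apply/asboolP => k /eA lk; rewrite -ltnS prednK //.
    rewrite ltnNge; apply/negP => nk; exact: nl (long_anti nk lk).
  by rewrite -ltnS prednK // ltnn.
split=> // _; apply: contrapT => nl; apply: nh; exists m; apply/asboolP => k /eA lk.
by rewrite leqNgt; apply/negP => /ltnW mk; exact: nl (long_anti mk lk).
Qed.

Lemma clen_reach m (i j : vertex Q) : reach m i j ->
  enat_le (omap (addn m) (clen j)) (clen i).
Proof.
move=> r; have h n : long n j -> long (m + n) i.
  by move=> [x rx]; exists x; apply/reach_add; exists j.
case ej: (clen j) => [c|] /=.
  have /h/long_clen : long c j by apply/long_clen; rewrite ej /=.
  by case: (clen i).
case ei: (clen i) => [d|] //; have /h/long_clen : long d.+1 j by apply/long_clen; rewrite ej.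
by rewrite ei /= => h'; exfalso; lia.
Qed.

Lemma ldeg_mono l l' c c' : (l <= l')%N -> enat_le c c' -> enat_le (ldeg L l c) (ldeg L l' c').
Proof.
case: c c' => [c|] [c'|] //= ll cc.
by apply: leq_add; apply: leq_div2r => //; apply: leq_add.
Qed.

(** A path of length [m] from [i] to [j] makes [clen i] larger than [clen j] by at
    least [m], which compensates a lower layer. *)
Lemma ldeg_reach m l l' (i j : vertex Q) : reach m i j -> (l <= m + l')%N ->
  enat_le (ldeg L l (clen j)) (ldeg L l' (clen i)).
Proof.
move=> /clen_reach; case: (clen j) (clen i) => [c|] [d|] //= h hl.
by apply: leq_add; apply: leq_div2r; lia.
Qed.

(** The total length of the paths in a chain. *)
Fixpoint chain_length n k : nat := if n is n'.+1 then (L - k + chain_length n' (L.-1 - k))%N else 0%N.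

Lemma chain_long n k i : @chain Q L n k i <-> long (chain_length n k) i.
Proof.
elim: n k i => [|n IHn] k i /=; first by split=> // _; exists i.
split=> [[j r /IHn[x rx]]|[x /reach_add[j r rx]]].
  by exists x; apply/reach_add; exists j.
by exists j => //; apply/IHn; exists x.
Qed.

(** One step of a chain shortens [c] by [L - k] and exchanges the roles of the
    two quotients in the degree, lowering their sum by one. *)
Lemma chain_length_div n k c : (k < L)%N ->
  (chain_length n k <= c)%N = (n <= c %/ L.+1 + (c + k.+1) %/ L.+1)%N.
Proof.
elim: n k c => [|n IHn] k c kL //=.
case: (ltnP c (L - k)) => hc.
  rewrite !divn_small; try lia.
have -> : (L - k + chain_length n (L.-1 - k) <= c)%N = (chain_length n (L.-1 - k) <= c - (L - k))%N by lia.
rewrite IHn; last by lia.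
have -> : (c - (L - k) + (L.-1 - k).+1 = c)%N by lia.
have -> : (c + k.+1 = 1 * L.+1 + (c - (L - k)))%N by lia.
by rewrite divnMDl // ; lia.
Qed.

Lemma chain_ldeg n k i : (k < L)%N ->
  @chain Q L n k i <-> enat_le (Some n) (ldeg L k.+1 (clen i)).
Proof.
move=> kL; rewrite chain_long long_clen; case: (clen i) => [c|] //=.
by rewrite chain_length_div.
Qed.

End Lengths.

(** * The projective dimension of a layering *)

Section PdSpec.
Variables (Q : quiver) (L : nat).
Implicit Types S : ssseq Q L.

Definition critS S k (j : vertex Q) : Prop :=
  (lay S k.+1 j < \sum_(a | tgt a == j) lay S k (src a))%N.

Definition validS S : Prop := forall l j, (l < L)%N ->
  (lay S l.+1 j <= \sum_(a | tgt a == j) lay S l (src a))%N.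

(** This determines the projective dimension of a layering: 0, or one more than
    the largest degree of a critical pair. The characterization is used instead
    of a maximum because the degrees may be infinite. *)
Definition pdspec S (v : enat) : Prop :=
  (v = Some 0%N /\ forall k j, (k < L)%N -> ~ critS S k j) \/
  exists k j, [/\ (k < L)%N, critS S k j, v = enat_succ (ldeg L k.+1 (clen j)) &
    forall k' j', (k' < L)%N -> critS S k' j' ->
      enat_le (ldeg L k'.+1 (clen j')) (ldeg L k.+1 (clen j))].

Lemma pdspec_unique S v v' : pdspec S v -> pdspec S v' -> v = v'.
Proof.
move=> [[-> n]|[k [j [kL c -> m]]]] [[-> n']|[k' [j' [kL' c' -> m']]]] //.
- by case: (n k' j').
- by case: (n' k j).
by congr enat_succ; apply: enat_le_anti; [apply: m' | apply: m].
Qed.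

Variable K : fieldType.
Local Notation Lambda := (tpalg K Q L).

Lemma layering_rlayer (r : qrep K Q L) S l j :
  has_radical_layering (repmod r : lmodType Lambda) S -> (l <= L)%N ->
  rlayer r l j = (lay S l j)%:Z.
Proof.
move=> h; rewrite -ltnS => hl; have := layering_dim (Ordinal hl) j h.
by rewrite /= /rlayer !ffunE => ->; rewrite PoszD addrK -[l]/(val (Ordinal hl)) layE.
Qed.

Lemma layering_rcrit (r : qrep K Q L) S k j :
  has_radical_layering (repmod r : lmodType Lambda) S -> (k < L)%N ->
  rcrit r k j = (\sum_(a | tgt a == j) lay S k (src a))%N%:Z - (lay S k.+1 j)%:Z.
Proof.
move=> h kL; have -> : rcrit r k j = \sum_(a | tgt a == j) rlayer r k (src a) - rlayer r k.+1 j.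
  by rewrite /rcrit; move: (rlayer r k) (rlayer r k.+1) => f g; rewrite !ffunE.
rewrite (layering_rlayer _ h) // sumPoz.
congr (_ - _); apply: eq_bigr => a _; exact: layering_rlayer (ltnW kL).
Qed.

Lemma layering_valid (r : qrep K Q L) S :
  has_radical_layering (repmod r : lmodType Lambda) S -> validS S.
Proof.
by move=> h l j lL; have := rcrit_ge0 r l j; rewrite (layering_rcrit _ h) //; lia.
Qed.

(** A resolution of length [n] exists exactly when [n] exceeds the degrees of all
    the critical pairs, and the largest degree is attained. *)
Lemma layering_pdspec (r : qrep K Q L) S :
  has_radical_layering (repmod r : lmodType Lambda) S ->
  pdspec S (pdim (repmod r : lmodType Lambda)).
Proof.
move=> h; have cE k j : (k < L)%N -> 0 < rcrit r k j <-> critS S k j.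
  by move=> kL; rewrite (layering_rcrit _ h) // /critS; split; lia.
have res n : has_projective_resolution (repmod r : lmodType Lambda) n <->
    forall k j, (k < L)%N -> critS S k j -> ~ enat_le (Some n) (ldeg L k.+1 (clen j)).
  rewrite resolution_rcrit; split=> H k j kL c.
    by rewrite -(chain_ldeg _ _ kL); apply: H => //; apply/cE.
  by rewrite (chain_ldeg _ _ kL); apply: H => //; apply/cE.
have [[k [j [kL c]]]|none] := pselect (exists k j, (k < L)%N /\ critS S k j); last first.
  left; split; last by move=> k j kL c; apply: none; exists k, j.
  rewrite /pdim /enat_inf; case: pselect => [ex|[]].
    case: ex_minnP => n _ hmin; congr Some; apply/eqP; rewrite -leqn0; apply: hmin.
    by apply/asboolP/res => k j kL c; case: none; exists k, j.
  by exists 0%N; apply/asboolP/res => k j kL c; case: none; exists k, j.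
right.
have [|[k0 j0] [/= c0 m0]] := @enat_max _ (fun p : 'I_L * vertex Q => critS S p.1 p.2)
  (fun p => ldeg L p.1.+1 (clen p.2)); first by exists (Ordinal kL, j).
exists k0, j0; split=> //; last first.
  by move=> k' j' kL' c'; exact: (m0 (Ordinal kL', j')).
have res' n : has_projective_resolution (repmod r : lmodType Lambda) n <->
    ~ enat_le (Some n) (ldeg L k0.+1 (clen j0)).
  rewrite res; split=> [H|H k' j' kL' c' e]; first exact: H.
  by apply: H; apply: enat_le_trans e (m0 (Ordinal kL', j') c').
rewrite /pdim /enat_inf; case: pselect => [ex|nex].
  case: ex_minnP => n /asboolP/res' + hmin.
  case: (ldeg _ _ _) res' => [d|] res' //= /negP; rewrite -ltnNge => dn.
  congr Some; apply/eqP; rewrite eqn_leq dn andbT; apply: hmin; apply/asboolP/res' => /=.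
  by rewrite ltnn.
case: (ldeg _ _ _) res' => [d|] res' //=; case: nex; exists d.+1.
by apply/asboolP/res' => /=; rewrite ltnn.
Qed.

End PdSpec.

(** * Comparing layerings *)

Section Compare.
Variables (Q : quiver) (L : nat).
Implicit Types S : ssseq Q L.

Definition cum S n j : nat := (\sum_(l < n) lay S l j)%N.

Definition lay_ge S' S : Prop :=
  (forall j, cum S L.+1 j = cum S' L.+1 j) /\ (forall n j, cum S n j <= cum S' n j)%N.

Lemma cum_ord S n j : (\sum_(l < L.+1 | (l < n)%N) S l j)%N = cum S n j.
Proof.
have -> : (\sum_(l < L.+1 | (l < n)%N) S l j)%N = (\sum_(l < L.+1 | (l < n)%N) lay S l j)%N.
  by apply: eq_bigr => l _; rewrite layE.
rewrite /cum; case: (leqP n L.+1) => h.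
  by rewrite (big_ord_widen _ (fun l => lay S l j) h).
transitivity (\sum_(l < L.+1) lay S l j)%N.
  by apply: eq_bigl => l; rewrite (ltn_trans (ltn_ord l) h).
rewrite (big_ord_widen n (fun l => lay S l j) (ltnW h)) [RHS](bigID (fun l : 'I_n => (l < L.+1)%N)) /=.
rewrite [X in (_ + X)%N]big1 ?addn0 // => l.
by rewrite -leqNgt => /lay_big ->.
Qed.

Lemma ssseq_geP S' S : ssseq_ge S' S <-> lay_ge S' S.
Proof.
have e0 (T : ssseq Q L) j : (\sum_(l < L.+1) T l : ssmod Q) j = cum T L.+1 j.
  rewrite sum_ffunE -cum_ord; apply: eq_bigl => l; by rewrite ltn_ord.
have e1 (T : ssseq Q L) r j : (\sum_(l < L.+1 | (l <= r)%N) T l : ssmod Q) j = cum T r.+1 j.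
  by rewrite sum_ffunE -cum_ord.
split=> [[e h]|[e h]].
  split=> [j|[|n] j]; first by rewrite -!e0 e.
    by rewrite /cum !big_ord0.
  by have [C hC] := h n; rewrite -!e1 hC ffunE leq_addr.
split=> [|r]; first by apply/ffunP=> j; rewrite !e0.
exists [ffun j => (cum S' r.+1 j - cum S r.+1 j)%N]; apply/ffunP=> j.
by rewrite ffunE ffunE !e1; apply/esym/subnKC/h.
Qed.

(** The layers that the top would generate if there were no critical pairs. *)
Fixpoint free_lay S l j : nat :=
  if l is l'.+1 then (\sum_(a | tgt a == j) free_lay S l' (src a))%N else lay S 0 j.

Lemma lay_free S l j : validS S -> (l <= L)%N -> (lay S l j <= free_lay S l j)%N.
Proof.
move=> v; elim: l j => [|l IHl] j lL //=.
by apply: leq_trans (v l j lL) _; apply: leq_sum => a _; apply: IHl; apply: ltnW.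
Qed.

Lemma free_lay_mono S S' l j : lay_ge S' S -> (free_lay S l j <= free_lay S' l j)%N.
Proof.
move=> [_ h]; elim: l j => [|l IHl] j /=; last by apply: leq_sum.
by have := h 1%N j; rewrite /cum !big_ord1.
Qed.

Lemma free_lay_reach S l j : (0 < free_lay S l j)%N <-> exists i, (0 < lay S 0 i)%N /\ reach l i j.
Proof.
elim: l j => [|l IHl] j /=; first by split=> [h|[i [h <-]]] //; exists j.
split=> [|[i [hi [a ea ri]]]].
  rewrite lt0n sum_nat_eq0 negb_forall => /existsP[a]; rewrite negb_imply -lt0n.
  by move=> /andP[/eqP ea /IHl[i [hi ri]]]; exists i; split=> //; exists a.
rewrite (bigD1 a) ?ea //= addn_gt0; apply/orP; left; apply/IHl; by exists i.
Qed.

Definition upset (U : nat -> vertex Q -> Prop) : Prop :=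
  (forall l l' j, (l <= l')%N -> U l j -> U l' j) /\
  (forall l a, (0 < l)%N -> U l.+1 (tgt a) -> U l (src a)).

(** On [U] the layering [S'] is generated freely by its top, which contains the
    top of [S]; so its layers are at least those of [S]. On the other hand
    [S' >= S] makes the sums over the layers from [l] on at most those of [S].
    Hence both agree on [U], and [S] is generated freely there as well. *)
Lemma upset_rigid S S' U : validS S -> validS S' -> lay_ge S' S -> upset U ->
  (forall k j, (k < L)%N -> U k.+1 j -> ~ critS S' k j) ->
  (forall l j, (0 < l <= L)%N -> U l j ->
     lay S' l j = lay S l j /\ free_lay S l j = lay S l j) /\
  (forall k j, (k < L)%N -> U k.+1 j -> ~ critS S k j).
Proof.
move=> vS vS' ge [Ul Up] nc.
have fr l j : (l <= L)%N -> U l j -> lay S' l j = free_lay S' l j.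
  elim: l j => [//|l IHl] j lL Uj /=.
  have -> : lay S' l.+1 j = (\sum_(a | tgt a == j) lay S' l (src a))%N.
    apply/eqP; rewrite eqn_leq vS' //= leqNgt; apply/negP; exact: nc.
  apply: eq_bigr => a /eqP ea; case: l IHl lL Uj => [//|l] IHl lL Uj.
  by apply: IHl; [apply: ltnW | apply: Up; rewrite ?ea].
have le l j : (l <= L)%N -> U l j -> (lay S l j <= free_lay S l j <= lay S' l j)%N.
  by move=> lL Uj; rewrite (fr l j) // free_lay_mono // andbT; apply: lay_free.
have key l j : (0 < l <= L)%N -> U l j -> lay S' l j = lay S l j.
  move=> /andP[l0 lL] Uj.
  (* the totals over all layers agree, so larger partial sums mean smaller tails *)
  have tail (T : ssseq Q L) : (cum T L.+1 j = cum T l j + \sum_(l <= m < L.+1) lay T m j)%N.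
    rewrite /cum -!(big_mkord xpredT (fun m => lay T m j)).
    by rewrite (big_cat_nat (n := l)) //=; apply: ltnW.
  have h : (\sum_(l <= m < L.+1) lay S' m j <= \sum_(l <= m < L.+1) lay S m j)%N.
    by have := ge.1 j; have := ge.2 l j; rewrite !tail; lia.
  apply/eqP; rewrite eqn_leq; have /andP[h1 h2] := le l j lL Uj.
  rewrite (leq_trans h1 h2) andbT.
  move: h; rewrite !(big_ltn (m := l)) // => h.
  have : (\sum_(l.+1 <= m < L.+1) lay S m j <= \sum_(l.+1 <= m < L.+1) lay S' m j)%N.
    rewrite !big_nat; apply: leq_sum => m /andP[lm mL].
    have /andP[h3 h4] := le m j mL (Ul _ _ _ (ltnW lm) Uj); exact: leq_trans h3 h4.
  lia.
have free l j : (0 < l <= L)%N -> U l j -> free_lay S l j = lay S l j.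
  move=> hl Uj; have /andP[_ lL] := hl; have := le l j lL Uj; rewrite key //; lia.
split=> [l j hl Uj|k j kL Uj]; first by rewrite key // free.
rewrite /critS -free //=; apply/negP; rewrite -leqNgt.
by apply: leq_sum => a _; apply: lay_free => //; apply: ltnW.
Qed.

Definition deg_up (D : enat) l (j : vertex Q) : Prop := enat_le D (ldeg L l (clen j)).
Definition deg_above (D : enat) l (j : vertex Q) : Prop := enat_lt D (ldeg L l (clen j)).

Lemma enat_lt_le_trans m n p : enat_lt m n -> enat_le n p -> enat_lt m p.
Proof. by case: m n p => [m|] [n|] [p|] //=; apply: leq_trans. Qed.

Lemma enat_le_lt_trans m n p : enat_le m n -> enat_lt n p -> enat_lt m p.
Proof. by case: m n p => [m|] [n|] [p|] //=; apply: leq_ltn_trans. Qed.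

Lemma reach_arrow (a : arrow Q) : reach 1 (src a) (tgt a).
Proof. by exists a. Qed.

Lemma deg_up_upset D : upset (deg_up D).
Proof.
split=> [l l' j ll h|l a l0 h]; apply: enat_le_trans h _.
  exact: ldeg_mono ll (enat_le_refl _).
exact: ldeg_reach (reach_arrow a) _.
Qed.

Lemma deg_above_upset D : upset (deg_above D).
Proof.
split=> [l l' j ll h|l a l0 h]; apply: enat_lt_le_trans h _.
  exact: ldeg_mono ll (enat_le_refl _).
exact: ldeg_reach (reach_arrow a) _.
Qed.

Lemma pdspec_mono S S' v v' : validS S -> validS S' -> lay_ge S' S ->
  pdspec S v -> pdspec S' v' -> enat_le v v'.
Proof.
move=> vS vS' ge [[-> _]|[k [j [kL c -> m]]]] h'; first by case: v' h'.
rewrite enat_leNgt; apply/negP => lt.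
have [|_ nc] := @upset_rigid S S' (deg_up (ldeg L k.+1 (clen j))) vS vS' ge (deg_up_upset _).
  move=> k' j' kL' up c'; case: h' => [[_ n]|[k1 [j1 [kL1 c1 e1 m1]]]]; first exact: n c'.
  move: lt; rewrite e1 enat_ltSS => lt.
  have := enat_lt_le_trans (enat_le_lt_trans (m1 _ _ kL' c') lt) up.
  by case: (ldeg _ _ _) => //= d; rewrite ltnn.
exact: (nc k j kL (enat_le_refl _)) c.
Qed.

(** Let [D] be the largest degree of a critical pair of [S'] and [(j, k.+1)] such
    a pair. If [S] has no simple at [j] in that layer, then a path of length
    [k.+1] ending in [j] starts in a vertex [i'] that belongs to the top of [S']
    but not to the top of [S]. Some copy of it in a positive layer of [S] has been
    moved, and its degree is at least [D] because of the path; a larger degree is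
    excluded because above [D] the layerings agree. *)
Lemma pdspec_larger S S' v v' : validS S -> validS S' -> lay_ge S' S ->
  pdspec S v -> pdspec S' v' -> enat_lt v v' ->
  exists (j : vertex Q) (l : 'I_L.+1),
    [/\ (1 <= l)%N, (0 < S l j)%N & v' = enat_succ (ldeg L l (clen j))].
Proof.
move=> vS vS' ge hv [[-> _]|[k [j [kL c -> m]]]] lt; first by case: v lt hv.
set D := ldeg L k.+1 (clen j) in lt m *.
(* such a pair would make the projective dimension of S at least that of S' *)
have ncS k' j' : (k' < L)%N -> deg_up D k'.+1 j' -> ~ critS S k' j'.
  move=> kL' up c'; case: hv => [[_ n]|[k1 [j1 [kL1 c1 e1 m1]]]]; first exact: n c'.
  move: lt; rewrite e1 enat_ltSS => lt.
  have := enat_lt_le_trans (enat_le_lt_trans (m1 _ _ kL' c') lt) up.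
  by case: (ldeg _ _ _) => //= d; rewrite ltnn.
(* D is the largest degree of a critical pair of S' *)
have [|rigid _] := @upset_rigid S S' (deg_above D) vS vS' ge (deg_above_upset _).
  move=> k' j' kL' up c'; have := enat_lt_le_trans up (m _ _ kL' c').
  by case: (D) => //= d; rewrite ltnn.
have found l i : (0 < l <= L)%N -> (0 < lay S l i)%N -> ldeg L l (clen i) = D ->
    exists (j : vertex Q) (l : 'I_L.+1),
    [/\ (1 <= l)%N, (0 < S l j)%N & enat_succ D = enat_succ (ldeg L l (clen j))].
  move=> /andP[l0 lL] Sl <-; rewrite -ltnS in lL.
  by exists i, (Ordinal lL); rewrite -layE.
case: (posnP (lay S k.+1 j)) => [S0|]; last by move=> h; apply: (found k.+1 j).
have [i' [ti ri]] : exists i, (0 < lay S' 0 i)%N /\ reach k.+1 i j.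
  apply/free_lay_reach => /=; apply: leq_ltn_trans (leq0n _) (leq_trans c _).
  by apply: leq_sum => a _; apply: lay_free => //; apply: ltnW.
have Si : lay S 0 i' = 0%N.
  apply/eqP; rewrite -leqn0 leqNgt; apply/negP => h.
  have : (0 < free_lay S k.+1 j)%N by apply/free_lay_reach; exists i'.
  have [rigS _] := @upset_rigid S S (deg_up D) vS vS (conj (fun _ => erefl) (fun _ _ => leqnn _))
    (deg_up_upset _) ncS.
  by have [_ ->] := rigS k.+1 j kL (enat_le_refl _); rewrite S0.
have [l [hl gt]] : exists l, (0 < l <= L)%N /\ (lay S' l i' < lay S l i')%N.
  apply: contrapT => no; have := ge.1 i'; apply/eqP; rewrite /cum neq_ltn.
  rewrite !big_ord_recl Si add0n; apply/orP; left.
  apply: leq_ltn_trans (_ : _ <= \sum_(i < L) lay S' (bump 0 i) i')%N _; last first.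
    by rewrite -[X in (X < _)%N]add0n ltn_add2r.
  apply: leq_sum => l _; rewrite leqNgt; apply/negP => h; apply: no.
  by exists (bump 0 l); rewrite /bump /= add1n ltn_ord.
apply: (found l i') => //; first exact: leq_ltn_trans gt.
have up : enat_le D (ldeg L l (clen i')).
  by apply: ldeg_reach ri _; rewrite leq_addr.
apply: enat_le_anti => //; rewrite enat_leNgt; apply/negP => h.
by have [e _] := rigid l i' hl h; rewrite e ltnn in gt.
Qed.
End Compare.

(** * Cutting a forest *)

Section ForestLayers.
Variables (Q : quiver) (L d : nat) (F : forest Q L d) (S : ssseq Q L).
Hypothesis cF : forall l j, lay_count F l j = lay S l j.

Lemma forest_layering (K : fieldType) (w : 'I_d -> K) : (forall y, w y != 0) ->
  has_radical_layering (repmod (frep F w) : lmodType (tpalg K Q L)) S.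
Proof.
move=> w0; apply: dim_layering => l j; rewrite dim_frep_step // -layE -cF //.
Qed.

Let Y (k : nat) j : {set 'I_d} := finset (fun y => (fv F y == j) && (flam F y == k.+1)).
Let Z (k : nat) j : {set arrow Q * 'I_d} :=
  finset (fun p => [&& tgt p.1 == j, fv F p.2 == src p.1 & flam F p.2 == k]).

Lemma card_pairs k j : #|Z k j| = (\sum_(a | tgt a == j) lay S k (src a))%N.
Proof.
under eq_bigr => a _ do rewrite -cF /lay_count -sum1_card.
rewrite pair_big_dep /= sum1_card; apply: eq_card => p.
by rewrite inE.
Qed.

Lemma card_children k j : #|Y k j| = lay S k.+1 j.
Proof. by rewrite -cF; apply: eq_card => x; rewrite inE. Qed.

Lemma forest_children k j :
  [/\ #|fpar F @: Y k j| = #|Y k j|, fpar F @: Y k j \subset Some @: Z k j &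
      #|Some @: Z k j| = #|Z k j|].
Proof.
have parY y : y \in Y k j -> exists2 p, fpar F y = Some p & p \in Z k j.
  rewrite inE => /andP[/eqP vy /eqP ly]; case e: (fpar F y) => [[a x]|].
    have [h1 h2 h3] := fparS e; exists (a, x) => //; rewrite inE /= -h1 vy h2 !eqxx /=.
    by apply/eqP/succn_inj; rewrite -h3.
  by have := fparN e; rewrite ly.
split; last by rewrite card_imset //; apply: Some_inj.
  apply: card_in_imset => y y' /parY[p e _] _ e'.
  by apply: fpar_inj (e) _; rewrite -e'.
by apply/fintype.subsetP => _ /imsetP[y /parY[p -> pZ] ->]; apply: imset_f.
Qed.

(** Vectors of level [k.+1] at [j] correspond to their parents, so a critical pair
    is a pair of an arrow and a vector that is not the parent of anything along
    this arrow. *)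
Lemma forest_crit k j : critS S k j <-> exists a x,
  [/\ tgt a = j, fv F x = src a, flam F x = k & forall y, fpar F y <> Some (a, x)].
Proof.
rewrite /critS -card_pairs -card_children; have [e1 sub e2] := forest_children k j.
rewrite -e1 -e2 ltnNge; split=> [h|[a [x [aj vx lx no]]]].
  have : ~~ (Some @: Z k j \subset fpar F @: Y k j).
    by apply: contra h => /subset_leq_card.
  move=> /fintype.subsetPn[_ /imsetP[[a x] + ->] no]; rewrite inE /= => /and3P[/eqP aj /eqP vx /eqP lx].
  exists a, x; split=> // y e; case/imsetP: no; exists y => //.
  by have [h1 h2 h3] := fparS e; rewrite inE h1 aj h3 lx !eqxx.
rewrite -ltnNge; apply: proper_card; rewrite properE sub; apply/fintype.subsetPn.
exists (Some (a, x)); first by apply: imset_f; rewrite inE /= aj vx lx !eqxx.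
by apply/negP => /imsetP[y _ e]; apply: (no y).
Qed.

End ForestLayers.

Section Cut.
Variables (Q : quiver) (L d : nat) (F : forest Q L d) (y0 : 'I_d).

Fixpoint below_rec n y : bool :=
  (y == y0) || (if n is n'.+1 then
    (if fpar F y is Some (_, x) then below_rec n' x else false) else false).
(** The vectors of the tree with root [y0]. *)
Definition below y := below_rec (flam F y) y.

Lemma belowS y a x : fpar F y = Some (a, x) -> below y = (y == y0) || below x.
Proof. by move=> e; rewrite /below; have [_ _ ->] := fparS e; rewrite /= e. Qed.

Lemma belowN y : fpar F y = None -> below y = (y == y0).
Proof. by move=> e; rewrite /below (fparN e) /= orbF. Qed.

Lemma below_reach y : below y ->
  (flam F y0 <= flam F y)%N /\ reach (flam F y - flam F y0) (fv F y0) (fv F y).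
Proof.
have [n] : exists n, flam F y = n by exists (flam F y).
elim: n y => [|n IHn] y hn; case e: (fpar F y) => [[a x]|].
- by have [_ _] := fparS e; rewrite hn.
- by rewrite (belowN e) => /eqP ->; rewrite subnn.
- have [h1 h2 h3] := fparS e; rewrite (belowS e) => /orP[/eqP ->|]; first by rewrite subnn.
  have lx : flam F x = n by apply/succn_inj; rewrite -h3.
  move=> /(IHn x lx)[le r]; rewrite h3 (leq_trans le (leqnSn _)); split=> //.
  by rewrite subSn //=; exists a; rewrite // -h2.
- by have := fparN e; rewrite hn.
Qed.

Definition cut_par y := if y == y0 then None else fpar F y.
Definition cut_lam y := if below y then (flam F y - flam F y0)%N else flam F y.

Lemma cut_parS y a x : cut_par y = Some (a, x) ->
  [/\ fv F y = tgt a, fv F x = src a & cut_lam y = (cut_lam x).+1].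
Proof.
rewrite /cut_par; case: eqP => // yy0 e; have [h1 h2 h3] := fparS e.
split=> //; rewrite /cut_lam (belowS e); move/eqP/negPf: yy0 => ->; rewrite orFb.
by case: ifP => // /below_reach[le _]; rewrite h3 subSn.
Qed.

Lemma below_self : below y0.
Proof. by rewrite /below; case: (flam F y0) => [|n] /=; rewrite eqxx. Qed.

Lemma cut_parN y : cut_par y = None -> cut_lam y = 0%N.
Proof.
rewrite /cut_par /cut_lam; case: eqP => [->|/eqP/negPf yy0] e.
  by rewrite below_self subnn.
by rewrite (belowN e) yy0 (fparN e).
Qed.

Lemma cut_par_inj y y' p : cut_par y = Some p -> cut_par y' = Some p -> y = y'.
Proof. by rewrite /cut_par; case: eqP => // _; case: eqP => // _; apply: fpar_inj. Qed.

Lemma cut_lam_le y : (cut_lam y <= flam F y)%N.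
Proof. by rewrite /cut_lam; case: ifP => // _; apply: leq_subr. Qed.

Lemma cut_lamL y : (cut_lam y <= L)%N.
Proof. exact: leq_trans (cut_lam_le y) (flamL F y). Qed.

Definition cut : forest Q L d := Forest cut_parS cut_parN cut_par_inj cut_lamL.

Variable S : ssseq Q L.
Hypothesis cF : forall l j, lay_count F l j = lay S l j.

Definition cutS : ssseq Q L := fun l => [ffun j => lay_count cut l j].

Lemma cut_count l j : lay_count cut l j = lay cutS l j.
Proof.
case: (ltnP L l) => h.
  rewrite lay_big //; apply: eq_card0 => x; rewrite !inE /=.
  by apply/negbTE; rewrite negb_and neq_ltn (leq_ltn_trans (cut_lamL x) h) orbT.
by rewrite -ltnS in h; rewrite -[l]/(val (Ordinal h)) layE ffunE.
Qed.

Lemma forest_cum (G : forest Q L d) (T : ssseq Q L) n j :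
  (forall l i, lay_count G l i = lay T l i) ->
  cum T n j = #|[pred x | (fv G x == j) && (flam G x < n)%N]|.
Proof.
move=> cG; elim: n => [|n IHn].
  rewrite /cum big_ord0; apply/esym/eq_card0 => x.
  by rewrite !inE ltn0 andbF.
rewrite /cum big_ord_recr /= -/(cum T n j) IHn -cG /lay_count.
rewrite -[RHS](cardID [pred x | (flam G x < n)%N]); congr (_ + _)%N; apply: eq_card => x.
  by rewrite !inE -andbA; congr (_ && _); apply/idP/andP => [h|[]] //; split=> //; apply: ltnW.
rewrite !inE; case: (fv G x == j) => //=; rewrite -?leqNgt ?andbF //.
by rewrite ltnS andbC eqn_leq andbC.
Qed.

Lemma cut_ge : lay_ge cutS S.
Proof.
split=> [j|n j]; rewrite (forest_cum _ _ cF) (forest_cum _ _ cut_count).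
  apply: eq_card => x; rewrite !inE /= !ltnS flamL.
  by rewrite cut_lamL.
apply: subset_leq_card; apply/fintype.subsetP => x; rewrite !inE => /andP[-> h] /=.
exact: leq_ltn_trans (cut_lam_le x) h.
Qed.

(** Cutting at [y0] creates the critical pair that ends in [y0]. Every other
    critical pair was there before, in a layer at least as large, or it prolongs
    a path of maximal length [L] through [y0]; in that case the part of the path
    that follows [y0] bounds its degree by that of [y0]. *)
Lemma cut_pdspec v : (0 < flam F y0)%N -> pdspec S v ->
  enat_lt v (enat_succ (ldeg L (flam F y0) (clen (fv F y0)))) ->
  pdspec cutS (enat_succ (ldeg L (flam F y0) (clen (fv F y0)))).
Proof.
move=> l0 hv lt; right; set D := ldeg _ _ _ in lt *.
case e0: (fpar F y0) => [[a0 x0]|]; last by rewrite (fparN e0) in l0.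
have [h1 h2 h3] := fparS e0.
have nb : below x0 = false.
  by apply/negP => /below_reach[]; rewrite h3 ltnn.
exists (flam F x0), (fv F y0); split.
- by rewrite -h3; apply: flamL.
- apply/(forest_crit cut_count); exists a0, x0; split=> //=.
    by rewrite /cut_lam nb.
  move=> y; rewrite /cut_par; case: eqP => // yy0 e; exact: yy0 (fpar_inj e e0).
- by rewrite -h3.
rewrite -h3 -/D => k j kL /(forest_crit cut_count)[a [x [aj vx lx no]]].
(* either the arrow [a] led from [x] to [y0], or to no basis vector at all *)
case: (pselect (exists y, fpar F y = Some (a, x))) => [[y e]|no'].
  have yy0 : y = y0.
    by apply/eqP/negP => /negP/negPf yy0; apply: (no y); rewrite /= /cut_par yy0.
  move: e; rewrite yy0 e0 => -[ea ex]; subst a x.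
  by move: lx; rewrite /= /cut_lam nb => <-; rewrite -h3 -aj -h1 enat_le_refl.
case: (ltnP (flam F x) L) => hx.
  have c : critS S (flam F x) j.
    by apply/(forest_crit cF); exists a, x; split=> // y e; apply: no'; exists y.
  have le : enat_le (ldeg L k.+1 (clen j)) (ldeg L (flam F x).+1 (clen j)).
    by apply: ldeg_mono (enat_le_refl _); rewrite ltnS -lx; apply: cut_lam_le.
  apply: enat_le_trans le _; case: hv => [[_ n]|[k1 [j1 [kL1 c1 e1 m1]]]]; first by case: (n _ _ hx c).
  apply: enat_le_trans (m1 _ _ hx c) _; apply: enat_ltW.
  by move: lt; rewrite e1 enat_ltSS.
(* now [x] was in the last layer and the shift of its tree made room for [a] *)
have eL : flam F x = L by apply/eqP; rewrite eqn_leq flamL.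
have bx : below x by apply: contraLR kL => nb'; rewrite -lx /= /cut_lam (negPf nb') eL ltnn.
have [le r] := below_reach bx.
have ek : (k = L - flam F y0)%N by rewrite -lx /= /cut_lam bx eL.
apply: (@ldeg_reach _ _ k.+1); last exact: leq_addr.
by exists a => //; rewrite eL -ek -[fv F x]/(fv cut x) vx in r.
Qed.

End Cut.

(** * Semicontinuity *)

Section Generators.
Variables (Q : quiver) (d : nat).

Fixpoint rsize l : nat := if l is l'.+1 then #|{: arrow Q * 'I_(rsize l')}| else d.

(** The rows of [rgen x l] are the transposes of vectors that span [J^l], for the
    representation given by [x]. Over a polynomial ring this provides minors that
    are polynomial in the coordinates of [x]. *)
Fixpoint rgen (R : comPzRingType) (x : generator Q -> 'M[R]_d) l : 'M[R]_(rsize l, d) :=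
  match l return 'M[R]_(rsize l, d) with
  | 0 => 1%:M
  | l'.+1 => \matrix_(k, t)
      (rgen x l' *m (x (inr (enum_val k).1))^T) (enum_val k).2 t
  end.

Definition rgenv (R : comPzRingType) (x : generator Q -> 'M[R]_d) l j := rgen x l *m (x (inl j))^T.

Lemma map_rgen (R S : comPzRingType) (f : {rmorphism R -> S}) (x : generator Q -> 'M[R]_d) l :
  map_mx f (rgen x l) = rgen (fun g => map_mx f (x g)) l.
Proof.
elim: l => [|l IHl] /=; first by rewrite map_mx1.
by apply/matrixP=> k t; rewrite !mxE -IHl rmorph_sum; apply: eq_bigr => i _; rewrite rmorphM !mxE.
Qed.

Lemma map_rgenv (R S : comPzRingType) (f : {rmorphism R -> S}) (x : generator Q -> 'M[R]_d) l j :
  map_mx f (rgenv x l j) = rgenv (fun g => map_mx f (x g)) l j.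
Proof. by rewrite /rgenv map_mxM map_rgen map_trmx. Qed.

Lemma rgenS (K : fieldType) (x : generator Q -> 'M[K]_d) l :
  (rgen x l.+1 :=: \sum_a <<rgen x l *m (x (inr a))^T>>)%MS.
Proof.
apply/eqmxP/andP; split.
  apply/row_subP=> k; apply: (submx_trans _ (sumsmx_sup (enum_val k).1 _ (submx_refl _))) => //; rewrite genmxE.
  have -> : row k (rgen x l.+1) = row (enum_val k).2 (rgen x l *m (x (inr (enum_val k).1))^T).
    by apply/rowP=> t; rewrite [LHS]mxE [RHS]mxE [LHS]mxE.
  exact: row_sub.
apply/sumsmx_subP=> a _; rewrite genmxE; apply/row_subP=> i.
have -> : row i (rgen x l *m (x (inr a))^T) = row (enum_rank (a, i)) (rgen x l.+1).
  by apply/rowP=> t; rewrite [LHS]mxE [RHS]mxE [RHS]mxE enum_rankK.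
exact: row_sub.
Qed.

Lemma dim_rank (K : fieldType) n (U : {vspace 'cV[K]_d}) (B : 'M[K]_(n, d)) :
  (forall u : 'cV[K]_d, (u \in U) = (u^T <= B)%MS) -> \dim U = \rank B.
Proof.
move=> h; pose g (c : 'rV[K]_(\rank B)) : 'cV[K]_d := (c *m row_base B)^T.
have gl : linear g by move=> c u v; rewrite /g mulmxDl -scalemxAl linearP.
pose gL := GRing.isLinear.Build K 'rV[K]_(\rank B) 'cV[K]_d _ g gl.
pose G : 'Hom('rV[K]_(\rank B), 'cV[K]_d) := linfun (HB.pack_for {linear 'rV[K]_(\rank B) -> 'cV[K]_d} g gL).
have GE c : G c = g c by rewrite lfunE.
have G0 : lker G = 0%VS.
  apply/eqP; rewrite -subv0; apply/subvP=> c; rewrite memv_ker GE memv0 => /eqP e.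
  have : c *m row_base B = 0 by rewrite -[LHS]trmxK -/(g c) e trmx0.
  by move/eqP; rewrite mulmx_free_eq0 ?row_base_free.
have <- : limg G = U.
  apply/vspaceP=> u; rewrite h; apply/memv_imgP/idP => [[c _ ->]|].
    by rewrite GE /g trmxK; apply: submx_trans (submxMl _ _) _; rewrite eq_row_base.
  rewrite -(eq_row_base B) => /submxP[c e]; exists c; first exact: memvf.
  by rewrite GE /g -e trmxK.
by rewrite limg_dim_eq ?G0 ?capv0 // dimvf dim_matrix; apply: mul1n.
Qed.

Lemma mem_prep (K : fieldType) L (x : point K Q d) (hx : point_rel L x) l (u : 'cV[K]_d) :
  (u \in Jpow (prep hx) l) = (u^T <= rgen x l)%MS.
Proof.
elim: l u => [|l IHl] u; first by rewrite submx1; apply: memvf.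
rewrite (rgenS x l); apply/memv_sumP/sub_sumsmxP => [[f fJ ->]|[D e]].
  have hD a : exists D, (f a)^T = D *m <<rgen x l *m (x (inr a))^T>>%MS.
    have /memv_imgP[m + ->] := fJ a isT; rewrite IHl => h.
    by apply/submxP; rewrite genmxE prepX trmx_mul submxMr.
  have [D DE] := choice hD; exists D.
  by rewrite linear_sum; apply: eq_bigr => a _; apply: DE.
have hC a : exists C, D a *m <<rgen x l *m (x (inr a))^T>>%MS = C *m (rgen x l *m (x (inr a))^T).
  by apply/submxP; apply: submx_trans (submxMl _ _) _; rewrite genmxE.
have [C CE] := choice hC.
exists (fun a => x (inr a) *m (C a *m rgen x l)^T) => [a _|].
  rewrite -[_ *m _](prepX (hx := hx)); apply: memv_img; rewrite IHl trmxK; exact: submxMl.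
apply: trmx_inj; rewrite e linear_sum; apply: eq_bigr => a _ /=.
by rewrite trmx_mul trmxK CE mulmxA.
Qed.

Lemma dim_prep (K : fieldType) L (x : point K Q d) (hx : point_rel L x) l j :
  \dim (vpart j (Jpow (prep hx) l)) = \rank (rgenv x l j).
Proof.
suff H (u : 'cV[K]_d) : (u \in vpart j (Jpow (prep hx) l)) = (u^T <= rgenv x l j)%MS.
  exact: (dim_rank H).
apply/memv_imgP/submxP => [[m + ->]|[D e]].
  rewrite mem_prep => /submxP[D e]; exists D.
  by rewrite prepE trmx_mul e mulmxA.
exists (D *m rgen x l)^T; first by rewrite mem_prep trmxK submxMl.
by rewrite prepE; apply: trmx_inj; rewrite e trmx_mul trmxK mulmxA.
Qed.

Lemma exists_minor (K : fieldType) m n (A : 'M[K]_(m, n)) :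
  exists (f : 'I_(\rank A) -> 'I_m) (g : 'I_(\rank A) -> 'I_n), \det (mxsub f g A) != 0.
Proof.
have cols r (B : 'M[K]_(r, n)) : row_free B ->
    exists g : 'I_r -> 'I_n, row_free (rowsub g B^T).
  move=> Bf; have e : \rank B^T = r by rewrite mxrank_tr; apply/eqP.
  have : exists g : 'I_(\rank B^T) -> 'I_n, row_free (rowsub g B^T).
    by exists (maxrankfun B^T); apply: maxrowsub_free.
  by rewrite e.
have [g hg] := cols _ _ (maxrowsub_free A).
exists (maxrankfun A), g; rewrite -unitfE -unitmxE -unitmx_tr -row_free_unit.
by apply: etrans hg; congr row_free; apply/matrixP=> i k; rewrite !mxE.
Qed.

Lemma minor_vanish (K : fieldType) m n r (A : 'M[K]_(m, n)) (f : 'I_r -> 'I_m) (g : 'I_r -> 'I_n) :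
  (\rank A < r)%N -> \det (mxsub f g A) = 0.
Proof.
move=> h; apply/eqP; apply: contraLR h => hd; rewrite -leqNgt.
have <- : \rank (mxsub f g A) = r by apply: mxrank_unit; rewrite unitmxE unitfE.
have -> : mxsub f g A = rowsub f (rowsub g A^T)^T by apply/matrixP=> i k; rewrite !mxE.
apply: leq_trans (mxrankS (rowsub_sub _ _)) _; rewrite mxrank_tr.
by apply: leq_trans (mxrankS (rowsub_sub _ _)) _; rewrite mxrank_tr.
Qed.

End Generators.

Section Evaluation.
Import mpoly.
Local Notation coord := Defs.coord.
Variables (K : fieldType) (Q : quiver) (d : nat).
Local Notation N := #|coordinate Q d|.
Local Notation MP := (mpoly.mpoly N K).

Definition generic_point : generator Q -> 'M[MP]_d :=
  fun g => \matrix_(i, k) mpoly.mpolyX K (mpoly.mnm1 (enum_rank (g, i, k) : 'I_N)).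

Lemma coord_rank (R : fieldType) (y : point R Q d) g i k :
  coord y (enum_rank (g, i, k)) = y g i k.
Proof. by rewrite /coord enum_rankK. Qed.

Lemma generic_mmap (F : fieldType) (iota : {rmorphism K -> F}) (y : point F Q d) l j :
  map_mx (mpoly.mmap iota (coord y)) (rgenv generic_point l j) = rgenv y l j.
Proof.
rewrite (map_rgenv (mpoly.mmap iota (coord y))).
suff -> : (fun g => map_mx (mpoly.mmap iota (coord y)) (generic_point g)) = y by [].
apply/funext=> g; apply/matrixP => i k; rewrite !mxE.
by rewrite [LHS]mpoly.mmapX mpoly.mmap1U coord_rank.
Qed.

Lemma mmap_morph (A B : comNzRingType) (iota : K -> A) (h : 'I_N -> A) (phi : {rmorphism A -> B}) f :
  phi (mpoly.mmap iota h f) = mpoly.mmap (phi \o iota) (phi \o h) f.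
Proof.
rewrite /mpoly.mmap rmorph_sum; apply: eq_bigr => m _; rewrite rmorphM.
by congr (_ * _); rewrite rmorph_prod; apply: eq_bigr => i _; rewrite rmorphXn.
Qed.

End Evaluation.

Section Semicontinuity.
Import mpoly.
Local Notation coord := Defs.coord.
Variables (K : fieldType) (Q : quiver) (L : nat) (S : ssseq Q L).
Local Notation d := (tdim S).

Lemma sum_layer_cum (F : fieldType) (r : qrep F Q L) (T : ssseq Q L) l j :
  has_radical_layering (repmod r : lmodType (tpalg F Q L)) T -> (l <= L.+1)%N ->
  (\dim (vpart j (Jpow r l)) + cum T l j = cum T L.+1 j)%N.
Proof.
move=> h; have step k : (k <= L)%N ->
    \dim (vpart j (Jpow r k)) = (lay T k j + \dim (vpart j (Jpow r k.+1)))%N.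
  rewrite -ltnS => hk; rewrite -[k]/(val (Ordinal hk)) layE; exact: layering_dim.
move=> hl; have [n en] : exists n, (L.+1 - l = n)%N by exists (L.+1 - l)%N.
elim: n l hl en => [|n IHn] l hl en.
  have -> : l = L.+1 by lia.
  by rewrite Jpow_nil /vpart limg0 dimv0 add0n.
rewrite step; last by lia.
rewrite -(IHn l.+1); [|lia|lia].
rewrite [in RHS]/cum big_ord_recr /= -/(cum T l j); lia.
Qed.

Lemma ModS_rank (F : fieldType) (y : point F Q d) l j : ModS F S y -> (l <= L.+1)%N ->
  (\rank (rgenv y l j) + cum S l j = cum S L.+1 j)%N.
Proof.
move=> [My [M rM hM]] hl; have hy := Mod_d_point_rel My.
have [f bf] := represents_iso hy rM.
have [g [fK gK]] := linear_iso_inv bf.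
have bg : bijective g by exists f.
rewrite -(dim_prep hy); apply: sum_layer_cum => //; exact: layering_iso bg hM.
Qed.

(** Ranks are detected by minors, which are polynomials over the ground field
    that vanish on the points of Mod(S) over every extension field. *)
Lemma closure_rank x l j : variety_closure K S x -> (l <= L.+1)%N ->
  (\rank (rgenv x l j) + cum S l j <= cum S L.+1 j)%N.
Proof.
move=> [Mx hx] hl; rewrite leqNgt; apply/negP => lt.
have [f [g /negP[]]] := exists_minor (rgenv x l j).
pose D := \det (mxsub f g (rgenv (@generic_point K Q d) l j)).
have E (F : fieldType) (iota : {rmorphism K -> F}) (y : point F Q d) :
    mpoly.mmap iota (coord y) D = \det (mxsub f g (rgenv y l j)).
  rewrite /D -(det_map_mx (mpoly.mmap iota (coord y))) map_mxsub.
  by rewrite generic_mmap.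
rewrite -[in X in is_true X](E K idfun x); apply/eqP; apply: hx => F iota y My.
rewrite E; apply: minor_vanish; have := ModS_rank j My hl; lia.
Qed.

Definition rep_layering (r : qrep K Q L) : ssseq Q L :=
  fun l => [ffun j => (\dim (vpart j (Jpow r l)) - \dim (vpart j (Jpow r l.+1)))%N].

Lemma rep_layeringP (r : qrep K Q L) :
  has_radical_layering (repmod r : lmodType (tpalg K Q L)) (rep_layering r).
Proof.
by apply: dim_layering => l j; rewrite ffunE subnK // dimvS // vpartS // Jpow_sub.
Qed.

Lemma layering_tdim (r : qrep K Q L) T :
  has_radical_layering (repmod r : lmodType (tpalg K Q L)) T ->
  \dim (fullv : {vspace r}) = tdim T.
Proof.
move=> h; rewrite (dim_vstable (@vstable_full _ _ _ r)).
rewrite sum_lay exchange_big /=; apply: eq_bigr => j _.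
by have := sum_layer_cum j h (leq0n _); rewrite /cum big_ord0 addn0.
Qed.

Lemma ModS_intro d' (x : point K Q d') (hx : point_rel L x) T :
  has_radical_layering (repmod (prep hx) : lmodType (tpalg K Q L)) T -> ModS K T !=set0.
Proof.
move=> h; have e := layering_tdim h.
have {}e : d' = tdim T by rewrite -e dimvf dim_matrix; apply/esym/muln1.
move: x hx h; rewrite e => x hx h; exists x; split; first exact: point_rel_Mod_d.
by exists (repmod (prep hx) : lmodType (tpalg K Q L)); first exact: prep_represents.
Qed.

(** The dimensions of [e_j J^l] do not exceed those prescribed by [S]. For [l = 0]
    they have the same total, and so are equal. *)
Lemma closure_layering x (hx : point_rel L x) : variety_closure K S x ->
  ssseq_ge (rep_layering (prep hx)) S.
Proof.
move=> cx; have h := rep_layeringP (prep hx); apply/ssseq_geP.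
have le n j : (n <= L.+1)%N -> (cum S n j + cum (rep_layering (prep hx)) L.+1 j <=
    cum (rep_layering (prep hx)) n j + cum S L.+1 j)%N.
  move=> hn; have := closure_rank j cx hn; rewrite -(dim_prep hx).
  have := sum_layer_cum j h hn; lia.
have tot (T : ssseq Q L) : tdim T = (\sum_j cum T L.+1 j)%N.
  by rewrite sum_lay exchange_big.
have et : tdim (rep_layering (prep hx)) = d.
  by rewrite -(layering_tdim h) dimvf dim_matrix; apply: muln1.
have le0 j : (cum (rep_layering (prep hx)) L.+1 j <= cum S L.+1 j)%N.
  by have := le 0%N j isT; rewrite /cum !big_ord0 !add0n.
have eq j : cum S L.+1 j = cum (rep_layering (prep hx)) L.+1 j.
  apply/eqP; rewrite eqn_leq le0 andbT leqNgt; apply/negP => lt.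
  have : (\sum_i cum (rep_layering (prep hx)) L.+1 i < \sum_i cum S L.+1 i)%N.
    rewrite (bigD1 j) //= [X in (_ < X)%N](bigD1 j) //= -addSn.
    by apply: leq_add => //; apply: leq_sum => i _.
  by rewrite -!tot et ltnn.
split=> // n j; case: (leqP n L.+1) => hn; first by have := le n j hn; rewrite eq; lia.
have big (T : ssseq Q L) : cum T n j = cum T L.+1 j.
  rewrite /cum -!(big_mkord xpredT (fun m => lay T m j)) (big_cat_nat (n := L.+1)) //=; last exact: ltnW.
  have -> : (\sum_(L.+1 <= m < n) lay T m j = 0)%N; last by rewrite addn0.
  rewrite big_nat_cond big1 // => m /andP[/andP[hm _] _]; exact: lay_big.
by rewrite !big eq.
Qed.

End Semicontinuity.

(** * Degenerating a forest module along a line *)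

Section Curve.
Import mpoly.
Local Notation coord := Defs.coord.
Variables (K : fieldType) (Q : quiver) (L : nat) (S : ssseq Q L).
Local Notation d := (tdim S).
Variables (F : forest Q L d) (y0 : 'I_d).
Hypothesis cF : forall l j, lay_count F l j = lay S l j.

Definition cutw (A : pzRingType) (t : A) (y : 'I_d) : A := if y == y0 then t else 1.

Lemma forest_ModS (E : fieldType) (w : 'I_d -> E) : (forall y, w y != 0) ->
  ModS E S (fpt F w).
Proof.
move=> w0; split; first exact: (point_rel_Mod_d (fpt_rel F w)).
exists (repmod (frep F w) : lmodType (tpalg E Q L)); first exact: prep_represents.
exact: forest_layering.
Qed.

Lemma cut_point : fpt (cut F y0) (fun=> 1 : K) = fpt F (cutw (0 : K)).
Proof.
apply/funext=> -[v|a]; apply/matrixP=> y x; rewrite !mxE //= /cut_par /cutw.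
by case: (y == y0) => //; case: ifP.
Qed.

(** Coordinates of the line of weighted forest modules, with the variable as the
    weight of the edge that leads to [y0]. *)
Definition curve_coord (i : 'I_#|coordinate Q d|) : {poly K} :=
  let t := enum_val i in
  match t.1.1 with
  | inl v => ((t.1.2 == t.2) && (fv F t.2 == v))%:R
  | inr a => if fpar F t.1.2 == Some (a, t.2) then cutw 'X t.1.2 else 0
  end.

Lemma curve_coordE (E : fieldType) (phi : {rmorphism {poly K} -> E}) i :
  phi (curve_coord i) = coord (fpt F (cutw (phi 'X))) i.
Proof.
rewrite /curve_coord /coord; case: (enum_val i) => -[[v|a] y] x /=; rewrite mxE.
  by rewrite rmorph_nat.
by case: ifP; rewrite ?rmorph0 // /cutw; case: ifP; rewrite ?rmorph1.
Qed.

Definition curve_poly (f : mpoly #|coordinate Q d| K) : {poly K} :=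
  mmap (@polyC K) curve_coord f.

Lemma curve_polyE (E : fieldType) (phi : {rmorphism {poly K} -> E}) f :
  phi (curve_poly f) = mmap (phi \o @polyC K) (coord (fpt F (cutw (phi 'X)))) f.
Proof.
rewrite /curve_poly mmap_morph; congr mmap; apply/funext => i; exact: curve_coordE.
Qed.

Lemma curve_poly_eval t f : (curve_poly f).[t] = meval (coord (fpt F (cutw t))) f.
Proof.
rewrite -[LHS]/(horner_eval t (curve_poly f)) curve_polyE /= {2}/horner_eval hornerX.
rewrite /meval; congr mmap; apply/funext=> c /=; exact: hornerC.
Qed.

Lemma cutw_neq0 (E : fieldType) (t : E) : t != 0 -> forall y, cutw t y != 0.
Proof. by move=> t0 y; rewrite /cutw; case: ifP => // _; apply: oner_neq0. Qed.

(** The variable is a nonzero weight in the field of rational functions, so a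
    polynomial that vanishes on Mod(S) over this field vanishes identically along
    the line, and in particular at 0. *)
Lemma cut_point_variety : variety_closure K S (fpt (cut F y0) (fun=> 1)).
Proof.
split; first exact: (point_rel_Mod_d (fpt_rel _ _)).
move=> f hf; rewrite cut_point -curve_poly_eval.
pose iota : {rmorphism K -> {fraction {poly K}}} := (@FracField.tofrac {poly K}) \o (@polyC K).
have X0 : (FracField.tofrac ('X : {poly K})) != 0 by rewrite tofrac_eq0 polyX_eq0.
have := hf _ iota _ (forest_ModS (cutw_neq0 X0)).
rewrite -(curve_polyE (@FracField.tofrac {poly K})) => /eqP.
by rewrite tofrac_eq0 => /eqP ->; rewrite horner0.
Qed.

(** Along the line the polynomial vanishes at all the nonzero elements of [K],
    which are more than its degree allows. *)
Lemma cut_point_zariski : infinite_set [set: K] ->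
  zariski_closure L (ModS K S) (fpt (cut F y0) (fun=> 1)).
Proof.
move=> infK; split; first exact: (point_rel_Mod_d (fpt_rel _ _)).
move=> f hf; rewrite cut_point -curve_poly_eval.
suff -> : curve_poly f = 0 by rewrite horner0.
apply/eqP; apply: contraT => g0; set g := curve_poly f in g0 *.
have h0 : 'X * g != 0 by rewrite mulf_neq0 // polyX_eq0.
have [B _ cB] := infinite_set_fset (size ('X * g)) infK.
have := @max_poly_roots _ ('X * g) (enum_fset B) h0.
rewrite fset_uniq => /(_ _ isT) lt.
have hr : all (root ('X * g)) (enum_fset B).
  apply/allP => t _; rewrite /root hornerM hornerX.
  case: (eqVneq t 0) => [->|t0]; first by rewrite mul0r.
  by rewrite curve_poly_eval hf ?mulr0 //; apply: forest_ModS; apply: cutw_neq0.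
by have := lt hr; rewrite ltnNge cB.
Qed.

End Curve.

Section ClosureBasics.
Variables (K : fieldType) (Q : quiver) (L : nat) (S : ssseq Q L).

Lemma ModS_zariski x : ModS K S x -> zariski_closure L (ModS K S) x.
Proof. by move=> hx; split; [case: hx | move=> f; apply]. Qed.

Lemma zariski_variety x : zariski_closure L (ModS K S) x -> variety_closure K S x.
Proof.
move=> [Mx hx]; split=> // f hf; apply: hx => y My.
exact: (hf K idfun y My).
Qed.

End ClosureBasics.

(** * The range of the projective dimension *)

Section Main.
Variables (K : fieldType) (Q : quiver) (L : nat).
Local Notation Lambda := (tpalg K Q L).
Implicit Types S : ssseq Q L.

Lemma pdim_iso (M N : lmodType Lambda) (f : {linear M -> N}) : bijective f -> pdim M = pdim N.
Proof.
move=> bf; have [g [fK gK]] := linear_iso_inv bf; have bg : bijective g by exists f.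
rewrite /pdim; congr enat_inf; apply/funext=> n; apply/propext.
by split; [apply: resolution_iso bf | apply: resolution_iso bg].
Qed.

Lemma ModS_valid S : ModS K S !=set0 -> validS S.
Proof.
move=> [x [Mx [M rM hM]]]; have [f bf] := represents_iso (Mod_d_point_rel Mx) rM.
have [g [fK gK]] := linear_iso_inv bf; have bg : bijective g by exists f.
exact: layering_valid (layering_iso bg hM).
Qed.

Lemma pdim_values_pdspec S v : pdim_values L (ModS K S) v -> pdspec S v.
Proof.
move=> [x [M [[Mx [N rN hN]] rM ->]]]; have hx := Mod_d_point_rel Mx.
have [f bf] := represents_iso hx rM; have [f' bf'] := represents_iso hx rN.
have [g [fK gK]] := linear_iso_inv bf'; have bg : bijective g by exists f'.
rewrite -(pdim_iso bf); exact: layering_pdspec (layering_iso bg hN).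
Qed.

Lemma ModS_pdim_value S : ModS K S !=set0 -> exists v, pdim_values L (ModS K S) v.
Proof. by move=> [x hx]; have [_ [M rM _]] := hx; exists (pdim M), x, M. Qed.

Lemma pdimS_value S : ModS K S !=set0 -> pdim_values L (ModS K S) (pdimS K S).
Proof. by move=> /ModS_pdim_value[v hv]; rewrite /pdimS; case: xgetP => [w _ //|/(_ v)]. Qed.

Lemma pdimS_pdspec S : ModS K S !=set0 -> pdspec S (pdimS K S).
Proof. by move/pdimS_value/pdim_values_pdspec. Qed.

Variables (S : ssseq Q L) (hS : ModS K S !=set0).

Definition larger_values : set enat := [set v | exists S' : ssseq Q L,
  [/\ ssseq_ge S' S, ModS K S' !=set0 & v = pdimS K S']].

Lemma closure_values : pdim_values L (variety_closure K S) `<=` larger_values.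
Proof.
move=> _ [x [M [cx rM ->]]]; have hx := Mod_d_point_rel (proj1 cx).
have h := rep_layeringP (prep hx).
have ne := ModS_intro h.
exists (rep_layering (prep hx)); split=> //; first exact: closure_layering.
have [f bf] := represents_iso hx rM; rewrite -(pdim_iso bf).
exact: pdspec_unique (layering_pdspec h) (pdimS_pdspec ne).
Qed.

Definition jump_values : set enat := [set v | enat_lt (pdimS K S) v /\
  exists (j : vertex Q) (l : 'I_L.+1),
    [/\ (1 <= l)%N, (0 < S l j)%N & v = enat_succ (ldeg L l (clen j))]].

Lemma larger_jump : larger_values `<=` [set pdimS K S] `|` jump_values.
Proof.
move=> _ [S' [/ssseq_geP ge ne ->]].
have vS := ModS_valid hS; have vS' := ModS_valid ne.
have pS := pdimS_pdspec hS; have pS' := pdimS_pdspec ne.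
have le := pdspec_mono vS vS' ge pS pS'.
have [lt|nlt] := boolP (enat_lt (pdimS K S) (pdimS K S')); last first.
  by left; apply: enat_le_anti; rewrite // enat_leNgt.
by right; split=> //; apply: pdspec_larger pS pS' lt.
Qed.

(** The jump is realized in every forest with layering [S], by cutting at any
    vector of the given layer and vertex. *)
Lemma jump_cut v : jump_values v -> exists (F : forest Q L (tdim S)) (y0 : 'I_(tdim S)),
  (forall l j, lay_count F l j = lay S l j) /\ pdspec (cutS F y0) v.
Proof.
move=> [lt [j [l [l0 Sl ev]]]].
have [F [cF _]] := forest_exists (ModS_valid hS).
have : (0 < lay_count F l j)%N by rewrite cF layE.
move=> /card_gt0P[y0]; rewrite inE => /andP[/eqP vy /eqP ly].
exists F, y0; split=> //; rewrite ev -ly -vy; apply: cut_pdspec (pdimS_pdspec hS) _ => //.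
  by rewrite ly.
by rewrite ly vy -ev.
Qed.

Lemma cut_layering (F : forest Q L (tdim S)) (y0 : 'I_(tdim S)) : (forall l j, lay_count F l j = lay S l j) ->
  has_radical_layering (repmod (frep (cut F y0) (fun=> 1 : K)) : lmodType Lambda) (cutS F y0).
Proof.
move=> cF; apply: forest_layering; first exact: cut_count.
by move=> y; apply: oner_neq0.
Qed.

Lemma jump_larger : [set pdimS K S] `|` jump_values `<=` larger_values.
Proof.
move=> v [->|jv].
  exists S; split=> //; apply/ssseq_geP; split=> // n j; exact: leqnn.
have [F [y0 [cF pv]]] := jump_cut jv; have ne := ModS_intro (cut_layering y0 cF).
exists (cutS F y0); split=> //; first exact/ssseq_geP/cut_ge.
exact: pdspec_unique pv (pdimS_pdspec ne).
Qed.

Lemma larger_eq : larger_values = [set pdimS K S] `|` jump_values.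
Proof. by apply/seteqP; split; [apply: larger_jump | apply: jump_larger]. Qed.

(** Both closures lie between Mod(S) together with the cut forest modules and the
    locus where semicontinuity holds. *)
Lemma closed_values (C : set (point K Q (tdim S))) :
  C `<=` variety_closure K S -> ModS K S `<=` C ->
  (forall (F : forest Q L (tdim S)) y0, (forall l j, lay_count F l j = lay S l j) -> C (fpt (cut F y0) (fun=> 1))) ->
  pdim_values L C = larger_values.
Proof.
move=> CV SC hC; apply/seteqP; split=> v.
  by move=> [x [M [/CV cx rM ev]]]; apply: closure_values; exists x, M.
rewrite larger_eq => -[->|/jump_cut[F [y0 [cF pv]]]].
  by have [x [M [/SC cx rM ev]]] := pdimS_value hS; exists x, M.
exists (fpt (cut F y0) (fun=> 1)), (repmod (frep (cut F y0) (fun=> 1 : K)) : lmodType Lambda).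
split; [exact: hC | exact: prep_represents |].
exact: pdspec_unique pv (layering_pdspec (cut_layering y0 cF)).
Qed.

End Main.

Theorem theorem15 (K : fieldType) (Q : quiver) (L : nat) (hL : (1 <= L)%N)
    (S : ssseq Q L) (hS : ModS K S !=set0) :
  [/\ pdim_values L (variety_closure K S)
        = [set v | exists S' : ssseq Q L,
             [/\ ssseq_ge S' S, ModS K S' !=set0 & v = pdimS K S']],
      infinite_set [set: K] ->
        pdim_values L (zariski_closure L (ModS K S))
          = [set v | exists S' : ssseq Q L,
               [/\ ssseq_ge S' S, ModS K S' !=set0 & v = pdimS K S']] &
      [set v | exists S' : ssseq Q L,
         [/\ ssseq_ge S' S, ModS K S' !=set0 & v = pdimS K S']]
        = [set pdimS K S] `|`
          [set v | enat_lt (pdimS K S) v /\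
             exists (j : vertex Q) (l : 'I_L.+1),
               [/\ (1 <= l)%N, (0 < S l j)%N
                 & v = enat_succ (ldeg L l (clen j))]]].
Proof.
split; last exact: larger_eq.
- apply: closed_values => // [x /ModS_zariski|F y0 cF]; first exact: zariski_variety.
  exact: cut_point_variety.
- move=> infK; apply: closed_values => // [x|x|F y0 cF].
  + exact: zariski_variety.
  + exact: ModS_zariski.
  exact: cut_point_zariski.
Qed.
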